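(* Let $(M,d,\mu)$ be a countable, uniformly discrete metric measure space whose measure is comparable to the counting measure and which satisfies the homogeneous volume doubling condition with volume growth function $V_h$ (all as defined in the context). Let $\beta\in(0,2)$ and let $\phi:[0,\infty)\to(0,\infty)$ be a continuous, positive, regularly varying function of index $\beta$ such that $\phi(x)=\left((1+x)\,l(x)\right)^\beta$ for all $x\ge 0$, where $l$ is a slowly varying function. Consider a Markov chain on $M$, reversible with respect to $\mu$, with Dirichlet form $\mathcal{E}$ and jump kernel $J=h_1$ with respect to $\mu$, and suppose there is a constant $C_1>0$ such that $$ C_1^{-1}\frac{1}{V_h(d(x,y))\,\phi(d(x,y))}\le J(x,y)=J(y,x)\le C_1\frac{1}{V_h(d(x,y))\,\phi(d(x,y))}\qquad\text{for all }x,y\in M.$$ Then there exists $C_2>0$ such that for all integers $n\ge 1$ and all $x,y\in M$, $$ h_n(x,y)\le C_2\left(\frac{1}{V_h\!\left(n^{1/\beta}l_{\#}(n^{1/\beta})\right)}\wedge\frac{n}{V_h(d(x,y))\,\phi(d(x,y))}\right)$$ and $$ h_n(x,y)\ge C_2^{-1}\left(\frac{1}{V_h\!\left(n^{1/\beta}l_{\#}(n^{1/\beta})\right)}\wedge\frac{n}{V_h(d(x,y))\,\phi(d(x,y))}\right),$$ where $l_{\#}$ denotes the de Bruijn conjugate of $l$.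
   Context: Space. $(M,d)$ is a countable metric space with a measure $\mu$; write $\mu_x=\mu(\{x\})$. Uniformly discrete: there is $a>0$ with $d(x,y)>a$ for all distinct $x,y\in M$. Comparability with the counting measure: there is $C_\mu\in[1,\infty)$ with $C_\mu^{-1}\le\mu_x\le C_\mu$ for all $x\in M$. Put $B(x,r)=\{y\in M: d(x,y)\le r\}$ and $V(x,r)=\mu(B(x,r))$. Homogeneous volume doubling: there are a non-decreasing function $V_h:[0,\infty)\to(0,\infty)$ and constants $C_D,C_h\ge 1$ such that $V_h(2r)\le C_D V_h(r)$ for all $r>0$, and $C_h^{-1}V_h(r)\le V(x,r)\le C_hV_h(r)$ for all $x\in M$, $r>0$. Chain. $p(x,y)$ are the transition probabilities of a discrete time Markov chain $(X_n)_{n\ge0}$ on $M$, with $\sum_{z\in M}p(x,z)=1$ for all $x$, reversible: $p(x,y)\mu_x=p(y,x)\mu_y$. $p_n(x,y)=\mathbb{P}^x(X_n=y)$ is the $n$-step transition function; $h_n(x,y)=p_n(x,y)/\mu_y$ is the heat kernel and $J=h_1$ is the jump kernel. The associated Dirichlet form is $\mathcal{E}(f,f)=\frac12\sum_{x,y\in M}(f(x)-f(y))^2J(x,y)\mu_x\mu_y$ for $f\in\ell^2(M,\mu)$. Regular variation. $\phi:[0,\infty)\to\mathbb{R}$ is regularly varying of index $\rho\in\mathbb{R}$ if $\lim_{x\to\infty}\phi(\lambda x)/\phi(x)=\lambda^\rho$ for every $\lambda>0$; it is slowly varying if it is regularly varying of index $0$. The de Bruijn conjugate of a positive slowly varying function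 $l$ is a positive slowly varying function $l_{\#}$ with $l(x)\,l_{\#}(x\,l(x))\to1$ and $l_{\#}(x)\,l(x\,l_{\#}(x))\to1$ as $x\to\infty$; it is unique up to asymptotic equivalence at infinity. $s\wedge t=\min(s,t)$. *)

(* Defs.v *)
From HB Require Import structures.
From mathcomp Require Import all_boot all_order all_algebra.
From mathcomp Require Import all_classical all_reals all_analysis.

Set Implicit Arguments.
Unset Strict Implicit.
Unset Printing Implicit Defensive.

Import Order.TTheory GRing.Theory Num.Theory.
Import numFieldNormedType.Exports.

Local Open Scope classical_set_scope.
Local Open Scope ring_scope.

(* The sigma-algebra is not tied to the metric: that every subset is measurable
   has to be assumed separately. *)
#[short(type="measurableMetricType")]
HB.structure Definition MeasurableMetric (d : measure_display)
  (R : numDomainType) := {M of Measurable d M & Metric R M}.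

Section Space.
Context {d : measure_display} {R : realType} {M : measurableMetricType d R}.
Implicit Types (mu : {measure set M -> \bar R}) (Vh : R -> R).

Definition uniformly_discrete (T : metricType R) : Prop :=
  exists2 a : R, 0 < a & forall x y : T, x <> y -> a < mdist x y.

Definition comparable_to_counting mu : Prop :=
  exists2 C : R, 1 <= C &
    forall x : M, ((C^-1)%:E <= mu [set x] <= C%:E)%E.

(* [closed_ball] of the library is the closure of the open ball, which on a
   discrete space may be smaller than the set below. *)
Definition cball (x : M) (r : R) : set M := [set y | mdist x y <= r].

Definition volume mu (x : M) (r : R) : \bar R := mu (cball x r).

(* Functions on [0, +oo[ are total functions R -> R of which only the values
   at nonnegative arguments are constrained. *)
Definition homogeneous_volume_doubling mu Vh : Prop :=
  [/\ forall r : R, 0 <= r -> 0 < Vh r,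
      forall r s : R, 0 <= r -> r <= s -> Vh r <= Vh s,
      exists2 CD : R, 1 <= CD & forall r : R, 0 < r -> Vh (2 * r) <= CD * Vh r &
      exists2 Ch : R, 1 <= Ch & forall (x : M) (r : R), 0 < r ->
        ((Ch^-1 * Vh r)%:E <= volume mu x r <= (Ch * Vh r)%:E)%E].

Definition mass mu (x : M) : R := fine (mu [set x]).

End Space.

Section Chain.
Context {d d' : measure_display} {R : realType}.
Context {M : measurableMetricType d R} {Omega : measurableType d'}.
Implicit Types (mu : {measure set M -> \bar R}) (p : M -> M -> R)
  (P : M -> probability Omega R) (X : nat -> {mfun Omega >-> M}).

Definition transition_probabilities p : Prop :=
  (forall x y, 0 <= p x y) /\
  (forall x, \esum_(z in [set: M]) (p x z)%:E = 1%E).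

(* [P x] is the law of the chain started at [x].  The last clause is the Markov
   property P(X_(n+1) = s_(n+1) | X_0 = s_0, ..., X_n = s_n)
   = p(s_n, s_(n+1)), multiplied out so that conditioning on a null event
   imposes nothing. *)
Definition markov_chain P X p : Prop :=
  [/\ transition_probabilities p,
      forall x, P x (X 0%N @^-1` [set x]) = 1%E &
      forall (x : M) (n : nat) (s : nat -> M),
        P x (\bigcap_(i < n.+2) (X i @^-1` [set s i])) =
        (P x (\bigcap_(i < n.+1) (X i @^-1` [set s i]))
          * (p (s n) (s n.+1))%:E)%E].

Definition reversible mu p : Prop :=
  forall x y, p x y * mass mu x = p y x * mass mu y.

Definition nstep P X (n : nat) (x y : M) : R :=
  fine (P x (X n @^-1` [set y])).

Definition heat_kernel mu P X (n : nat) (x y : M) : R :=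
  nstep P X n x y / mass mu y.

Definition jump_kernel mu P X : M -> M -> R := heat_kernel mu P X 1.

End Chain.

Section RegularVariation.
Context {R : realType}.
Implicit Types (phi l lsharp : R -> R).

Definition regularly_varying phi (rho : R) : Prop :=
  forall lambda : R, 0 < lambda ->
    phi (lambda * x) / phi x @[x --> +oo] --> lambda `^ rho.

Definition slowly_varying l : Prop := regularly_varying l 0.

Definition de_bruijn_conjugate l lsharp : Prop :=
  [/\ forall x : R, 0 <= x -> 0 < lsharp x,
      slowly_varying lsharp,
      l x * lsharp (x * l x) @[x --> +oo] --> (1 : R) &
      lsharp x * l (x * lsharp x) @[x --> +oo] --> (1 : R)].

End RegularVariation.

(* Main.v *)
Require Import Defs.
From mathcomp Require Import all_boot all_order all_algebra.
From mathcomp Require Import all_classical all_reals all_analysis.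
From mathcomp Require Import ring lra zify.
Import Order.TTheory GRing.Theory Num.Theory.
Import numFieldNormedType.Exports.
Local Open Scope classical_set_scope.
Local Open Scope ring_scope.
Set Implicit Arguments.
Unset Strict Implicit.

(** Regular variation and the finite theory.  The proof uses [phi] and [Vh] only
    along a dyadic sequence of radii [r0 * 2 ^ k], through [U k = Vh (r0 * 2 ^ k)]
    and [F k = phi (r0 * 2 ^ k)].  Regular variation of index [beta] in ]0, 2[
    gives [k1 * F k <= F k.+1 <= k2 * F k] with [1 < k1] and [k2 < 4], and
    Baire's theorem makes [phi] comparable with [F k] between consecutive radii
    ([phi_dyadic]).  The equation of the de Bruijn conjugate says that
    [r = n ^ (1 / beta) * lsharp (n ^ (1 / beta))] satisfies [phi r ~ n]
    ([phi_conjugate]), so that [F k] is the time in which the chain covers a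
    distance of order [2 ^ k].  All analysis takes place on finite sets of
    states: the chain killed on leaving a finite set has a symmetric
    sub-stochastic kernel, and its heat kernel and total mass converge to those
    of the chain as the set grows ([restricted_walk], [exhaustion]).  Constants
    must therefore not depend on the finite set.

    On-diagonal bound.  Since [J] dominates a multiple of the uniform kernel on
    balls of radius [2 ^ k], Schur's test gives
    [|P f|^2 <= (1 - q / F k) |f|^2 + C |f|_1^2 / (U k * F k)] for every [k].
    Applied to the heat kernel at increasing scales, this yields
    [h_n <= C / U k] once [n >= c * F k] ([nash_step], [on_diagonal]).

    Off-diagonal upper bound.  A path of length [n] between points at distance
    about [2 ^ j] with a jump of comparable length contributes at most
    [C n / (U j * F j)].  The other paths have jumps at most [2 ^ k], where
    [j - k] is a large constant.  As [k2 < 4], the second moment of these jumps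
    is at most [C 4 ^ k / F k], and a weighted norm inequality controls the walk
    with bounded jumps, on average over its starting point
    ([weighted_step], [average_tail]).  A multiscale argument in time replaces
    the average by a fixed starting point ([point_tail]), and repeated exits
    from balls raise the probability of going far to an arbitrary power
    ([exit_prob_le], [exit_stages]).  This beats the ratio of volumes that
    the on-diagonal bound leaves over ([off_diagonal_upper]).

    Lower bound.  If [F k >= C n], the chain started at [x] is at each time up
    to [n] in the ball of radius [2 ^ k] with probability at least 1/2, by
    [point_tail].  Setting aside a small multiple of the uniform kernel on a ball
    of this size, the paths that use it exactly once, at one of [n] possible
    times, contribute at least [c n / (U k * F k)] whenever [x] and [y] are at
    distance at most [2 ^ k] ([hk_lower]).  The best [k] gives the minimum in the
    statement. *)

(** * Markov operators on a finite set *)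

Section Kernel.
Context {R : realFieldType} {T : finType} (m : T -> R).
Implicit Types (K L : T -> T -> R) (f g : T -> R) (c : R).

Definition kapp K f x : R := \sum_y K x y * m y * f y.
Definition kpow K n f : T -> R := iter n (kapp K) f.
Definition dot f g : R := \sum_x f x * g x * m x.
Definition point_mass x : T -> R := fun y => (y == x)%:R / m x.
Definition hk K n x y : R := kpow K n (point_mass x) y.

Definition sub_markov K :=
  (forall x y, 0 <= K x y) /\ (forall x, \sum_y K x y * m y <= 1).

Hypothesis m_gt0 : forall x, 0 < m x.
Let m_ge0 x : 0 <= m x. Proof. exact: ltW. Qed.

Lemma eq_kpow K n f g : f =1 g -> kpow K n f =1 kpow K n g.
Proof.
move=> fg; elim: n => [//|n IH] x; rewrite /kpow !iterS /kapp.
by apply: eq_bigr => y _; rewrite [iter _ _ _ _]IH.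
Qed.

Lemma kpowS K n f x : kpow K n.+1 f x = kapp K (kpow K n f) x.
Proof. by []. Qed.

Lemma kpowD K a b f : kpow K (a + b) f = kpow K a (kpow K b f).
Proof. by rewrite /kpow iterD. Qed.

Lemma ler_kapp K L f g x : (forall y, 0 <= K x y <= L x y) ->
  (forall y, 0 <= f y <= g y) -> kapp K f x <= kapp L g x.
Proof.
move=> KL fg; apply: ler_sum => y _.
have /andP[K0 {}KL] := KL y; have /andP[f0 {}fg] := fg y.
by apply: ler_pM => //; [rewrite mulr_ge0|rewrite ler_wpM2r].
Qed.

Lemma kapp_ge0 K f x : (forall y, 0 <= K x y) -> (forall y, 0 <= f y) ->
  0 <= kapp K f x.
Proof. by move=> K0 f0; apply: sumr_ge0 => y _; rewrite !mulr_ge0. Qed.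

Lemma kpow_ge0 K n f x : (forall x y, 0 <= K x y) -> (forall y, 0 <= f y) ->
  0 <= kpow K n f x.
Proof.
move=> K0 f0; elim: n x => [//|n IH] x; rewrite kpowS; exact: kapp_ge0.
Qed.

Lemma ler_kpow K L n f g x : (forall x y, 0 <= K x y <= L x y) ->
  (forall y, 0 <= f y <= g y) -> kpow K n f x <= kpow L n g x.
Proof.
move=> KL fg; elim: n x => [|n IH] x; first by have /andP[] := fg x.
rewrite !kpowS; apply: ler_kapp => // y; rewrite IH andbT.
apply: kpow_ge0 => [u v|u]; first by have /andP[] := KL u v.
by have /andP[] := fg u.
Qed.

Lemma kapp_le K f c x : sub_markov K -> 0 <= c -> (forall y, f y <= c) ->
  kapp K f x <= c.
Proof.
move=> [K0 K1] c0 fc.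
apply: (@le_trans _ _ (\sum_y K x y * m y * c)).
  by apply: ler_sum => y _; rewrite ler_wpM2l ?mulr_ge0.
by rewrite -mulr_suml -[leRHS]mul1r ler_wpM2r.
Qed.

Lemma kpow_le K n f c x : sub_markov K -> 0 <= c -> (forall y, f y <= c) ->
  kpow K n f x <= c.
Proof.
move=> KM c0 fc; elim: n x => [//|n IH] x; rewrite kpowS; exact: kapp_le.
Qed.

Lemma kappD K f g x : kapp K (fun y => f y + g y) x = kapp K f x + kapp K g x.
Proof. by rewrite -big_split; apply: eq_bigr => y _; rewrite mulrDr. Qed.

Lemma kappZ K c f x : kapp K (fun y => c * f y) x = c * kapp K f x.
Proof. by rewrite mulr_sumr; apply: eq_bigr => y _; rewrite mulrCA. Qed.

Lemma kpowDf K n f g x : kpow K n (fun y => f y + g y) x = kpow K n f x + kpow K n g x.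
Proof.
elim: n x => [//|n IH] x; rewrite !kpowS -kappD.
by apply: eq_bigr => y _; rewrite IH.
Qed.

Lemma dotC f g : dot f g = dot g f.
Proof. by apply: eq_bigr => x _; rewrite (mulrC (f x)). Qed.

Lemma dot_point_mass f x : dot f (point_mass x) = f x.
Proof.
rewrite /dot (bigD1 x) //= big1 => [|y yx]; rewrite /point_mass.
  by rewrite eqxx addr0 mul1r -mulrA mulVf ?mulr1 // gt_eqF.
by rewrite (negPf yx) mul0r mulr0 mul0r.
Qed.

Lemma dot_kapp K f g : (forall x y, K x y = K y x) ->
  dot (kapp K f) g = dot f (kapp K g).
Proof.
move=> Ks; rewrite /dot /kapp.
under eq_bigr do rewrite mulr_suml mulr_suml.
under [RHS]eq_bigr do rewrite mulr_sumr mulr_suml.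
rewrite exchange_big; apply: eq_bigr => x _; apply: eq_bigr => y _.
by rewrite Ks; ring.
Qed.

Lemma dot_kpow K n f g : (forall x y, K x y = K y x) ->
  dot (kpow K n f) g = dot f (kpow K n g).
Proof.
move=> Ks; elim: n f => [//|n IH] f.
rewrite [kpow K n.+1 g]/kpow iterS -/(kpow K n g) -dot_kapp// -IH.
by rewrite /kpow iterSr.
Qed.

Lemma kpowE K n f x : (forall x y, K x y = K y x) ->
  kpow K n f x = \sum_y hk K n x y * m y * f y.
Proof.
move=> Ks; rewrite -[LHS]dot_point_mass dot_kpow//.
by apply: eq_bigr => y _; rewrite /hk; ring.
Qed.

Lemma hk_sym K n x y : (forall x y, K x y = K y x) -> hk K n x y = hk K n y x.
Proof.
by move=> Ks; rewrite /hk -[LHS]dot_point_mass dot_kpow// dotC dot_point_mass.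
Qed.

Lemma hkD K a b x y : (forall x y, K x y = K y x) ->
  hk K (a + b) x y = \sum_z hk K a x z * m z * hk K b z y.
Proof.
move=> Ks; rewrite hk_sym// {1}/hk kpowD kpowE//.
by apply: eq_bigr => z _; congr (_ * _); rewrite -/(hk _ _ _ _) hk_sym.
Qed.

Lemma point_mass_ge0 x y : 0 <= point_mass x y.
Proof. by rewrite /point_mass divr_ge0. Qed.

Lemma hk_ge0 K n x y : (forall x y, 0 <= K x y) -> 0 <= hk K n x y.
Proof. by move=> K0; apply: kpow_ge0 => // z; exact: point_mass_ge0. Qed.

Lemma ler_hk K L n x y : (forall x y, 0 <= K x y <= L x y) ->
  hk K n x y <= hk L n x y.
Proof. by move=> KL; apply: ler_kpow => // z; rewrite point_mass_ge0 lexx. Qed.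

(** The terms of an n-step path sum in which the difference [J - K] is used at
    least once are grouped by the first time at which it is used. *)
Lemma kpow_perturb K J n f e x : sub_markov K -> 0 <= e ->
  (forall i y, kapp (fun u v => J u v - K u v) (kpow J i f) y <= e) ->
  kpow J n f x <= kpow K n f x + n%:R * e.
Proof.
move=> KM e0 He; elim: n x => [|n IH] x; first by rewrite mul0r addr0.
have -> : kpow J n.+1 f x =
    kapp K (kpow J n f) x + kapp (fun u v => J u v - K u v) (kpow J n f) x.
  rewrite kpowS -big_split; apply: eq_bigr => y _ /=; ring.
have H : kapp K (fun y => kpow J n f y - kpow K n f y) x <= n%:R * e.
  apply: kapp_le => // [|y]; first by rewrite mulr_ge0.
  by rewrite lerBlDl.
have E : kapp K (kpow J n f) x =
    kpow K n.+1 f x + kapp K (fun y => kpow J n f y - kpow K n f y) x.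
  by rewrite kpowS -kappD; apply: eq_bigr => y _; rewrite addrC subrK.
rewrite E -natr1 mulrDl mul1r -!addrA lerD2l.
by apply: lerD => //; exact: He.
Qed.

(** Schur's test: [2 f x f y <= f x ^ 2 + f y ^ 2] and the symmetry of the kernel
    reduce the quadratic form to the row sums. *)
Lemma schur_test G f c : (forall x y, 0 <= G x y) ->
  (forall x y, G x y = G y x) -> (forall x, \sum_y G x y * m y <= c) ->
  dot f (kapp G f) <= c * dot f f.
Proof.
move=> G0 Gs Gc.
have E : \sum_x \sum_y G x y * m x * m y * (f x * f x) <= c * dot f f.
  rewrite /dot mulr_sumr; apply: ler_sum => x _.
  have -> : \sum_y G x y * m x * m y * (f x * f x) =
            (\sum_y G x y * m y) * (f x * f x * m x).
    by rewrite mulr_suml; apply: eq_bigr => y _; ring.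
  by rewrite ler_wpM2r// mulr_ge0// -expr2 sqr_ge0.
have E' : \sum_x \sum_y G x y * m x * m y * (f y * f y) <= c * dot f f.
  rewrite exchange_big (le_trans _ E)//; apply: ler_sum => x _.
  apply: ler_sum => y _; rewrite Gs le_eqVlt; apply/orP; left; apply/eqP; ring.
suff : dot f (kapp G f) *+ 2 <=
    \sum_x \sum_y G x y * m x * m y * (f x * f x) +
    \sum_x \sum_y G x y * m x * m y * (f y * f y) by lra.
rewrite -big_split -sumrMnl; apply: ler_sum => x _ /=.
rewrite -big_split /kapp mulr_sumr mulr_suml -sumrMnl; apply: ler_sum => y _ /=.
have -> : f x * (G x y * m y * f y) * m x = G x y * m x * m y * (f x * f y).
  by ring.
have := sqr_ge0 (f x - f y).
have : 0 <= G x y * m x * m y by rewrite !mulr_ge0.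
move: (G x y * m x * m y) => a a0 b0; have := mulr_ge0 a0 b0; nra.
Qed.

(** A discrete time form of Davies' argument.  The weighted square norm grows
    only by a second order quantity, the mean square relative increment of [w],
    whatever the drift of [w]: after symmetrization the first order part of the
    difference is a product of increments of [f] and of [w], and the squared
    increments of [f] left over by the holding probability [a] absorb it. *)
Lemma weighted_step K (w : T -> R) (b : T -> T -> R) a theta f :
  sub_markov K -> (forall x y, K x y = K y x) ->
  0 < a < 1 -> (forall x, a <= K x x * m x) ->
  (forall x, 0 < w x) ->
  (forall x y, b x y = b y x) ->
  (forall x y, K x y != 0 -> (w y - w x) ^+ 2 <= b x y * (w x * w y)) ->
  (forall x, \sum_y K x y * m y * b x y <= theta) ->
  (forall x, 0 <= f x) ->
  \sum_x w x * kapp K f x ^+ 2 * m x <=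
  (1 + theta / (2 * a)) * \sum_x w x * f x ^+ 2 * m x.
Proof.
move=> [K0 K1] Ks /andP[a0 a1] Ka w0 bs wb btheta f0.
pose H x y := 2 * w x * f x * (f y - f x) + (1 - a) * w x * (f y - f x) ^+ 2.
have stepx x : kapp K f x ^+ 2 <=
    f x ^+ 2 + (\sum_y K x y * m y * H x y) / w x.
  pose Lf := \sum_y K x y * m y * (f y - f x).
  pose Q := \sum_y K x y * m y * (f y - f x) ^+ 2.
  have hL : kapp K f x <= f x + Lf.
    rewrite /kapp /Lf; under [in leRHS]eq_bigr do rewrite mulrBr.
    rewrite sumrB -mulr_suml; have := K1 x; have := f0 x.
    move: (\sum_y K x y * m y) => s; nra.
  have hQ : Lf ^+ 2 <= (1 - a) * Q.
    (* the diagonal term of [Lf] vanishes, and the rest has mass 1 - a *)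
    have [s sE] : exists s, s * (1 - a) = Lf.
      by exists (Lf / (1 - a)); rewrite divfK// subr_eq0 gt_eqF.
    have : 0 <= \sum_(y | y != x) K x y * m y * (f y - f x - s) ^+ 2.
      by apply: sumr_ge0 => y _; rewrite mulr_ge0 ?sqr_ge0// mulr_ge0.
    have -> : \sum_(y | y != x) K x y * m y * (f y - f x - s) ^+ 2 =
        Q - 2 * s * Lf + s ^+ 2 * \sum_(y | y != x) K x y * m y.
      have -> : Q = \sum_(y | y != x) K x y * m y * (f y - f x) ^+ 2.
        by rewrite /Q (bigD1 x)//= subrr expr0n mulr0 add0r.
      have -> : Lf = \sum_(y | y != x) K x y * m y * (f y - f x).
        by rewrite /Lf (bigD1 x)//= subrr mulr0 add0r.
      rewrite !mulr_sumr -sumrB -big_split /=.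
      by apply: eq_bigr => y _; ring.
    have : \sum_(y | y != x) K x y * m y <= 1 - a.
      by have := K1 x; rewrite (bigD1 x)//=; have := Ka x; lra.
    move: (\sum_(y | y != x) K x y * m y) => r hr h.
    have h2 : Q - 2 * s * Lf + s ^+ 2 * (1 - a) >= 0.
      by apply: le_trans h _; rewrite lerD2l ler_wpM2l// sqr_ge0.
    have E : Lf ^+ 2 = (1 - a) * (2 * s * Lf - s ^+ 2 * (1 - a)).
      by rewrite -sE; ring.
    rewrite E ler_pM2l ?subr_gt0//; lra.
  have -> : (\sum_y K x y * m y * H x y) / w x =
      2 * f x * Lf + (1 - a) * Q.
    rewrite /Lf /Q !mulr_sumr -big_split mulr_suml.
    apply: eq_bigr => y _; rewrite /H /=; field; exact: lt0r_neq0.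
  have A0 : 0 <= kapp K f x by apply: kapp_ge0.
  have : kapp K f x ^+ 2 <= (f x + Lf) ^+ 2 by rewrite !expr2; nra.
  rewrite !expr2 in hQ *; lra.
have sumH : \sum_x \sum_y K x y * m x * m y * H x y <=
    \sum_x \sum_y K x y * m x * m y *
      (b x y / (4 * a) * (w x * f x ^+ 2 + w y * f y ^+ 2)).
  suff : (\sum_x \sum_y K x y * m x * m y * H x y) *+ 2 <=
    (\sum_x \sum_y K x y * m x * m y *
      (b x y / (4 * a) * (w x * f x ^+ 2 + w y * f y ^+ 2))) *+ 2 by lra.
  rewrite {1}mulr2n {2}exchange_big -big_split -sumrMnl /=.
  apply: ler_sum => x _; rewrite -big_split -sumrMnl /=.
  apply: ler_sum => y _; rewrite (Ks y x) -mulrnAr.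
  have [->|Kxy] := eqVneq (K x y) 0; first by rewrite !mul0r addr0.
  have {}wb := wb x y Kxy.
  have -> : K x y * m y * m x * H y x = K x y * m x * m y * H y x by ring.
  rewrite -mulrDr ler_wpM2l ?mulr_ge0 //.
  have wx := w0 x; have wy := w0 y; have fx := f0 x; have fy := f0 y.
  rewrite /H; move: (b x y) (w x) (w y) (f x) (f y) wb wx wy fx fy.
  move=> {H stepx btheta} B wx wy gx gy wB wx0 wy0 gx0 gy0.
  have s0 : 0 < wx + wy by lra.
  (* completing the square in [gy - gx] *)
  have h1 : 2 * wx * gx * (gy - gx) + (1 - a) * wx * (gy - gx) ^+ 2 +
      (2 * wy * gy * (gx - gy) + (1 - a) * wy * (gx - gy) ^+ 2) <=
      (wy - wx) ^+ 2 * (gx + gy) ^+ 2 / (4 * a * (wx + wy)).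
    rewrite ler_pdivlMr; last by rewrite !mulr_gt0.
    have := sqr_ge0 (2 * a * (wx + wy) * (gy - gx) + (wy - wx) * (gx + gy)).
    nra.
  apply: le_trans h1 _; rewrite ler_pdivrMr; last by rewrite !mulr_gt0.
  have -> : (B / (4 * a) * (wx * gx ^+ 2 + wy * gy ^+ 2)) *+ 2 *
     (4 * a * (wx + wy)) = 2 * B * (wx * gx ^+ 2 + wy * gy ^+ 2) * (wx + wy).
    by rewrite -mulr_natl; field; exact: lt0r_neq0.
  have B0 : 0 <= B.
    rewrite -(pmulr_lge0 _ (mulr_gt0 wx0 wy0)).
    exact: le_trans (sqr_ge0 _) wB.
  have h2 : (gx + gy) ^+ 2 <= 2 * (gx ^+ 2 + gy ^+ 2).
    by have := sqr_ge0 (gx - gy); lra.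
  apply: le_trans (ler_pM (sqr_ge0 _) (sqr_ge0 _) wB h2) _.
  have -> : B * (wx * wy) * (2 * (gx ^+ 2 + gy ^+ 2)) =
    2 * B * (wx * wy * (gx ^+ 2 + gy ^+ 2)) by ring.
  rewrite -(mulrA (2 * B)) ler_wpM2l ?mulr_ge0//.
  have hx := mulr_ge0 (mulr_ge0 (ltW wx0) (ltW wx0)) (sqr_ge0 gx).
  have hy := mulr_ge0 (mulr_ge0 (ltW wy0) (ltW wy0)) (sqr_ge0 gy).
  lra.
have E1 : \sum_x w x * kapp K f x ^+ 2 * m x <=
    \sum_x w x * f x ^+ 2 * m x + \sum_x \sum_y K x y * m x * m y * H x y.
  rewrite -big_split; apply: ler_sum => x _ /=.
  have -> : \sum_y K x y * m x * m y * H x y =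
     w x * m x * ((\sum_y K x y * m y * H x y) / w x).
    have -> : w x * m x * ((\sum_y K x y * m y * H x y) / w x) =
        m x * \sum_y K x y * m y * H x y by field; exact: lt0r_neq0.
    by rewrite mulr_sumr; apply: eq_bigr => y _; ring.
  have := stepx x; have : 0 < w x * m x by rewrite mulr_gt0.
  nra.
apply: le_trans E1 _; rewrite mulrDl mul1r lerD2l.
apply: le_trans sumH _.
have -> : \sum_x \sum_y K x y * m x * m y *
      (b x y / (4 * a) * (w x * f x ^+ 2 + w y * f y ^+ 2)) =
    \sum_x \sum_y K x y * m x * m y * (b x y / (4 * a) * (w x * f x ^+ 2)) +
    \sum_x \sum_y K x y * m x * m y * (b x y / (4 * a) * (w y * f y ^+ 2)).
  by rewrite -big_split; apply: eq_bigr => x _; rewrite -big_split;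
     apply: eq_bigr => y _ /=; ring.
rewrite [X in _ + X <= _]exchange_big /=.
under [X in _ + X <= _]eq_bigr => x _ do under eq_bigr => y _ do
  rewrite (Ks y x) (bs y x) (mulrAC (K x y)).
rewrite -big_split mulr_sumr; apply: ler_sum => x _ /=.
have -> : \sum_y K x y * m x * m y * (b x y / (4 * a) * (w x * f x ^+ 2)) =
    (\sum_y K x y * m y * b x y) * (w x * f x ^+ 2 * m x / (4 * a)).
  by rewrite mulr_suml; apply: eq_bigr => y _; ring.
have : 0 <= w x * f x ^+ 2 * m x / (4 * a).
  apply: divr_ge0; last by rewrite mulr_ge0// ltW.
  by rewrite mulr_ge0// mulr_ge0 ?sqr_ge0// ltW.
have -> : theta / (2 * a) * (w x * f x ^+ 2 * m x) =
   2 * (theta * (w x * f x ^+ 2 * m x / (4 * a))).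
  by field; exact: lt0r_neq0.
have := btheta x; move: (\sum_y _) => s; move: (_ / _) => t; nra.
Qed.

End Kernel.

(** * Scales and walks *)

Section RealLemmas.
Context {R : archiRealFieldType}.

Lemma exp_unbounded (a X : R) : 1 < a -> exists n, X <= a ^+ n.
Proof.
move=> a1; have d0 : 0 < a - 1 by rewrite subr_gt0.
have H n : 1 + n%:R * (a - 1) <= a ^+ n.
  elim: n => [|n IH]; first by rewrite mul0r addr0 expr0.
  rewrite exprS -natr1; have : 0 <= n%:R * (a - 1) by rewrite mulr_ge0// ltW.
  nra.
have [X0|X0] := leP X 0; first by exists 0%N; rewrite expr0 (le_trans X0).
exists (Num.bound (X / (a - 1))); apply: le_trans (H _).
have : X / (a - 1) < (Num.bound (X / (a - 1)))%:R.
  by rewrite archi_boundP// divr_ge0// ltW.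
by rewrite ltr_pdivrMr//; lra.
Qed.

Lemma expr_decay (z : R) n : 0 <= z <= 1 -> (1 - z) ^+ n * (1 + n%:R * z) <= 1.
Proof.
move=> /andP[z0 z1]; elim: n => [|n IH]; first by rewrite expr0 mul0r addr0 mulr1.
apply: le_trans IH; rewrite exprS -natr1.
have h : 0 <= (1 - z) ^+ n by rewrite exprn_ge0// subr_ge0.
rewrite -mulrA mulrCA ler_wpM2l//.
have : 0 <= n%:R * z ^+ 2 by rewrite mulr_ge0// sqr_ge0.
nra.
Qed.

Lemma expr_growth (C : R) : exists2 E, 0 < E &
  forall (z : R) n, 0 <= z -> n%:R * z <= C -> (1 + z) ^+ n <= E.
Proof.
pose N := (Num.bound (2 * `|C|)).+1; exists (2 ^+ N); first by rewrite exprn_gt0.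
move=> z n z0 nz; have N0 : 0 < N%:R :> R by rewrite ltr0n.
have half (y : R) : 0 <= y -> n%:R * y <= 2^-1 -> (1 + y) ^+ n <= 2.
  move=> y0 ny.
  have H k : (k <= n)%N -> (1 + y) ^+ k * (1 - k%:R * y) <= 1.
    elim: k => [|k IH] kn; first by rewrite expr0 mul0r subr0 mulr1.
    apply: le_trans (IH (ltnW kn)); rewrite exprS -natr1 -mulrA mulrCA.
    rewrite ler_wpM2l//; first by rewrite exprn_ge0// addr_ge0.
    have : 0 <= k%:R * y ^+ 2 by rewrite mulr_ge0// sqr_ge0.
    have := sqr_ge0 y; nra.
  have := H n (leqnn n); have : 0 <= (1 + y) ^+ n by rewrite exprn_ge0// addr_ge0.
  nra.
have zN : 0 <= z / N%:R by rewrite divr_ge0.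
have H k : 1 + k%:R * (z / N%:R) <= (1 + z / N%:R) ^+ k.
  elim: k => [|k IH]; first by rewrite mul0r addr0 expr0.
  rewrite exprS -natr1; have : 0 <= k%:R * (z / N%:R) by rewrite mulr_ge0.
  nra.
have {}H : 1 + z <= (1 + z / N%:R) ^+ N.
  by apply: le_trans (H N); rewrite mulrCA mulfV ?mulr1// gt_eqF.
apply: (@le_trans _ _ ((1 + z / N%:R) ^+ N ^+ n)).
  by rewrite lerXn2r// nnegrE ?exprn_ge0 ?addr_ge0.
rewrite exprAC lerXn2r// ?nnegrE ?exprn_ge0 ?addr_ge0//; apply: half => //.
rewrite mulrA ler_pdivrMr//.
have : 2 * `|C| < N%:R.
  apply: (@lt_le_trans _ _ (Num.bound (2 * `|C|))%:R).
    by rewrite archi_boundP// mulr_ge0.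
  by rewrite ler_nat.
have := ler_norm C; lra.
Qed.

(** The minimum of [n] and the integer part of [t], with the value 0 for
    negative [t]. *)
Lemma largest_below (t : R) n :
  exists n1, [/\ (n1 <= n)%N, n1%:R <= t \/ n1 = 0%N & n1 = n \/ t < n1.+1%:R].
Proof.
elim: n => [|n [n1 [n1n H [E|H2]]]]; first by exists 0%N; split => //; [right|left].
  subst n1; have [h|h] := leP n.+1%:R t; first by exists n.+1; split => //; left.
  by exists n; split => //; right.
by exists n1; split => //; [exact: leqW|right].
Qed.

End RealLemmas.

(** [U k] and [F k] stand for the volume of a ball of radius [2 ^ k] and for the
    time in which the walk covers this distance.  The condition [k2 < 4] says
    that the index of the walk is less than 2. *)
Record scaling (R : archiRealFieldType) := Scaling {
  U : nat -> R;
  F : nat -> R;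
  D : R;
  k1 : R;
  k2 : R;
  U_gt0 : forall k, 0 < U k;
  U_le : forall k, U k <= U k.+1;
  U_dbl : forall k, U k.+1 <= D * U k;
  F_gt0 : forall k, 0 < F k;
  k1_gt1 : 1 < k1;
  k2_lt4 : k2 < 4;
  F_ge : forall k, k1 * F k <= F k.+1;
  F_le : forall k, F k.+1 <= k2 * F k }.

Section ScalingTheory.
Context {R : archiRealFieldType} (S : scaling R).
Local Notation U := (U S).
Local Notation F := (F S).
Local Notation D := (D S).
Local Notation k1 := (k1 S).
Local Notation k2 := (k2 S).

Lemma D_ge1 : 1 <= D.
Proof.
have := le_trans (U_le S 0) (U_dbl S 0).
by rewrite -{1}[U 0]mul1r ler_pM2r ?U_gt0.
Qed.

Lemma D_gt0 : 0 < D. Proof. exact: lt_le_trans ltr01 D_ge1. Qed.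

Lemma k1_gt0 : 0 < k1. Proof. exact: lt_trans ltr01 (k1_gt1 S). Qed.

Lemma k2_gt1 : 1 < k2.
Proof.
apply: lt_le_trans (k1_gt1 S) _; rewrite -(ler_pM2r (F_gt0 S 0)).
exact: le_trans (F_ge S 0) (F_le S 0).
Qed.

Lemma k2_gt0 : 0 < k2. Proof. exact: lt_trans ltr01 k2_gt1. Qed.

Lemma U_mono j i : (i <= j)%N -> U i <= U j.
Proof.
move=> /subnK <-; elim: (j - i)%N => [//|q IH].
by rewrite addSn (le_trans IH)// U_le.
Qed.

Lemma U_grow q i : U (i + q) <= D ^+ q * U i.
Proof.
elim: q => [|q IH]; first by rewrite addn0 expr0 mul1r.
rewrite addnS exprS -mulrA (le_trans (U_dbl _ _))// ler_wpM2l//.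
exact: ltW D_gt0.
Qed.

Lemma F_grow q i : k1 ^+ q * F i <= F (i + q).
Proof.
elim: q => [|q IH]; first by rewrite addn0 expr0 mul1r.
rewrite addnS exprS -mulrA (le_trans _ (F_ge _ _))// ler_wpM2l//.
exact: ltW k1_gt0.
Qed.

Lemma F_growr q i : F (i + q) <= k2 ^+ q * F i.
Proof.
elim: q => [|q IH]; first by rewrite addn0 expr0 mul1r.
rewrite addnS exprS -mulrA (le_trans (F_le _ _))// ler_wpM2l//.
exact: ltW k2_gt0.
Qed.

Lemma F_mono j i : (i <= j)%N -> F i <= F j.
Proof.
move=> /subnKC <-; apply: le_trans (F_grow _ _).
by rewrite ler_peMl ?(ltW (F_gt0 _ _))// exprn_ege1// ltW// k1_gt1.
Qed.

Lemma UF_gt0 k : 0 < U k * F k. Proof. by rewrite mulr_gt0 ?U_gt0 ?F_gt0. Qed.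

(** Negative powers of a geometric sequence of ratio [k1] are compared with
    those of [eta], for which [1 / k1 <= eta ^+ 2]; the square root of [1 / k1]
    would also do. *)
Definition eta : R := (1 + k1^-1) / 2.

Lemma eta_gt0 : 0 < eta.
Proof. by rewrite divr_gt0// addr_gt0// invr_gt0 k1_gt0. Qed.

Lemma eta_ge_half : 2^-1 <= eta.
Proof.
have := k1_gt0; rewrite -invr_gt0 /eta => h.
by rewrite ler_pdivlMr// mulVf//; lra.
Qed.

Lemma eta_lt1 : eta < 1.
Proof.
have : k1^-1 < 1 by rewrite invf_lt1 ?k1_gt1 ?k1_gt0.
rewrite /eta; lra.
Qed.

Lemma eta_sq : k1^-1 <= eta ^+ 2.
Proof. by have := sqr_ge0 (1 - k1^-1); rewrite /eta; nra. Qed.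

Lemma eta_small (X : R) : 0 < X -> exists q, eta ^+ q <= X.
Proof.
move=> X0; have [|q Hq] := @exp_unbounded R eta^-1 X^-1.
  by rewrite invf_gt1 ?eta_lt1// eta_gt0.
exists q; move: Hq; rewrite exprVn lef_pV2// posrE ?exprn_gt0 ?eta_gt0//.
Qed.

Lemma eta_decr a b : (a <= b)%N -> eta ^+ b <= eta ^+ a.
Proof.
by move=> ab; rewrite ler_wiXn2l// ltW// ?eta_gt0 ?eta_lt1.
Qed.

(** A finite weighted state space [W] carrying a reversible, possibly
    sub-stochastic, random walk whose jump density at distance about [2 ^ k] is
    comparable with [1 / (U k * F k)].  In the application [W] is a finite
    subset of [M], and mass is lost on leaving it.  Volumes of balls of [W] are
    bounded from above only; the lower volume bound of [M] survives in
    [J_mass_ball], where the part of the ball that is not in [W] contributes lost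
    mass. *)
Record walk (A : R) := Walk {
  pt :> finType;
  m : pt -> R;
  dl : pt -> pt -> R;
  J : pt -> pt -> R;
  A_ge1 : 1 <= A;
  m_ge : forall x, A^-1 <= m x;
  dl_ge0 : forall x y, 0 <= dl x y;
  dlxx : forall x, dl x x = 0;
  dl_sym : forall x y, dl x y = dl y x;
  dl_tri : forall x y z, dl x z <= dl x y + dl y z;
  J_sym : forall x y, J x y = J y x;
  J_le : forall x y, J x y <= A;
  J_up : forall k x y, 2 ^+ k < dl x y -> J x y <= A / (U k * F k);
  J_low : forall k x y, dl x y <= 2 ^+ k -> (A * (U k * F k))^-1 <= J x y;
  vol : forall k x, \sum_(y | dl x y <= 2 ^+ k) m y <= A * U k;
  J_mass : forall x, \sum_y J x y * m y <= 1;
  J_mass_ball : forall k x, \sum_y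
    (J x y - (dl x y <= 2 ^+ k)%R%:R / (A * (U k * F k))) * m y
      <= 1 - (A ^+ 2 * F k)^-1 }.

End ScalingTheory.

(** * On-diagonal upper bound *)

Section Walk.
Context {R : archiRealFieldType} {S : scaling R} {A : R}.
Local Notation walk := (walk S A).
Local Notation U := (U S).
Local Notation F := (F S).
Local Notation D := (D S).
Local Notation k1 := (k1 S).
Local Notation k2 := (k2 S).
Local Notation mm W := (@m R S A W).
Local Notation JJ W := (@J R S A W).

Lemma A_gt0 (W : walk) : 0 < A. Proof. exact: lt_le_trans ltr01 (A_ge1 W). Qed.

Lemma m_gt0 (W : walk) (x : W) : 0 < m x.
Proof. by apply: lt_le_trans (m_ge x); rewrite invr_gt0 (A_gt0 W). Qed.

Lemma m_ge0 (W : walk) (x : W) : 0 <= m x. Proof. exact: ltW (m_gt0 x). Qed.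

Definition lvl (W : walk) k (x y : W) := dl x y <= 2 ^+ k.

(** The part of the kernel that is uniform on balls of radius [2 ^ k]. *)
Definition unif (W : walk) k (x y : W) : R := (lvl k x y)%:R / (A * (U k * F k)).

Lemma AUF_gt0 (W : walk) k : 0 < A * (U k * F k).
Proof. by rewrite mulr_gt0 ?UF_gt0// (A_gt0 W). Qed.

Lemma unif_ge0 (W : walk) k (x y : W) : 0 <= unif k x y.
Proof. by rewrite /unif divr_ge0// ltW// AUF_gt0. Qed.

Lemma lvl_sym (W : walk) k (x y : W) : lvl k x y = lvl k y x.
Proof. by rewrite /lvl dl_sym. Qed.

Lemma unif_le (W : walk) k (x y : W) : unif k x y <= J x y.
Proof.
rewrite /unif; have [h|h] := boolP (lvl k x y); first by rewrite mul1r J_low.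
rewrite mul0r.
have [i hi] := exp_unbounded (dl x y) (ltr1n R 2).
by apply: le_trans (J_low hi); rewrite invr_ge0 ltW// AUF_gt0.
Qed.

Lemma J_ge0 (W : walk) (x y : W) : 0 <= J x y.
Proof. exact: le_trans (unif_ge0 0 _ _) (unif_le _ _ _). Qed.

Lemma sub_markovJ (W : walk) : sub_markov (mm W) (JJ W).
Proof. split; [exact: J_ge0|exact: J_mass]. Qed.

(** Half of a lower bound for the probability of not moving in one step; the
    half makes it smaller than 1. *)
Definition hold : R := (2 * A ^+ 2 * (U 0 * F 0))^-1.

Lemma hold_gt0 (W : walk) : 0 < hold.
Proof. by rewrite invr_gt0 !mulr_gt0 ?exprn_gt0 ?U_gt0 ?F_gt0 ?(A_gt0 W). Qed.

Lemma hold_le (W : walk) (x : W) : 2 * hold <= J x x * m x.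
Proof.
have A0 := A_gt0 W; have UF := UF_gt0 S 0.
have -> : 2 * hold = (A * (U 0 * F 0))^-1 * A^-1.
  by rewrite /hold; field; rewrite !gt_eqF ?U_gt0 ?F_gt0.
apply: ler_pM; rewrite ?invr_ge0 ?(ltW A0) ?(ltW (AUF_gt0 W 0))//.
  by apply: (@J_low _ _ _ _ 0); rewrite dlxx.
exact: m_ge.
Qed.

Lemma hold_lt1 (W : walk) (x : W) : hold < 1.
Proof.
have h1 : J x x * m x <= 1.
  apply: le_trans (J_mass x); rewrite (bigD1 x)//= lerDl.
  by apply: sumr_ge0 => y _; rewrite mulr_ge0 ?J_ge0 ?m_ge0.
have := hold_le x; have := hold_gt0 W; lra.
Qed.

(** The averaging argument behind Nash's inequality: on balls of radius [2 ^ k]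
    the kernel dominates a multiple of the uniform kernel, which has small
    density; Schur's test applies to what remains. *)
Lemma nash_step : exists q C, [/\ 0 < q, 0 < C & forall (W : walk) (x0 : W) k f,
  (forall x, 0 <= f x) -> \sum_x f x * m x <= 1 -> 0 <= 1 - q / F k /\
  dot (mm W) (kapp (mm W) (JJ W) f) (kapp (mm W) (JJ W) f) <=
    (1 - q / F k) * dot (mm W) f f + C / (U k * F k)].
Proof.
have [A0|A0] := leP A 0.
  by exists 1, 1; split => // W; have := A_gt0 W; rewrite ltNge A0.
have h0 : 0 < hold.
  by rewrite invr_gt0 !mulr_gt0 ?exprn_gt0// ?U_gt0 ?F_gt0.
exists (hold / A ^+ 2), (hold / A).
split; rewrite ?divr_gt0 ?exprn_gt0// => W x0 k f f0 f1.
pose J2 (x y : W) := \sum_z J x z * m z * J z y.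
pose G x y := J2 x y - hold * unif k x y.
have aJ (x : W) : hold <= J x x * m x.
  by have := hold_le x; have := hold_gt0 W; lra.
have G0 x y : 0 <= G x y.
  rewrite subr_ge0; apply: (@le_trans _ _ (J x x * m x * J x y)).
    apply: ler_pM (aJ x) (unif_le k x y); [exact: ltW|exact: unif_ge0].
  rewrite /J2 (bigD1 x)//= lerDl; apply: sumr_ge0 => z _.
  by rewrite mulr_ge0 ?J_ge0// mulr_ge0 ?J_ge0 ?m_ge0.
have Gs x y : G x y = G y x.
  rewrite /G /unif lvl_sym; congr (_ - _); apply: eq_bigr => z _.
  by rewrite (J_sym x z) (J_sym z y); ring.
have UF' k' : 0 < F k' by exact: F_gt0.
have Grow x : \sum_y G x y * m y <= 1 - hold / A ^+ 2 / F k.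
  have -> : \sum_y G x y * m y =
      \sum_y J2 x y * m y - hold * \sum_y unif k x y * m y.
    by rewrite mulr_sumr -sumrB; apply: eq_bigr => y _; rewrite /G; ring.
  have h1 : \sum_y J2 x y * m y <= \sum_y J x y * m y.
    under eq_bigr => y _ do rewrite mulr_suml.
    rewrite exchange_big /=; apply: ler_sum => z _.
    have -> : \sum_y J x z * m z * J z y * m y =
        J x z * m z * \sum_y J z y * m y.
      by rewrite mulr_sumr; apply: eq_bigr => y _; ring.
    by rewrite ler_piMr ?J_mass// mulr_ge0 ?J_ge0 ?m_ge0.
  have := J_mass_ball k x; have := J_mass x.
  have -> : \sum_y (J x y - (dl x y <= 2 ^+ k)%R%:R / (A * (U k * F k))) * m y =
     \sum_y J x y * m y - \sum_y unif k x y * m y.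
    by rewrite -sumrB; apply: eq_bigr => y _; rewrite mulrBl.
  have -> : hold / A ^+ 2 / F k = hold * (A ^+ 2 * F k)^-1.
    by field; rewrite !gt_eqF.
  have := hold_lt1 x; have := hold_gt0 W; move: h1.
  move: (\sum_y J2 x y * m y) (\sum_y J x y * m y) (\sum_y unif k x y * m y).
  move=> s1 s2 s3; move: (_^-1) hold => t a; nra.
split.
  apply: le_trans (Grow x0); apply: sumr_ge0 => y _.
  by rewrite mulr_ge0 ?m_ge0.
have -> : dot (mm W) (kapp (mm W) (JJ W) f) (kapp (mm W) (JJ W) f) =
    dot (mm W) f (kapp (mm W) J2 f).
  rewrite dot_kapp; last exact: J_sym.
  apply: eq_bigr => x _; congr (_ * _ * _); rewrite /kapp.
  under eq_bigr => y _ do rewrite mulr_sumr.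
  rewrite exchange_big /=; apply: eq_bigr => y _.
  by rewrite !mulr_suml; apply: eq_bigr => z _; ring.
have -> : dot (mm W) f (kapp (mm W) J2 f) = dot (mm W) f (kapp (mm W) G f) +
    hold * dot (mm W) f (kapp (mm W) (@unif W k) f).
  rewrite /dot /kapp mulr_sumr -big_split; apply: eq_bigr => x _ /=.
  have -> : \sum_y J2 x y * m y * f y = \sum_y G x y * m y * f y +
      hold * \sum_y unif k x y * m y * f y.
    by rewrite mulr_sumr -big_split; apply: eq_bigr => y _ /=; rewrite /G; ring.
  ring.
apply: lerD.
  have h := schur_test (@m_gt0 W) f G0 Gs Grow.
  exact: h.
have -> : hold / A / (U k * F k) = hold * (A * (U k * F k))^-1.
  by field; rewrite !gt_eqF// ?U_gt0.
apply: ler_wpM2l; first exact: ltW (hold_gt0 W).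
have f10 : 0 <= \sum_x f x * m x.
  by apply: sumr_ge0 => x _; rewrite mulr_ge0 ?m_ge0.
apply: (@le_trans _ _ ((A * (U k * F k))^-1 * (\sum_x f x * m x) ^+ 2)); last first.
  by rewrite ler_piMr ?invr_ge0 ?(ltW (AUF_gt0 W k))// expr_le1.
rewrite expr2 mulr_suml mulr_sumr; apply: ler_sum => x _.
rewrite [X in X * m x]mulr_sumr mulr_suml !mulr_sumr; apply: ler_sum => y _.
have -> : f x * (unif k x y * m y * f y) * m x =
   unif k x y * (f x * m x * (f y * m y)) by ring.
rewrite ler_wpM2r ?mulr_ge0 ?m_ge0//.
rewrite /unif; case: (lvl k x y); rewrite ?mul1r ?mul0r ?invr_ge0//.
exact: ltW (AUF_gt0 W k).
Qed.

Lemma hk_le_A (W : walk) n (x y : W) : hk (mm W) (JJ W) n x y <= A.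
Proof.
apply: kpow_le; [exact: m_gt0|exact: sub_markovJ|exact: ltW (A_gt0 W)|].
move=> z; rewrite /point_mass; have := m_gt0 x; have := m_ge x; have := A_gt0 W.
case: eqP => _ A0 h m0; last by rewrite mul0r ltW.
by rewrite mul1r invf_ple.
Qed.

Lemma hk_mass (W : walk) n (x : W) :
  \sum_y hk (mm W) (JJ W) n x y * m y <= 1.
Proof.
have -> : \sum_y hk (mm W) (JJ W) n x y * m y = kpow (mm W) (JJ W) n (fun=> 1) x.
  rewrite kpowE; [|exact: m_gt0|exact: J_sym].
  by apply: eq_bigr => y _; rewrite mulr1.
by apply: kpow_le => //; [exact: m_gt0|exact: sub_markovJ].
Qed.

(** The ball of radius [2 ^ k] controls the decay up to times of order [F k];
    going up one scale multiplies the volume by at most [D], which is beaten by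
    the decay during a large multiple of [F k.+1]. *)
Lemma norm_hk_decay : exists L K, [/\ 0 < L, 0 < K & forall (W : walk) k n (x : W),
  L * F k <= n.+1%:R ->
  dot (mm W) (hk (mm W) (JJ W) n x) (hk (mm W) (JJ W) n x) <= K / U k].
Proof.
have [A0|A0] := leP A 0.
  by exists 1, 1; split => // W; have := A_gt0 W; rewrite ltNge A0.
have [q [C [q0 C0 step]]] := nash_step.
have k0 := k1_gt0 S; have kk := k1_gt1 S.
have kp : 0 < 1 - k1^-1 by rewrite subr_gt0 invf_lt1.
have D0 := D_gt0 S; have D1 := D_ge1 S.
pose L := (2 * D + 2) / ((1 - k1^-1) * q).
pose K := 2 * (C / q) + A * U 0.
have L0 : 0 < L by apply: divr_gt0; [lra|exact: mulr_gt0].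
have K0 : 0 < K.
  have := divr_gt0 C0 q0; have : 0 < A * U 0 by rewrite mulr_gt0 ?U_gt0.
  by rewrite /K; lra.
exists L, K; split => // W k n x.
pose u i := dot (mm W) (hk (mm W) (JJ W) i x) (hk (mm W) (JJ W) i x).
have uS i l : 0 <= 1 - q / F l /\
    u i.+1 <= (1 - q / F l) * u i + C / (U l * F l).
  apply: (step W x l (hk (mm W) (JJ W) i x)) => [y|].
    by apply: hk_ge0 => //; [exact: m_gt0|exact: J_ge0].
  exact: hk_mass.
have uA i : u i <= A.
  have -> : u i = hk (mm W) (JJ W) (i + i) x x.
    rewrite hkD; [|exact: m_gt0|exact: J_sym].
    apply: eq_bigr => y _; rewrite [hk _ _ i y x]hk_sym; [ring|exact: m_gt0|exact: J_sym].
  exact: hk_le_A.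
have iter i t l : u (i + t)%N <= C / q / U l + (1 - q / F l) ^+ t * u i.
  have [r0 _] := uS 0%N l; have Ul := U_gt0 S l; have Fl := F_gt0 S l.
  elim: t => [|t IH].
    by rewrite addn0 expr0 mul1r lerDr ltW// !divr_gt0.
  rewrite addnS; have [_ h] := uS (i + t)%N l; apply: le_trans h _.
  have -> : C / (U l * F l) = q / F l * (C / q / U l).
    by field; rewrite !gt_eqF.
  rewrite exprS.
  apply: (@le_trans _ _ ((1 - q / F l) * (C / q / U l + (1 - q / F l) ^+ t * u i)
      + q / F l * (C / q / U l))); last first.
    by rewrite le_eqVlt; apply/orP; left; apply/eqP; ring.
  by rewrite lerD2r ler_wpM2l.
rewrite -/(u n); elim: k n => [|k IH] n Ln.
  apply: le_trans (uA n) _; rewrite ler_pdivlMr ?U_gt0// /K lerDr.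
  by rewrite mulr_ge0// ltW// divr_gt0.
have Fk := F_gt0 S k; have Fk1 := F_gt0 S k.+1; have Uk := U_gt0 S k.
have Uk1 := U_gt0 S k.+1.
have FF : F k <= k1^-1 * F k.+1.
  by rewrite -(ler_pM2l k0) mulrA mulfV ?gt_eqF// mul1r F_ge.
have [n1 [n1n Hn1 Ln1]] := largest_below (L * F k) n.
have {}Ln1 : L * F k <= n1.+1%:R.
  case: Ln1 => [->|/ltW//]; apply: le_trans Ln.
  by rewrite ler_wpM2l ?(ltW L0)// F_mono.
pose t := (n - n1)%N.
have tE : n = (n1 + t)%N by rewrite subnKC.
have tR : t%:R = n%:R - n1%:R :> R by rewrite natrB.
have [r0 _] := uS 0%N k.+1.
have z0 : 0 <= q / F k.+1 <= 1 by rewrite divr_ge0 ?(ltW q0) ?(ltW Fk1)//; lra.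
have tlow : L * (1 - k1^-1) * F k.+1 - 1 <= t%:R.
  have : n1%:R <= L * (k1^-1 * F k.+1).
    case: Hn1 => [h|->]; first by apply: le_trans h _; rewrite ler_pM2l.
    by rewrite mulr_ge0 ?(ltW L0)// mulr_ge0 ?invr_ge0 ?(ltW k0) ?(ltW Fk1).
  rewrite tR; move: Ln; rewrite -natr1; lra.
have tz : 2 * D + 1 <= t%:R * (q / F k.+1).
  have zE : q / F k.+1 * F k.+1 = q by rewrite divfK// gt_eqF.
  have LE : L * (1 - k1^-1) * q = 2 * D + 2.
    by rewrite /L -mulrA divfK// gt_eqF// mulr_gt0.
  have := z0; move: (q / F k.+1) zE => z zE /andP[z00 z1].
  apply: (@le_trans _ _ ((L * (1 - k1^-1) * F k.+1 - 1) * z)).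
    have -> : (L * (1 - k1^-1) * F k.+1 - 1) * z =
      L * (1 - k1^-1) * (z * F k.+1) - z by ring.
    rewrite zE LE; lra.
  by rewrite ler_wpM2r.
have dec := expr_decay t z0.
rewrite tE; apply: le_trans (iter n1 t k.+1) _.
have un1 : u n1 <= K * D / U k.+1.
  apply: le_trans (IH _ Ln1) _; rewrite -mulrA ler_pM2l//.
  by rewrite ler_pdivlMr// mulrC ler_pdivrMr// U_dbl.
have rt0 : 0 <= (1 - q / F k.+1) ^+ t by rewrite exprn_ge0.
have rt : (1 - q / F k.+1) ^+ t * (2 * D) <= 1.
  by apply: le_trans dec; rewrite ler_wpM2l//; lra.
apply: (@le_trans _ _ (C / q / U k.+1 +
    (1 - q / F k.+1) ^+ t * (K * D / U k.+1))).
  by rewrite lerD2l ler_wpM2l.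
have -> : forall r, C / q / U k.+1 + r * (K * D / U k.+1) =
    (C / q + r * (2 * D) * (K / 2)) / U k.+1 by move=> r; field; rewrite !gt_eqF.
rewrite ler_pM2r ?invr_gt0//.
apply: (@le_trans _ _ (C / q + 1 * (K / 2))).
  by rewrite lerD2l ler_wpM2r// divr_ge0// ltW.
rewrite mul1r /K mulrDl; have : 0 < A * U 0 by rewrite mulr_gt0// U_gt0.
move: (C / q) (A * U 0) => a b; lra.
Qed.

(** The multiple of [F k] that [norm_hk_decay] requires is absorbed by a bounded
    number of scales, and Cauchy-Schwarz bounds the kernel by its values on the
    diagonal. *)
Lemma on_diagonal B : exists2 C, 0 < C &
  forall (W : walk) n k (x y : W), F k <= B * n.+1%:R ->
  hk (mm W) (JJ W) n x y <= C / U k.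
Proof.
have [A0|A0] := leP A 0.
  by exists 1 => // W; have := A_gt0 W; rewrite ltNge A0.
have [L [K [L0 K0 H]]] := norm_hk_decay.
have [j Hj] := exp_unbounded (2 * B * L) (k1_gt1 S).
have D0 := D_gt0 S; have Dj : 0 < D ^+ j by rewrite exprn_gt0.
have kj : 0 < k1 ^+ j by rewrite exprn_gt0// k1_gt0.
exists (K * D ^+ j + A * (D ^+ j * U 0)).
  by rewrite addr_gt0 ?mulr_gt0 ?U_gt0.
move=> W n k x y Fk; have Uk := U_gt0 S k.
have [kltj|jk] := ltnP k j.
  apply: le_trans (hk_le_A n x y) _; rewrite ler_pdivlMr//.
  apply: (@le_trans _ _ (A * (D ^+ j * U 0))); last first.
    by rewrite lerDr mulr_ge0 ?ltW.
  rewrite ler_wpM2l ?(ltW A0)//; apply: le_trans (U_mono _ (ltnW kltj)) _.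
  by have := U_grow S j 0; rewrite add0n.
have norm i : F k <= 2 * B * i.+1%:R ->
    forall z : W, dot (mm W) (hk (mm W) (JJ W) i z) (hk (mm W) (JJ W) i z) <=
    (K * D ^+ j + A * (D ^+ j * U 0)) / U k.
  move=> Fi z; apply: le_trans (H W (k - j)%N i z _) _.
    have := F_grow S j (k - j); rewrite subnK// => Fg.
    rewrite -(ler_pM2l kj) mulrCA.
    apply: (@le_trans _ _ (2 * B * L * i.+1%:R)).
      have -> : 2 * B * L * i.+1%:R = L * (2 * B * i.+1%:R) by ring.
      by rewrite ler_pM2l// (le_trans Fg).
    by rewrite ler_wpM2r.
  have Ukj := U_gt0 S (k - j).
  rewrite ler_pdivrMr// mulrAC ler_pdivlMr//.
  have := U_grow S j (k - j); rewrite subnK// => Ug.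
  apply: (@le_trans _ _ (K * D ^+ j * U (k - j))).
    by rewrite -mulrA ler_wpM2l// ltW.
  rewrite ler_wpM2r ?(ltW Ukj)// lerDl.
  by rewrite mulr_ge0 ?(ltW A0)// mulr_ge0 ?(ltW Dj)// ltW// U_gt0.
have even i : F k <= 2 * B * i.+1%:R -> forall u v : W,
    hk (mm W) (JJ W) (i + i) u v <= (K * D ^+ j + A * (D ^+ j * U 0)) / U k.
  move=> Fi u v.
  rewrite hkD; [|exact: m_gt0|exact: J_sym].
  have := norm i Fi u; have := norm i Fi v; rewrite /dot.
  move: (_ / _) => X hv hu.
  suff : (\sum_z hk (mm W) (JJ W) i u z * m z * hk (mm W) (JJ W) i z v) *+ 2 <=
     \sum_z hk (mm W) (JJ W) i u z * hk (mm W) (JJ W) i u z * m z +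
     \sum_z hk (mm W) (JJ W) i v z * hk (mm W) (JJ W) i v z * m z by lra.
  rewrite -big_split -sumrMnl; apply: ler_sum => z _ /=.
  rewrite [hk _ _ i z v]hk_sym; [|exact: m_gt0|exact: J_sym].
  have := m_ge0 z; have := sqr_ge0 (hk (mm W) (JJ W) i u z - hk (mm W) (JJ W) i v z).
  move: (hk _ _ i u z) (hk _ _ i v z) (m z) => a b c; nra.
have nE : n = (odd n + (n./2 + n./2))%N.
  by rewrite -[LHS]odd_double_half addnn.
have Fh : F k <= 2 * B * (n./2).+1%:R.
  have B0 : 0 < B.
    by rewrite -(pmulr_lgt0 _ (ltr0Sn R n)); apply: lt_le_trans Fk; exact: F_gt0.
  apply: le_trans Fk _; rewrite (mulrC 2) -mulrA ler_pM2l// -natrM ler_nat; clear; lia.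
have Cp : 0 <= (K * D ^+ j + A * (D ^+ j * U 0)) / U k.
  by rewrite divr_ge0 ?addr_ge0 ?mulr_ge0 ?(ltW (U_gt0 _ _)) ?(ltW Dj) ?(ltW A0)// ltW.
rewrite nE; case: (odd n); last by rewrite add0n even.
rewrite hk_sym; [|exact: m_gt0|exact: J_sym].
rewrite add1n /hk kpowS; apply: kapp_le => //; [exact: m_gt0|exact: sub_markovJ|].
by move=> z; exact: even.
Qed.

(** Geometrically decreasing bounds on dyadic annuli are summed from the
    outermost nonempty annulus inwards. *)
Lemma dyadic_sum (W : walk) (x : W) (g : W -> R) (a : nat -> R) (th : R) i0 i :
  0 <= th < 1 -> (forall j, (i0 <= j)%N -> 0 <= a j /\ a j.+1 <= th * a j) ->
  (forall j, (i0 <= j)%N ->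
    \sum_(y | ~~ lvl j x y && lvl j.+1 x y) g y <= a j) ->
  (i0 <= i)%N -> \sum_(y | ~~ lvl i x y) g y <= a i / (1 - th).
Proof.
move=> /andP[th0 th1] ath ha.
have [N HN] : exists N, forall y : W, lvl N x y.
  have [N HN] := exp_unbounded (\sum_y dl x y) (ltr1n R 2).
  exists N => y; apply: le_trans HN; rewrite (bigD1 y)//= lerDl.
  by apply: sumr_ge0 => z _; exact: dl_ge0.
have lvlS j y : lvl j x y -> lvl j.+1 x y.
  move=> /le_trans; apply; rewrite exprS; have : 0 <= 2 ^+ j :> R by exact: exprn_ge0.
  lra.
move=> ii0; have [q] := ubnP (N - i)%N; elim: q i ii0 => // q IH i ii0 Nq.
have [a0 ai] := ath i ii0.
have s0 : 0 < 1 - th by rewrite subr_gt0.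
have [iN|Ni] := ltnP i N; last first.
  rewrite big_pred0 ?divr_ge0 ?(ltW s0)// => y; apply/negbF.
  have : forall q, lvl (N + q) x y.
    by elim=> [|q' IH']; [rewrite addn0 HN|rewrite addnS lvlS].
  by move/(_ (i - N)%N); rewrite subnKC.
rewrite (bigID (lvl i.+1 x)) /=.
apply: (@le_trans _ _ (a i + a i.+1 / (1 - th))).
  apply: lerD; first exact: ha.
  rewrite (eq_bigl (fun y => ~~ lvl i.+1 x y)); first by apply: IH; [lia|lia].
  move=> y; case: (boolP (lvl i.+1 x y)) => h; rewrite ?andbF// andbT.
  by apply/negP => /lvlS; rewrite (negPf h).
rewrite -ler_pdivrMr ?invr_gt0// invrK mulrDl divfK ?gt_eqF//.
have := ai; nra.
Qed.

Lemma vol_lvl (W : walk) k (x : W) : \sum_(y | lvl k x y) m y <= A * U k.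
Proof. exact: vol. Qed.

Lemma tail_J : exists2 C, 0 < C & forall (W : walk) k (x : W),
  \sum_(y | ~~ lvl k x y) J x y * m y <= C / F k.
Proof.
have [A0|A0] := leP A 0.
  by exists 1 => // W; have := A_gt0 W; rewrite ltNge A0.
have D0 := D_gt0 S; have k0 := k1_gt0 S.
have th : 0 <= k1^-1 < 1 by rewrite invr_ge0 ltW// invf_lt1 ?k1_gt1.
have s0 : 0 < 1 - k1^-1 by case/andP: th => _; rewrite subr_gt0.
exists (A ^+ 2 * D / (1 - k1^-1)).
  by rewrite divr_gt0// mulr_gt0// exprn_gt0.
move=> W k x; rewrite mulrAC.
apply: (@dyadic_sum _ _ _ (fun i => A ^+ 2 * D / F i) _ 0 k th) => // i _.
  have Fi := F_gt0 S i; have Fi1 := F_gt0 S i.+1; split.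
    by rewrite divr_ge0 ?mulr_ge0 ?exprn_ge0 ?(ltW A0) ?(ltW D0) ?(ltW Fi).
  rewrite mulrCA ler_wpM2l ?mulr_ge0 ?exprn_ge0 ?(ltW A0) ?(ltW D0)//.
  by rewrite -invfM lef_pV2 ?posrE// ?mulr_gt0// F_ge.
have Fi := F_gt0 S i; have Ui := U_gt0 S i.
apply: (@le_trans _ _ (A / (U i * F i) * (A * U i.+1))).
  apply: (@le_trans _ _ (A / (U i * F i) * \sum_(y | lvl i.+1 x y) m y)).
    rewrite mulr_sumr big_mkcond [leRHS]big_mkcond; apply: ler_sum => y _ /=.
    case: (boolP (lvl i.+1 x y)) => _; rewrite ?andbF// andbT.
    have [h|h] := boolP (lvl i x y) => /=.
      by rewrite mulr_ge0 ?m_ge0// divr_ge0 ?(ltW A0)// ltW// UF_gt0.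
    by rewrite ler_wpM2r ?m_ge0// J_up// ltNge.
  by rewrite ler_wpM2l ?vol_lvl// divr_ge0 ?(ltW A0)// ltW// UF_gt0.
have -> : A / (U i * F i) * (A * U i.+1) = A ^+ 2 * (U i.+1 / U i) / F i.
  by field; rewrite !gt_eqF.
rewrite ler_pM2r ?invr_gt0// ler_pM2l ?exprn_gt0// ler_pdivrMr//.
exact: U_dbl.
Qed.

(** Since [k2 < 4], the truncated second moment is dominated by the largest
    jumps. *)
Lemma moment_J : exists2 C, 0 < C & forall (W : walk) k (x : W),
  \sum_(y | lvl k x y) J x y * m y * (dl x y / 2 ^+ k) ^+ 2 <= C / F k.
Proof.
have [A0|A0] := leP A 0.
  by exists 1 => // W; have := A_gt0 W; rewrite ltNge A0.
have D0 := D_gt0 S; have k0 := k2_gt0 S.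
have th0 : 0 < k2 / 4 by rewrite divr_gt0.
have th1 : k2 / 4 < 1 by rewrite ltr_pdivrMr// mul1r k2_lt4.
have F0 := F_gt0 S 0.
have C0 : 0 < A ^+ 2 * D * k2 by rewrite !mulr_gt0// exprn_gt0.
exists ((F 0 + A ^+ 2 * D * k2) / (1 - k2 / 4)).
  by rewrite divr_gt0 ?subr_gt0// addr_gt0.
have [E EE] : exists E, E = A ^+ 2 * D * k2 by exists (A ^+ 2 * D * k2).
rewrite -EE in C0 *; have E0 := C0.
have s0 : 0 < 1 - k2 / 4 by rewrite subr_gt0.
have E1 : E + (F 0 + E) / (1 - k2 / 4) * (k2 / 4) <= (F 0 + E) / (1 - k2 / 4).
  rewrite -lerBrDr -{1}[X in X - _]mulr1 -mulrBr divfK ?gt_eqF//.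
  by rewrite lerDr ltW.
move=> W k x; elim: k => [|k IH].
  apply: (@le_trans _ _ 1).
    apply: le_trans (J_mass x); rewrite big_mkcond; apply: ler_sum => y _ /=.
    have Jm : 0 <= J x y * m y by rewrite mulr_ge0 ?J_ge0 ?m_ge0.
    rewrite /lvl expr0 divr1; case: ifP => h //.
    by rewrite ler_piMr// expr_le1// dl_ge0.
  rewrite ler_pdivlMr// mul1r. rewrite ler_pdivlMr//; nra.
have Fk := F_gt0 S k; have Fk1 := F_gt0 S k.+1; have Uk := U_gt0 S k.
have p0 : 0 < 2 ^+ k :> R by rewrite exprn_gt0.
rewrite (bigID (lvl k x)) /= ler_pdivlMr//.
apply: le_trans E1; rewrite addrC mulrDl; apply: lerD.
  apply: (@le_trans _ _ (A / (U k * F k) * (A * U k.+1) * F k.+1)).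
    rewrite ler_wpM2r ?(ltW Fk1)//.
    apply: (@le_trans _ _ (A / (U k * F k) * \sum_(y | lvl k.+1 x y) m y)).
      rewrite mulr_sumr big_mkcond [leRHS]big_mkcond; apply: ler_sum => y _ /=.
      case: (boolP (lvl k.+1 x y)) => // h1.
      have [h|h] := boolP (lvl k x y) => /=.
        by rewrite mulr_ge0 ?m_ge0// divr_ge0 ?(ltW A0)// ltW// UF_gt0.
      apply: (@le_trans _ _ (J x y * m y)).
        rewrite ler_piMr ?mulr_ge0 ?J_ge0 ?m_ge0//.
        rewrite expr_le1 ?divr_ge0 ?dl_ge0 ?exprn_ge0//.
        by rewrite ler_pdivrMr ?exprn_gt0// mul1r.
      by rewrite ler_wpM2r ?m_ge0// J_up// ltNge.
    by rewrite ler_wpM2l ?vol_lvl// divr_ge0 ?(ltW A0)// ltW// UF_gt0.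
  have -> : A / (U k * F k) * (A * U k.+1) * F k.+1 =
      A ^+ 2 * ((U k.+1 / U k) * (F k.+1 / F k)).
    by field; rewrite !gt_eqF.
  rewrite EE -(mulrA (A ^+ 2) D) ler_pM2l ?exprn_gt0//; apply: ler_pM.
  - by rewrite divr_ge0 ?(ltW (U_gt0 _ _)).
  - by rewrite divr_ge0 ?(ltW (F_gt0 _ _)).
  - by rewrite ler_pdivrMr// U_dbl.
  - by rewrite ler_pdivrMr// F_le.
apply: (@le_trans _ _ (4^-1 * ((F 0 + E) / (1 - k2 / 4) / F k) * F k.+1)).
  rewrite ler_wpM2r ?(ltW Fk1)//.
  apply: le_trans (_ : _ <= 4^-1 * \sum_(y | lvl k x y)
     J x y * m y * (dl x y / 2 ^+ k) ^+ 2) _; last by rewrite ler_pM2l ?invr_gt0.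
  rewrite mulr_sumr big_mkcond [leRHS]big_mkcond; apply: ler_sum => y _ /=.
  have Jm : 0 <= J x y * m y by rewrite mulr_ge0 ?J_ge0 ?m_ge0.
  case: (boolP (lvl k x y)) => h; rewrite ?andbF// andbT.
  case: ifP => _; last first.
    by rewrite mulr_ge0 ?invr_ge0// mulr_ge0 ?sqr_ge0.
  rewrite le_eqVlt; apply/orP; left; apply/eqP.
  by rewrite (exprS _ k); field; rewrite gt_eqF.
have -> : 4^-1 * ((F 0 + E) / (1 - k2 / 4) / F k) * F k.+1 =
   (F 0 + E) / (1 - k2 / 4) * (F k.+1 / F k / 4).
  by move: (_ / (1 - k2 / 4)) => X; field; rewrite !gt_eqF.
rewrite ler_wpM2l//; first by rewrite divr_ge0 ?(ltW s0)// addr_ge0 ?ltW.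
by rewrite ler_pM2r ?invr_gt0// ler_pdivrMr// F_le.
Qed.

(** * Walks with bounded jumps *)

Lemma lvlxx (W : walk) k (x : W) : lvl k x x.
Proof. by rewrite /lvl dlxx exprn_ge0. Qed.

Definition trunc (W : walk) k (x y : W) : R := if lvl k x y then J x y else 0.

Lemma trunc_bd (W : walk) k (x y : W) : 0 <= trunc k x y <= J x y.
Proof. by rewrite /trunc; case: ifP; rewrite ?lexx ?J_ge0. Qed.

Lemma trunc_ge0 (W : walk) k (x y : W) : 0 <= trunc k x y.
Proof. by have /andP[] := trunc_bd k x y. Qed.

Lemma trunc_sym (W : walk) k (x y : W) : trunc k x y = trunc k y x.
Proof. by rewrite /trunc lvl_sym J_sym. Qed.

Lemma sub_markov_trunc (W : walk) k : sub_markov (mm W) (@trunc W k).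
Proof.
split=> [x y|x]; first exact: trunc_ge0.
apply: le_trans (J_mass x); apply: ler_sum => y _.
by rewrite ler_wpM2r ?m_ge0//; have /andP[] := trunc_bd k x y.
Qed.

Lemma pow_lipschitz (a b t : R) p : 1 <= a -> 1 <= b -> `|b - a| <= t -> t <= 1 ->
  (b ^+ p - a ^+ p) ^+ 2 <= (2 ^+ p) ^+ 2 * t ^+ 2 * (a ^+ p * b ^+ p).
Proof.
wlog ab : a b / a <= b.
  move=> H a1 b1 bat t1; have [ab|/ltW ba] := leP a b; first exact: H.
  have := H b a ba b1 a1; rewrite distrC => /(_ bat t1).
  by rewrite (mulrC (b ^+ p)) -sqrrN opprB.
move=> a1 b1; rewrite ger0_norm ?subr_ge0// => bat t1.
have t0 : 0 <= t by apply: le_trans bat; rewrite subr_ge0.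
have a0 : 0 <= a by apply: le_trans a1.
have H q : (1 + t) ^+ q <= 1 + t * (2 ^+ q - 1).
  elim: q => [|q IH]; first by rewrite !expr0 subrr mulr0 addr0.
  rewrite !exprS; have : 1 <= 2 ^+ q :> R by rewrite exprn_ege1// ler1n.
  have : 0 <= (1 + t) ^+ q by rewrite exprn_ge0// addr_ge0.
  move: IH; move: (2 ^+ q) ((1 + t) ^+ q) => X Y YX Y0 X1.
  have h : 0 <= t * (X - 1) * (1 - t).
    by rewrite !mulr_ge0 ?subr_ge0.
  have : (1 + t) * Y <= (1 + t) * (1 + t * (X - 1)) by rewrite ler_wpM2l ?addr_ge0.
  lra.
have ap : 0 <= a ^+ p by rewrite exprn_ge0.
have abp : a ^+ p <= b ^+ p by rewrite lerXn2r// nnegrE// (le_trans a0).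
have bp : b ^+ p - a ^+ p <= a ^+ p * (2 ^+ p * t).
  have : b ^+ p <= (a * (1 + t)) ^+ p.
    rewrite lerXn2r ?nnegrE ?mulr_ge0 ?addr_ge0//; first exact: le_trans a0 ab.
    have : t <= a * t by rewrite ler_peMl.
    lra.
  rewrite exprMn; have := ler_wpM2l ap (H p).
  have := mulr_ge0 ap t0; lra.
apply: (@le_trans _ _ ((a ^+ p * (2 ^+ p * t)) ^+ 2)).
  by rewrite lerXn2r ?nnegrE ?subr_ge0// !mulr_ge0// exprn_ge0.
have -> : (a ^+ p * (2 ^+ p * t)) ^+ 2 =
  (2 ^+ p) ^+ 2 * t ^+ 2 * (a ^+ p * a ^+ p) by ring.
apply: ler_wpM2l; first by apply: mulr_ge0; exact: sqr_ge0.
exact: ler_wpM2l.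
Qed.

(** A power of the distance to the ball of radius [2 ^ j] around [x0], in units
    of the largest jump [2 ^ k]. *)
Definition weight (W : walk) (x0 : W) j k p (y : W) : R :=
  (1 + Num.max 0 (dl x0 y - 2 ^+ j) / 2 ^+ k) ^+ p.

Lemma weight_ge1 (W : walk) (x0 : W) j k p y : 1 <= weight x0 j k p y.
Proof.
rewrite /weight exprn_ege1// lerDl divr_ge0 ?exprn_ge0//.
by rewrite le_max lexx.
Qed.

(** Up to time [F k] the weight is increased by a bounded factor, because
    [moment_J] bounds its mean square relative increment in one step by a
    multiple of [1 / F k]. *)
Lemma weighted_trunc p : exists2 E, 0 < E & forall (W : walk) (x0 : W) j k n f,
  n%:R <= F k -> (forall x, 0 <= f x) ->
  \sum_x weight x0 j k p x * kpow (mm W) (@trunc W k) n f x ^+ 2 * m x <=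
  E * \sum_x weight x0 j k p x * f x ^+ 2 * m x.
Proof.
have [A0|A0] := leP A 0.
  by exists 1 => // W; have := A_gt0 W; rewrite ltNge A0.
have [C C0 HC] := moment_J.
have [E E0 HE] := @expr_growth R ((2 ^+ p) ^+ 2 * C / (2 * hold)).
exists E => // W x0 j k n f nF f0.
have Fk := F_gt0 S k; have h0 := hold_gt0 W.
pose th := (2 ^+ p) ^+ 2 * C / F k.
have th0 : 0 <= th by rewrite divr_ge0 ?mulr_ge0 ?exprn_ge0 ?(ltW C0) ?(ltW Fk).
pose z := th / (2 * hold).
have z0 : 0 <= z by rewrite divr_ge0// mulr_ge0// ltW.
apply: (@le_trans _ _ ((1 + z) ^+ n *
    \sum_x weight x0 j k p x * f x ^+ 2 * m x)); last first.
  rewrite ler_wpM2r//.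
    apply: sumr_ge0 => x _; rewrite mulr_ge0 ?m_ge0// mulr_ge0 ?sqr_ge0//.
    exact: le_trans (weight_ge1 _ _ _ _ _).
  apply: HE => //; rewrite /z /th.
  have -> : n%:R * ((2 ^+ p) ^+ 2 * C / F k / (2 * hold)) =
      (n%:R / F k) * ((2 ^+ p) ^+ 2 * C / (2 * hold)).
    by field; rewrite !gt_eqF.
  apply: ler_piMl; last by rewrite ler_pdivrMr// mul1r.
  apply: divr_ge0; last by rewrite mulr_ge0// ltW.
  by apply: mulr_ge0; [exact: sqr_ge0|exact: ltW].
elim: n {nF} => [|n IH]; first by rewrite expr0 mul1r.
rewrite exprS -mulrA; apply: le_trans (_ : _ <= (1 + z) *
  \sum_x weight x0 j k p x * kpow (mm W) (@trunc W k) n f x ^+ 2 * m x) _; last first.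
  by rewrite ler_wpM2l// addr_ge0.
under eq_bigr => x _ do rewrite kpowS.
apply: (@weighted_step R W (mm W) (@m_gt0 W) (@trunc W k) _
  (fun x y => (2 ^+ p) ^+ 2 * (dl x y / 2 ^+ k) ^+ 2)) => //.
- exact: sub_markov_trunc.
- exact: trunc_sym.
- by rewrite h0 (hold_lt1 x0).
- move=> x; rewrite /trunc lvlxx; have := hold_le x; lra.
- by move=> x; apply: lt_le_trans (weight_ge1 _ _ _ _ _).
- by move=> x y; rewrite dl_sym.
- move=> x y; rewrite /trunc; case: ifP => [xy _|]; last by rewrite eqxx.
  have p0 : 0 < 2 ^+ k :> R by rewrite exprn_gt0.
  apply: pow_lipschitz; rewrite ?lerDl ?divr_ge0 ?(ltW p0) ?le_max ?lexx//.
    rewrite opprD addrACA subrr add0r -mulrBl normrM normfV (gtr0_norm p0).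
    rewrite ler_pM2r ?invr_gt0//; have := dl_tri x0 x y; have := dl_tri x0 y x.
    rewrite (dl_sym y x); have := dl_ge0 x y.
    by rewrite ler_norml !maxElt; case: ifP; case: ifP; lra.
  by rewrite ler_pdivrMr// mul1r.
- move=> x; rewrite /th -mulrA.
  have -> : \sum_y trunc k x y * m y * ((2 ^+ p) ^+ 2 * (dl x y / 2 ^+ k) ^+ 2) =
      (2 ^+ p) ^+ 2 * \sum_(y | lvl k x y) J x y * m y * (dl x y / 2 ^+ k) ^+ 2.
    rewrite mulr_sumr [RHS]big_mkcond; apply: eq_bigr => y _ /=; rewrite /trunc.
    case: ifP => _; ring.
  by rewrite ler_wpM2l ?sqr_ge0.
- by move=> x; apply: kpow_ge0 => //; [exact: m_gt0|exact: trunc_ge0].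
Qed.

(** On average over the starting point in a ball of radius [2 ^ j], a walk with
    jumps at most [2 ^ k] is unlikely to be outside the ball of twice the
    radius at a time up to [F k].  The bound is for the average only, but it decays faster
    than any given power of [2 ^ (j - k)]. *)
Lemma average_tail p : (0 < p)%N -> D <= 2 ^+ p -> exists2 C, 0 < C &
  forall (W : walk) (x : W) k j n, (k <= j)%N -> n%:R <= F k ->
  \sum_(z | lvl j x z) m z *
    kpow (mm W) (@trunc W k) n (fun y => (~~ lvl j.+1 x y)%:R) z <=
  C * U j / 2 ^+ ((j - k) * p).
Proof.
move=> p0 Dp; have [A0|A0] := leP A 0.
  by exists 1 => // W; have := A_gt0 W; rewrite ltNge A0.
have [E E0 HE] := @weighted_trunc (p * 2).
have D0 := D_gt0 S.
exists (E * A + 2 * A * D ^+ 2).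
  by rewrite addr_gt0 ?mulr_gt0// exprn_gt0.
move=> W x k j n kj nF.
pose g := kpow (mm W) (@trunc W k) n (fun y => (lvl j x y)%:R).
pose w := weight x j k (p * 2).
have w0 y : 0 < w y by apply: lt_le_trans (weight_ge1 _ _ _ _ _).
have g0 y : 0 <= g y by apply: kpow_ge0 => //; [exact: m_gt0|exact: trunc_ge0].
have -> : \sum_(z | lvl j x z) m z *
    kpow (mm W) (@trunc W k) n (fun y => (~~ lvl j.+1 x y)%:R) z =
    \sum_(y | ~~ lvl j.+1 x y) g y * m y.
  transitivity (dot (mm W) (fun y => (lvl j x y)%:R)
     (kpow (mm W) (@trunc W k) n (fun y => (~~ lvl j.+1 x y)%:R))).
    rewrite big_mkcond; apply: eq_bigr => z _ /=.
    by case: (lvl j x z); rewrite ?mul0r// mul1r mulrC.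
  rewrite -dot_kpow; last exact: trunc_sym.
  rewrite [RHS]big_mkcond; apply: eq_bigr => z _ /=.
  by rewrite -/(g z); case: (lvl j.+1 x z); rewrite ?mulr0 ?mul0r ?mulr1.
pose l : R := (2 ^+ ((j - k) * p))^-1.
have l0 : 0 < l by rewrite invr_gt0 exprn_gt0.
have sumw : \sum_y w y * g y ^+ 2 * m y <= E * (A * U j).
  apply: le_trans (HE W x j k n _ nF _) _ => [y|]; first exact: ler0n.
  rewrite ler_pM2l//; apply: le_trans (vol_lvl j x).
  rewrite [leRHS]big_mkcond; apply: ler_sum => y _ /=; rewrite /weight.
  case: ifP => h; last by rewrite expr0n mulr0 mul0r.
  rewrite (_ : Num.max 0 _ = 0) ?mul0r ?addr0 ?expr1n ?mul1r//.
  by apply/max_idPl; rewrite subr_le0.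
have p2 i : 0 < 2 ^+ i :> R by rewrite exprn_gt0.
have sumv : \sum_(y | ~~ lvl j.+1 x y) m y / w y <= 2 * A * D ^+ 2 * U j * l ^+ 2.
  apply: le_trans (@dyadic_sum W x (fun y => m y / w y)
     (fun i => A * U i.+1 / 2 ^+ ((i - k.+1) * (p * 2))) 2^-1 j.+1 j.+1 _ _ _ _) _.
  - by rewrite invr_ge0 ler0n /= invf_lt1// ltr1n.
  - move=> i ji; split.
      by rewrite divr_ge0 ?mulr_ge0 ?(ltW A0) ?(ltW (U_gt0 _ _)) ?(ltW (p2 _)).
    rewrite subSn; last by lia.
    rewrite mulSn exprD.
    have -> : A * U i.+2 / (2 ^+ (p * 2) * 2 ^+ ((i - k.+1) * (p * 2))) =
       A / 2 ^+ ((i - k.+1) * (p * 2)) * (U i.+2 / 2 ^+ (p * 2)).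
      by field; rewrite !gt_eqF.
    have -> : 2^-1 * (A * U i.+1 / 2 ^+ ((i - k.+1) * (p * 2))) =
       A / 2 ^+ ((i - k.+1) * (p * 2)) * (U i.+1 / 2).
      by field; rewrite !gt_eqF.
    rewrite ler_pM2l ?divr_gt0// ler_pdivrMr//.
    apply: le_trans (U_dbl S _) _.
    have h : D * 2 <= 2 ^+ (p * 2).
      rewrite muln2 -addnn exprD; apply: ler_pM => //; first exact: ltW.
      by rewrite -{1}[2]expr1 ler_weXn2l// ler1n.
    have Ui := U_gt0 S i.+1.
    have : D * 2 * U i.+1 <= 2 ^+ (p * 2) * U i.+1 by rewrite ler_pM2r.
    lra.
  - move=> i ji; have ki : (k.+1 <= i)%N by lia.
    have wi y : ~~ lvl i x y -> 2 ^+ ((i - k.+1) * (p * 2)) <= w y.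
      rewrite /lvl -ltNge => h; rewrite exprM lerXn2r ?nnegrE ?(ltW (p2 _))//.
        by rewrite addr_ge0// divr_ge0 ?(ltW (p2 _))// le_max lexx.
      have -> : 2 ^+ (i - k.+1) = 2 ^+ i.-1 / 2 ^+ k :> R.
        rewrite -exprB ?unitfE ?pnatr_eq0//; last by lia.
        by congr (_ ^+ _); lia.
      apply: (@le_trans _ _ (Num.max 0 (dl x y - 2 ^+ j) / 2 ^+ k)); last first.
        by rewrite lerDr.
      rewrite ler_pM2r ?invr_gt0// le_max; apply/orP; right.
      have : 2 ^+ j <= 2 ^+ i.-1 :> R by rewrite ler_weXn2l ?ler1n//; lia.
      have : 2 ^+ i = 2 * 2 ^+ i.-1 :> R by rewrite -exprS prednK//; lia.
      lra.
    apply: (@le_trans _ _ (\sum_(y | lvl i.+1 x y) m y / 2 ^+ ((i - k.+1) * (p * 2)))).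
      rewrite big_mkcond [leRHS]big_mkcond; apply: ler_sum => y _ /=.
      case: (boolP (lvl i x y)) => h1 /=.
        by case: ifP => // _; rewrite divr_ge0 ?m_ge0 ?(ltW (p2 _)).
      case: ifP => // _; rewrite ler_wpM2l ?m_ge0// lef_pV2 ?posrE//.
      exact: wi.
    by rewrite -mulr_suml ler_pM2r ?invr_gt0// vol_lvl.
  - exact: leqnn.
  - have -> : 1 - 2^-1 = 2^-1 :> R by lra.
    rewrite invrK subSS.
    have -> : (2 ^+ ((j - k) * (p * 2)))^-1 = l ^+ 2 :> R.
      by rewrite /l mulnA exprM exprVn.
    have -> : A * U j.+2 * l ^+ 2 * 2 = 2 * A * U j.+2 * l ^+ 2 by ring.
    rewrite ler_pM2r ?exprn_gt0// -(mulrA (2 * A)) ler_pM2l ?mulr_gt0//.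
    by have := U_grow S 2 j; rewrite addn2.
have pt y : ~~ lvl j.+1 x y -> (g y * m y) *+ 2 <=
    l * (w y * g y ^+ 2 * m y) + l^-1 * (m y / w y).
  move=> _; have wy := w0 y; have := sqr_ge0 (l * w y * g y - 1).
  have -> : l * (w y * g y ^+ 2 * m y) + l^-1 * (m y / w y) =
     m y * ((l * w y * g y) ^+ 2 + 1) / (l * w y).
    by field; rewrite !gt_eqF.
  move=> h; rewrite ler_pdivlMr ?mulr_gt0//; have := m_ge0 y.
  have -> : g y * m y *+ 2 * (l * w y) = m y * (2 * (l * w y * g y)).
    by rewrite -mulr_natl; ring.
  move=> m0; rewrite ler_wpM2l//; lra.
suff : (\sum_(y | ~~ lvl j.+1 x y) g y * m y) *+ 2 <=
    ((E * A + 2 * A * D ^+ 2) * U j * l) *+ 2 by rewrite -/l lerMn2r.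
rewrite -sumrMnl; apply: le_trans (ler_sum _ pt) _.
rewrite big_split -!mulr_sumr /=.
apply: (@le_trans _ _ (l * (E * (A * U j)) + l^-1 * (2 * A * D ^+ 2 * U j * l ^+ 2))).
  apply: lerD; last by rewrite ler_pM2l ?invr_gt0.
  rewrite ler_pM2l//; apply: le_trans sumw.
  rewrite [leLHS]big_mkcond; apply: ler_sum => y _ /=; case: ifP => // _.
  by rewrite mulr_ge0 ?m_ge0// mulr_ge0 ?sqr_ge0// ltW.
have -> : l^-1 * (2 * A * D ^+ 2 * U j * l ^+ 2) = 2 * A * D ^+ 2 * U j * l.
  by field; rewrite gt_eqF.
have -> : l * (E * (A * U j)) + 2 * A * D ^+ 2 * U j * l =
   (E * A + 2 * A * D ^+ 2) * U j * l by ring.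
have Cp : 0 < E * A + 2 * A * D ^+ 2 by rewrite addr_gt0 ?mulr_gt0// exprn_gt0.
by rewrite mulr2n lerDl ltW// mulr_gt0// mulr_gt0// U_gt0.
Qed.

(** * Tails at a fixed starting point *)

Local Notation eta := (eta S).

Lemma kpowJ_le1 (W : walk) n f (x : W) : (forall y, f y <= 1) ->
  kpow (mm W) (JJ W) n f x <= 1.
Proof. by move=> f1; apply: kpow_le => //; [exact: m_gt0|exact: sub_markovJ]. Qed.

Lemma kpowJE (W : walk) n f (x : W) :
  kpow (mm W) (JJ W) n f x = \sum_y hk (mm W) (JJ W) n x y * m y * f y.
Proof. by apply: kpowE; [exact: m_gt0|exact: J_sym]. Qed.

Lemma hkJ_ge0 (W : walk) n (x y : W) : 0 <= hk (mm W) (JJ W) n x y.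
Proof. by apply: hk_ge0; [exact: m_gt0|exact: J_ge0]. Qed.

(** Each step has probability at most [C / F k] of being longer than [2 ^ k], by
    [tail_J]. *)
Lemma discard_jumps : exists2 C, 0 < C & forall (W : walk) k n f (x : W),
  (forall y, 0 <= f y) -> (forall y, f y <= 1) ->
  kpow (mm W) (JJ W) n f x <= kpow (mm W) (@trunc W k) n f x + n%:R * (C / F k).
Proof.
have [C C0 HC] := tail_J; exists C => // W k n f x f0 f1.
apply: kpow_perturb; [exact: m_gt0|exact: sub_markov_trunc| |].
  by rewrite divr_ge0 ?(ltW C0)// ltW// F_gt0.
move=> i y; apply: le_trans (HC W k y).
rewrite /kapp [leRHS]big_mkcond; apply: ler_sum => z _ /=; rewrite /trunc.
case: ifP => _; first by rewrite subrr !mul0r.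
rewrite subr0 ler_piMr ?kpowJ_le1// mulr_ge0 ?J_ge0 ?m_ge0//.
Qed.

(** The walk started at [x] is followed at times growing by a factor at least
    [k1 ^+ 2] while the radius of the ball in which it should remain only
    doubles.  Given its position at one of these times, which has density at
    most a constant over the volume of the smaller scale, the average bound
    [average_tail] applies up to the next one; its rapid decay outweighs the
    ratio of the volumes of the two scales. *)
Lemma point_tail : exists2 C, 0 < C & forall (W : walk) n i j (x : W),
  n%:R <= F i -> (i <= j)%N ->
  kpow (mm W) (JJ W) n (fun y => (~~ lvl j x y)%:R) x <= C * eta ^+ (j - i).
Proof.
have [A0|A0] := leP A 0.
  by exists 1 => // W; have := A_gt0 W; rewrite ltNge A0.
have D0 := D_gt0 S; have D1 := D_ge1 S; have kk := k1_gt0 S.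
have e0 := eta_gt0 S; have e1 := eta_lt1 S; have eh := eta_ge_half S.
have [Ct Ct0 HCt] := discard_jumps.
have [p Hp] := exp_unbounded (4 * D ^+ 2) (ltr1n R 2).
have DD : D <= D ^+ 2 by rewrite expr2 ler_peMl// ltW.
have Dp : D <= 2 ^+ p by apply: le_trans Hp; lra.
have p0 : (0 < p)%N.
  by case: p {Dp} Hp => // ; rewrite expr0; lra.
have [Ca Ca0 HCa] := average_tail p0 Dp.
have [Co Co0 HCo] := on_diagonal (1 + F 0).
pose C1 := (Ct + Co * Ca * D ^+ 3) / eta ^+ 2.
have N0 : 0 < Ct + Co * Ca * D ^+ 3.
  by rewrite addr_gt0// !mulr_gt0// exprn_gt0.
have C10 : 0 < C1 by rewrite divr_gt0// exprn_gt0.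
have s0 : 0 < 1 - eta by rewrite subr_gt0.
pose C := (C1 + 1) / (1 - eta).
have C0 : 0 < C by rewrite divr_gt0// addr_gt0.
have Cge1 : 1 <= C.
  rewrite ler_pdivlMr// mul1r; have := ltW C10; lra.
have Crec : C1 + C * eta <= C.
  have : C * (1 - eta) = C1 + 1 by rewrite divfK// gt_eqF.
  lra.
exists C => // W n i.
have [s] := ubnP i; elim: s i n => // s IH i n /ltnSE is_ j x nF ij.
have ind0 (j' : nat) (y : W) : 0 <= (~~ lvl j' x y)%:R :> R by exact: ler0n.
have ind1 (j' : nat) (y : W) : (~~ lvl j' x y)%:R <= 1 :> R by rewrite lern1 leq_b1.
have [->|jni] := eqVneq j i.
  by rewrite subnn expr0 mulr1 (le_trans (kpowJ_le1 _ _ _)).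
have {jni} iltj : (i < j)%N by rewrite ltn_neqAle eq_sym jni.
have [[i2 nlow]|cas] : ((2 <= i)%N /\ n%:R <= F (i - 2)) \/
    exists n1, [/\ (n1 <= n)%N, F (i - 2) <= (1 + F 0) * n1.+1%:R &
      kpow (mm W) (JJ W) n1 (fun y => (~~ lvl j.-1 x y)%:R) x
        <= C * eta ^+ (j - i).+1].
- have [i2|i2] := leqP 2 i; last first.
    right; exists 0%N; split => //.
      have -> : (i - 2 = 0)%N by clear -i2; lia.
      by rewrite mulr1 lerDr.
    by rewrite /kpow /= lvlxx/= mulr_ge0 ?(ltW C0)// exprn_ge0// ltW.
  have [|nF2] := leP n%:R (F (i - 2)); [by left|right].
  have [n1 [n1n Hn1 Hn1']] := largest_below (F (i - 2)) n.
  have Fi := F_gt0 S (i - 2).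
  have n1F : n1%:R <= F (i - 2) by case: Hn1 => // ->; exact: ltW.
  exists n1; split => //.
    case: Hn1' => [E|/ltW h]; first by move: nF2; rewrite -E ltNge n1F.
    apply: le_trans h _; rewrite ler_peMl//; have := F_gt0 S 0; lra.
  have -> : (j - i).+1 = (j.-1 - (i - 2))%N by clear -i2 iltj; lia.
  by apply: IH => //; clear -i2 is_ iltj; lia.
- apply: le_trans (IH (i - 2)%N n _ j x nlow _) _; [clear -i2 is_; lia|clear -iltj; lia|].
  by rewrite ler_pM2l// eta_decr//; clear; lia.
have {cas}[n1 [n1n Fn1 T1]] := cas.
pose n2 := (n - n1)%N.
have nE : n = (n1 + n2)%N by rewrite subnKC.
pose r := ((j - i).-1)./2.
have rq : (r.*2 <= (j - i).-1 < r.*2.+2)%N.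
  by rewrite /r; have := odd_double_half (j - i).-1; clear; case: (odd _); lia.
pose k := (i + r)%N.
have kj : (k <= j.-1)%N by rewrite /k; clear -rq iltj; lia.
have Fk := F_gt0 S k; have Ui := U_gt0 S (i - 2).
have n2F : n2%:R <= F k.
  apply: le_trans (_ : n%:R <= _); first by rewrite ler_nat leq_subr.
  by apply: le_trans nF _; apply: F_mono; rewrite leq_addr.
have HCo' z : hk (mm W) (JJ W) n1 x z <= Co / U (i - 2) by exact: HCo.
pose f (y : W) : R := (~~ lvl j x y)%:R.
rewrite nE kpowD kpowJE.
apply: (@le_trans _ _ (\sum_z (hk (mm W) (JJ W) n1 x z * m z * (n2%:R * (Ct / F k)) +
   (if lvl j.-1 x z then Co / U (i - 2) *
       (m z * kpow (mm W) (@trunc W k) n2 f z) else 0) +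
   hk (mm W) (JJ W) n1 x z * m z * (~~ lvl j.-1 x z)%:R))).
  apply: ler_sum => z _; have hm : 0 <= hk (mm W) (JJ W) n1 x z * m z.
    by rewrite mulr_ge0 ?hkJ_ge0 ?m_ge0.
  have e0' : 0 <= n2%:R * (Ct / F k) by rewrite mulr_ge0// divr_ge0 ?ltW.
  have g0 : 0 <= kpow (mm W) (@trunc W k) n2 f z.
    by apply: kpow_ge0 => //; [exact: m_gt0|exact: trunc_ge0].
  case: ifP => h /=.
    rewrite mulr0 addr0.
    apply: le_trans (ler_wpM2l hm (HCt W k n2 f z (ind0 j) (ind1 j))) _.
    rewrite mulrDr addrC lerD2l mulrA ler_wpM2r// ler_wpM2r ?m_ge0//.
  rewrite addr0 mulr1; apply: le_trans (_ : hk (mm W) (JJ W) n1 x z * m z <= _).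
    by rewrite ler_piMr// kpowJ_le1.
  by rewrite lerDr mulr_ge0.
rewrite 2!big_split /= -!mulr_suml -kpowJE -big_mkcond -mulr_sumr /=.
have half r' : k1^-1 ^+ r' <= (eta ^+ 2) ^+ r'.
  by rewrite lerXn2r ?nnegrE ?invr_ge0 ?(ltW kk) ?exprn_ge0 ?(ltW e0)// eta_sq.
have t1 : (\sum_z hk (mm W) (JJ W) n1 x z * m z) * (n2%:R * (Ct / F k)) <=
    Ct * (eta ^+ 2) ^+ r.
  apply: (@le_trans _ _ (n2%:R * (Ct / F k))).
    by rewrite ler_piMl ?hk_mass// mulr_ge0// divr_ge0 ?ltW.
  rewrite mulrCA ler_pM2l// ler_pdivrMr//.
  apply: le_trans (_ : n%:R <= _); first by rewrite ler_nat leq_subr.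
  apply: le_trans nF _.
  have : k1^-1 ^+ r * F k <= (eta ^+ 2) ^+ r * F k by rewrite ler_pM2r.
  apply: le_trans; rewrite exprVn mulrC ler_pdivlMr ?exprn_gt0//.
  by rewrite mulrC F_grow.
have t2 : Co / U (i - 2) *
    \sum_(z | lvl j.-1 x z) m z * kpow (mm W) (@trunc W k) n2 f z <=
    Co * Ca * D ^+ 3 * (eta ^+ 2) ^+ r.
  apply: (@le_trans _ _ (Co / U (i - 2) * (Ca * U j.-1 / 2 ^+ ((j.-1 - k) * p)))).
    rewrite ler_wpM2l//; first by rewrite divr_ge0 ?ltW.
    have jE : j.-1.+1 = j by clear -iltj; lia.
    by have := HCa W x k j.-1 n2 kj n2F; rewrite jE.
  have Uj : U j.-1 <= D ^+ (r * 2 + 3) * U (i - 2).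
    have := U_grow S (j.-1 - (i - 2)) (i - 2); rewrite subnKC; last by clear -iltj; lia.
    move=> h; apply: le_trans h _; rewrite ler_pM2r// ler_weXn2l//; clear -rq iltj; lia.
  have p2 : 2 ^+ (r * p) <= 2 ^+ ((j.-1 - k) * p) :> R.
    rewrite ler_weXn2l ?ler1n// leq_mul2r; apply/orP; right.
    by rewrite /k; clear -rq iltj; lia.
  have p20 i' : 0 < 2 ^+ i' :> R by rewrite exprn_gt0.
  have -> : Co / U (i - 2) * (Ca * U j.-1 / 2 ^+ ((j.-1 - k) * p)) =
     Co * Ca * (U j.-1 / U (i - 2)) / 2 ^+ ((j.-1 - k) * p).
    by field; rewrite !gt_eqF.
  rewrite ler_pdivrMr//.
  apply: (@le_trans _ _ (Co * Ca * D ^+ (r * 2 + 3))).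
    by rewrite ler_pM2l ?mulr_gt0// ler_pdivrMr.
  have -> : Co * Ca * D ^+ 3 * (eta ^+ 2) ^+ r * 2 ^+ ((j.-1 - k) * p) =
     Co * Ca * (D ^+ 3 * ((eta ^+ 2) ^+ r * 2 ^+ ((j.-1 - k) * p))) by ring.
  rewrite ler_pM2l ?mulr_gt0// addnC exprD ler_pM2l ?exprn_gt0//.
  apply: (@le_trans _ _ ((eta ^+ 2) ^+ r * 2 ^+ (r * p))); last first.
    by rewrite ler_wpM2l// exprn_ge0// exprn_ge0// ltW.
  rewrite mulnC (mulnC r) !exprM -exprMn.
  apply: lerXn2r; rewrite ?nnegrE; [exact: sqr_ge0| |].
    by apply: mulr_ge0; [exact: sqr_ge0|exact: ltW].
  have : 4^-1 <= eta ^+ 2.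
    have : (2^-1) ^+ 2 <= eta ^+ 2.
      by rewrite lerXn2r// nnegrE; [rewrite invr_ge0|exact: ltW].
    by rewrite expr2; lra.
  move=> q4.
  apply: (@le_trans _ _ (4^-1 * 2 ^+ p)); last by rewrite ler_pM2r.
  by have := Hp; lra.
apply: le_trans (lerD (lerD t1 t2) T1) _.
rewrite -mulrDl (exprS _ (j - i)) mulrA.
have : (Ct + Co * Ca * D ^+ 3) * (eta ^+ 2) ^+ r <= C1 * eta ^+ (j - i).
  have -> : C1 * eta ^+ (j - i) =
     (Ct + Co * Ca * D ^+ 3) * (eta ^+ (j - i) / eta ^+ 2).
    by rewrite /C1 mulrAC [RHS]mulrA.
  rewrite ler_pM2l// ler_pdivlMr ?exprn_gt0//.
  by rewrite -exprM -exprD eta_decr//; clear -rq iltj; lia.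
have ej : 0 <= eta ^+ (j - i) by rewrite exprn_ge0// ltW.
have := ler_wpM2r ej Crec; lra.
Qed.

(** * Repeated exits from balls *)

Local Notation P W k := (kpow (mm W) (@trunc W k)).

Lemma ler_tr (W : walk) k n f g (x : W) : (forall y, 0 <= f y <= g y) ->
  P W k n f x <= P W k n g x.
Proof.
move=> fg; apply: ler_kpow => //; first exact: m_gt0.
by move=> u v; rewrite trunc_ge0 lexx.
Qed.

(** Probability that the walk with jumps at most [2 ^ k], started at [z], leaves
    the ball of radius [2 ^ k.+1] around [x0] in [n] steps. *)
Fixpoint exit_prob (W : walk) k (x0 : W) n (z : W) : R :=
  if lvl k.+1 x0 z then
    if n is n'.+1 then kapp (mm W) (@trunc W k) (exit_prob k x0 n') z else 0
  else 1.

Lemma ler_kapp_trunc (W : walk) k f g (z : W) :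
  (forall y, lvl k z y -> f y <= g y) ->
  kapp (mm W) (@trunc W k) f z <= kapp (mm W) (@trunc W k) g z.
Proof.
move=> fg; apply: ler_sum => y _; rewrite /trunc; case: ifP => h.
  by rewrite ler_wpM2l ?fg// mulr_ge0 ?J_ge0 ?m_ge0.
by rewrite !mul0r.
Qed.

(** Ottaviani's inequality: after leaving the larger ball the walk is likely to
    stay close to the exit point, hence to be outside the smaller ball at the
    final time. *)
Lemma exit_prob_le (W : walk) k n (x0 : W) e :
  e <= 4^-1 ->
  (forall z i, dl x0 z <= 3 * 2 ^+ k -> (i <= n)%N ->
     P W k i (fun y => (~~ lvl k z y)%:R) z <= e) ->
  (forall z i, dl x0 z <= 3 * 2 ^+ k -> (i <= n)%N ->
     2^-1 <= P W k i (fun=> 1) z) ->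
  forall i z, (i <= n)%N -> dl x0 z <= 3 * 2 ^+ k ->
  4^-1 * exit_prob k x0 i z <= P W k i (fun y => (~~ lvl k x0 y)%:R) z.
Proof.
move=> e4 He Hg i z; have p0 : 0 < 2 ^+ k :> R by rewrite exprn_gt0.
have out j y : (j <= n)%N -> dl x0 y <= 3 * 2 ^+ k -> ~~ lvl k.+1 x0 y ->
    4^-1 <= P W k j (fun y => (~~ lvl k x0 y)%:R) y.
  move=> jn xy ny.
  have := @ler_tr W k j (fun=> 1)
    (fun u => (~~ lvl k y u)%:R + (~~ lvl k x0 u)%:R) y.
  rewrite kpowDf => h; have := h _; have := He y j xy jn; have := Hg y j xy jn.
  suff H u : 0 <= (1 : R) <= (~~ lvl k y u)%:R + (~~ lvl k x0 u)%:R.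
    by move=> h1 h2 /(_ H); lra.
  rewrite ler01 /=; have [h1|h1] := boolP (lvl k y u); last first.
    by rewrite lerDl ler0n.
  have [h2|h2] := boolP (lvl k x0 u); last by rewrite add0r.
  case/negP: ny; move: h1 h2; rewrite /lvl exprS => h1 h2.
  by have := dl_tri x0 u y; rewrite (dl_sym u y); lra.
elim: i z => [|i IH] z jn xz /=.
  case: (boolP (lvl k.+1 x0 z)) => h; last by rewrite mulr1 (out 0%N).
  by rewrite mulr0 ler0n.
case: (boolP (lvl k.+1 x0 z)) => h; last by rewrite mulr1 (out i.+1).
rewrite -kappZ; apply: ler_kapp_trunc => y zy; apply: IH; first exact: ltnW.
move: h zy; rewrite /lvl exprS => h zy; have := dl_tri x0 z y; lra.
Qed.

(** A walk with jumps at most [2 ^ k] needs [l] successive exits from balls of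
    radius [2 ^ k.+1] to reach distance [4 l 2 ^ k]. *)
Lemma exit_stages (W : walk) k n (x : W) e L :
  0 <= e <= 4^-1 ->
  (forall z i, dl x z <= L -> (i <= n)%N ->
     P W k i (fun y => (~~ lvl k z y)%:R) z <= e) ->
  (forall z i, dl x z <= L -> (i <= n)%N -> 2^-1 <= P W k i (fun=> 1) z) ->
  forall l x0 i, (i <= n)%N -> dl x x0 + 4 * l%:R * 2 ^+ k <= L ->
  P W k i (fun y => (4 * l%:R * 2 ^+ k < dl x0 y)%R%:R) x0 <= (4 * e) ^+ l.
Proof.
move=> /andP[e0 e4] He Hg; have p0 : 0 < 2 ^+ k :> R by rewrite exprn_gt0.
elim=> [|l IH] x0 i jn Lx.
  rewrite expr0; apply: kpow_le => //; [exact: m_gt0|exact: sub_markov_trunc|].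
  by move=> y; rewrite lern1 leq_b1.
pose f (y : W) : R := (4 * l.+1%:R * 2 ^+ k < dl x0 y)%R%:R.
have l0 : 0 <= l%:R * 2 ^+ k :> R by rewrite mulr_ge0// ltW.
have lE : 4 * l.+1%:R * 2 ^+ k = 4 * (l%:R * 2 ^+ k) + 4 * 2 ^+ k :> R.
  by rewrite -natr1; ring.
have lE' : 4 * l%:R * 2 ^+ k = 4 * (l%:R * 2 ^+ k) :> R by ring.
have xz z : dl x0 z <= 3 * 2 ^+ k -> dl x z + 4 * l%:R * 2 ^+ k <= L.
  by move=> h; have := dl_tri x x0 z; move: Lx; rewrite lE lE'; lra.
have xzL z : dl x0 z <= 3 * 2 ^+ k -> dl x z <= L.
  by move=> /xz; rewrite lE'; lra.
have e40 : 0 <= (4 * e) ^+ l by rewrite exprn_ge0// mulr_ge0.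
have main j z : (j <= n)%N -> dl x0 z <= 3 * 2 ^+ k ->
    P W k j f z <= (4 * e) ^+ l * exit_prob k x0 j z.
  have out j' z' : (j' <= n)%N -> dl x0 z' <= 3 * 2 ^+ k ->
      P W k j' f z' <= (4 * e) ^+ l.
    move=> j'n xz'; apply: le_trans (IH z' j' j'n (xz _ xz')).
    apply: ler_tr => y; rewrite /f ler0n /= lE lE'.
    case: ltP => h; last exact: ler0n.
    suff -> : 4 * (l%:R * 2 ^+ k) < dl z' y by [].
    by have := dl_tri x0 z' y; lra.
  elim: j z => [|j IHj] z jn' xz' /=; case: (boolP (lvl k.+1 x0 z)) => h.
  - rewrite mulr0 /kpow /= /f lE; case: ltP => // h'.
    by move: h; rewrite /lvl exprS; lra.
  - by rewrite mulr1 (out 0%N).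
  - rewrite -kappZ; apply: ler_kapp_trunc => y zy; apply: IHj; first exact: ltnW.
    move: h zy; rewrite /lvl exprS => h zy; have := dl_tri x0 z y; lra.
  - by rewrite mulr1 (out j.+1).
have x00 : dl x0 x0 <= 3 * 2 ^+ k by rewrite dlxx mulr_ge0// ltW.
apply: le_trans (main i x0 jn x00) _; rewrite exprSr ler_wpM2l//.
have := exit_prob_le e4 (fun z i' h => He z i' (xzL z h))
  (fun z i' h => Hg z i' (xzL z h)) jn x00.
by have := He x0 i (xzL _ x00) jn; lra.
Qed.

(** * Off-diagonal upper bound *)

(** Mass is lost only by leaving the finite set, hence this holds for given [n]
    and [z] if the set is large enough. *)
Definition retains (W : walk) n (z : W) : Prop :=
  forall i, (i <= n)%N -> 3 / 4 <= kpow (mm W) (JJ W) i (fun=> 1) z.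

Lemma hk_trunc_le (W : walk) k n (x y : W) :
  hk (mm W) (@trunc W k) n x y <= hk (mm W) (JJ W) n x y.
Proof. by apply: ler_hk => [|u v]; [exact: m_gt0|exact: trunc_bd]. Qed.

(** A path from [x] to [y] either has a jump of size comparable with the
    distance, which costs the density of such a jump times the number of steps,
    or one of its halves goes far by means of shorter jumps only, which
    [exit_stages] makes so unlikely that the on-diagonal bound suffices for the
    other half. *)
Lemma off_diagonal_upper : exists2 C, 0 < C & forall (W : walk) n j (x y : W),
  (0 < n)%N -> ~~ lvl j x y ->
  (forall z, lvl j x z || lvl j y z -> retains n z) ->
  hk (mm W) (JJ W) n x y <= C * n%:R / (U j * F j).
Proof.
have [A0|A0] := leP A 0.
  by exists 1 => // W; have := A_gt0 W; rewrite ltNge A0.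
have D0 := D_gt0 S; have D1 := D_ge1 S; have kk := k1_gt0 S.
have e0 := eta_gt0 S; have e1 := eta_lt1 S.
have K0 := k2_gt0 S; have K1 := k2_gt1 S; have F0 := F_gt0 S 0.
have [Cp Cp0 HCp] := point_tail.
have [Ct Ct0 HCt] := discard_jumps.
have [b Hb] : exists b, eta ^+ b <= (16 * (Cp + Ct))^-1.
  by apply: eta_small; rewrite invr_gt0 mulr_gt0// addr_gt0.
have {}Hb : (Cp + Ct) * eta ^+ b <= 16^-1.
  by move: Hb; rewrite invfM ler_pdivlMr ?addr_gt0// mulrC.
have [l Hl] : exists l, eta ^+ l <= (k2 * D)^-1.
  by apply: eta_small; rewrite invr_gt0 mulr_gt0.
pose a := l.+3.
have [Co Co0 HCo] := on_diagonal (2 * (k2 + F 0)).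
pose B' := k2 ^+ (a + b) * (k2 + F 0).
have B'1 : 1 <= B'.
  rewrite /B' -[1]mulr1; apply: ler_pM => //; first by rewrite exprn_ege1// ltW.
  by have := K1; lra.
have [Co' Co'0 HCo'] := on_diagonal B'.
pose C3 := 2 * Co * (k2 * D) ^+ (a + b) * (k2 + F 0).
have kD0 i : 0 < (k2 * D) ^+ i by rewrite exprn_gt0// mulr_gt0.
have C30 : 0 < C3.
  by apply: mulr_gt0; [apply: mulr_gt0 => //; exact: mulr_gt0|exact: addr_gt0].
exists (Co' * B' + A * (k2 * D) ^+ a + C3).
  apply: addr_gt0 => //; apply: addr_gt0; apply: mulr_gt0 => //.
  exact: lt_le_trans ltr01 B'1.
move=> W n j x y n0 xy good; have Uj := U_gt0 S j; have Fj := F_gt0 S j.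
have nR : 1 <= n%:R :> R by rewrite ler1n.
have n00 : 0 <= n%:R :> R by [].
have t1 : 0 <= Co' * B' * n%:R / (U j * F j).
  rewrite divr_ge0 ?(ltW (UF_gt0 _ _))// mulr_ge0// mulr_ge0 ?(ltW Co'0)//.
  exact: le_trans ler01 B'1.
have t2 : 0 <= A * (k2 * D) ^+ a * n%:R / (U j * F j).
  rewrite divr_ge0 ?(ltW (UF_gt0 _ _))// mulr_ge0// mulr_ge0 ?(ltW A0)//.
  exact: ltW.
have t3 : 0 <= C3 * n%:R / (U j * F j).
  by rewrite divr_ge0 ?(ltW (UF_gt0 _ _))// mulr_ge0// ltW.
rewrite !mulrDl.
have [FB|FB] := leP (F j) (B' * n%:R).
  have h : hk (mm W) (JJ W) n x y <= Co' / U j.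
    apply: HCo'; apply: le_trans FB _; rewrite ler_wpM2l ?ler_nat//.
    exact: le_trans ler01 B'1.
  apply: le_trans h _; apply: (@le_trans _ _ (Co' * B' * n%:R / (U j * F j))).
    have -> : Co' * B' * n%:R / (U j * F j) = Co' / U j * (B' * n%:R / F j).
      by field; rewrite !gt_eqF.
    by rewrite ler_peMr ?divr_ge0 ?(ltW Co'0) ?(ltW Uj)// ler_pdivlMr// mul1r.
  by rewrite -!addrA lerDl addr_ge0.
(* [F i] is comparable with [n], with room between the scales [i] and [j] since
   [F j] is much larger than [n] *)
have [i [nFi Fin ij]] : exists i,
    [/\ n%:R <= F i, F i <= (k2 + F 0) * n%:R & (i <= j)%N].
  have ex : exists i, n%:R <= F i.
    by exists j; apply: le_trans (ltW FB); rewrite ler_peMl.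
  have [i Hi imin] := ex_minnP ex; exists i; split => //; last first.
    by apply: imin; apply: le_trans (ltW FB); rewrite ler_peMl.
  case: i Hi imin => [|i] Hi imin.
    apply: le_trans (_ : F 0 * 1 <= _); first by rewrite mulr1.
    by apply: ler_pM => //; [exact: ltW|rewrite lerDr ltW].
  apply: le_trans (F_le S i) _; have : F i <= n%:R.
    by rewrite leNgt; apply/negP => /ltW /imin; rewrite ltnn.
  have := K0; have := mulr_ge0 (ltW F0) n00; nra.
have ijab : (i + b + a <= j)%N.
  rewrite leqNgt; apply/negP => h; move: FB; apply/negP; rewrite -leNgt.
  apply: (@le_trans _ _ (F (i + (a + b)))); first by apply: F_mono; clear -h; lia.
  apply: le_trans (F_growr _ _ _) _; rewrite /B' -mulrA ler_pM2l//.
  by rewrite exprn_gt0.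
pose k := (j - a)%N; have kE : j = (k + a)%N by rewrite /k subnK//; clear -ijab; lia.
have ik : (i + b <= k)%N by rewrite /k; clear -ijab; lia.
have Fk := F_gt0 S k; have Uk := U_gt0 S k; have Ui := U_gt0 S i.
have tailk z i' : (i' <= n)%N ->
    P W k i' (fun y => (~~ lvl k z y)%:R) z <= Cp * eta ^+ (k - i).
  move=> i'n; apply: le_trans (HCp W i' i k z _ _); last 2 first.
  - by apply: le_trans nFi; rewrite ler_nat.
  - by clear -ik; lia.
  apply: ler_kpow; [exact: m_gt0|exact: trunc_bd|].
  by move=> u; rewrite ler0n lexx.
have ebk : eta ^+ (k - i) <= eta ^+ b by apply: eta_decr; clear -ik; lia.
have eb0 : 0 <= eta ^+ (k - i) by rewrite exprn_ge0// ltW.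
have eps4 : 0 <= Cp * eta ^+ (k - i) <= 4^-1.
  apply/andP; split; first by rewrite mulr_ge0// ltW.
  have := ler_wpM2l (ltW Cp0) ebk; have := mulr_ge0 (ltW Ct0) eb0.
  have := ler_wpM2l (ltW Ct0) ebk; move: Hb; rewrite mulrDl; lra.
have massk z i' : lvl j x z || lvl j y z -> (i' <= n)%N ->
    2^-1 <= P W k i' (fun=> 1) z.
  move=> /good gz i'n; have := gz i' i'n.
  have := HCt W k i' (fun=> 1) z (fun=> ler01) (fun=> lexx 1).
  suff : i'%:R * (Ct / F k) <= 4^-1 by lra.
  have h1 : i'%:R <= F i by apply: le_trans nFi; rewrite ler_nat.
  have h2 : F i / F k <= eta ^+ b.
    have h : k1 ^+ (k - i) * F i <= F k.
      by have := F_grow S (k - i) i; rewrite subnKC//; clear -ik; lia.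
    apply: (@le_trans _ _ (k1^-1 ^+ (k - i))).
      by rewrite exprVn ler_pdivrMr// ler_pdivlMl ?exprn_gt0.
    apply: (@le_trans _ _ ((eta ^+ 2) ^+ (k - i))).
      by rewrite lerXn2r ?nnegrE ?invr_ge0 ?(ltW kk) ?sqr_ge0// eta_sq.
    by rewrite -exprM; apply: eta_decr; clear -ik; lia.
  apply: (@le_trans _ _ (Ct * (F i / F k))).
    by rewrite mulrCA ler_pM2l// ler_pM2r// invr_gt0.
  apply: (@le_trans _ _ (Ct * eta ^+ b)); first by rewrite ler_pM2l.
  have := mulr_ge0 (ltW Cp0) (exprn_ge0 b (ltW e0)).
  by move: Hb; rewrite mulrDl; lra.
have l2 : 8 * l%:R * 2 ^+ k <= 2 ^+ j :> R.
  rewrite kE exprD mulrC ler_pM2l ?exprn_gt0// /a -natrX -natrM ler_nat.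
  have : (l < 2 ^ l)%N by exact: ltn_expl.
  by rewrite !expnS; clear; lia.
have far z i' : z = x \/ z = y -> (i' <= n)%N ->
    P W k i' (fun u => (~~ lvl j.-1 z u)%:R) z <= (eta ^+ l) ^+ (k - i - b).
  move=> zxy i'n; have gz u : dl z u <= 2 ^+ j -> lvl j x u || lvl j y u.
    by move=> h; apply/orP; case: zxy h => -> h; [left|right].
  have hL : dl z z + 4 * l%:R * 2 ^+ k <= 2 ^+ j.
    rewrite dlxx add0r; have : 0 <= l%:R * 2 ^+ k :> R by rewrite mulr_ge0// exprn_ge0.
    lra.
  have := exit_stages eps4 (fun u i'' _ h => tailk u i'' h)
    (fun u i'' hu h => massk u i'' (gz u hu) h) i'n hL.
  move=> h; apply: (@le_trans _ _ ((4 * (Cp * eta ^+ (k - i))) ^+ l)); last first.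
    rewrite -exprM mulnC exprM lerXn2r ?nnegrE ?exprn_ge0 ?(ltW e0)//.
      by rewrite mulr_ge0//; case/andP: eps4.
    have -> : eta ^+ (k - i) = eta ^+ (k - i - b) * eta ^+ b.
      by rewrite -exprD subnK//; clear -ik; lia.
    have : 0 <= eta ^+ (k - i - b) by rewrite exprn_ge0// ltW.
    have := mulr_ge0 (ltW Ct0) (exprn_ge0 b (ltW e0)).
    move: Hb; rewrite mulrDl; move: (eta ^+ (k - i - b)) (eta ^+ b) => X Y; nra.
  apply: le_trans h; apply: ler_tr => u; rewrite ler0n /= /lvl -ltNge.
  case: ltP => h; last exact: ler0n.
  suff -> : 4 * l%:R * 2 ^+ k < dl z u by [].
  apply: le_lt_trans h; have : 2 ^+ j = 2 * 2 ^+ j.-1 :> R.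
    by rewrite -exprS prednK//; clear -kE; rewrite kE /a; lia.
  lra.
have big : hk (mm W) (JJ W) n x y <=
    hk (mm W) (@trunc W k) n x y + n%:R * (A / (U k * F k)).
  have J0 : 0 <= A / (U k * F k) by rewrite divr_ge0 ?(ltW A0) ?(ltW (UF_gt0 _ _)).
  apply: kpow_perturb => //; [exact: m_gt0|exact: sub_markov_trunc|].
  move=> i' u; apply: (@le_trans _ _ (\sum_z A / (U k * F k) *
      (hk (mm W) (JJ W) i' x z * m z))).
    apply: ler_sum => z _; rewrite -mulrA (mulrC (m z)) -/(hk _ _ i' x z).
    rewrite ler_wpM2r ?mulr_ge0 ?hkJ_ge0 ?m_ge0// /trunc.
    case: (boolP (lvl k u z)) => h; first by rewrite subrr.
    by rewrite subr0 J_up// ltNge.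
  by rewrite -mulr_sumr ler_piMr// hk_mass.
have bigE : n%:R * (A / (U k * F k)) <= A * (k2 * D) ^+ a * n%:R / (U j * F j).
  have -> : A * (k2 * D) ^+ a * n%:R / (U j * F j) =
      n%:R * (A * (D ^+ a / U j * (k2 ^+ a / F j))).
    by rewrite exprMn; field; rewrite !gt_eqF.
  rewrite ler_wpM2l// ler_pM2l// invfM ler_pM ?invr_ge0 ?(ltW Uk) ?(ltW Fk)//.
    by rewrite ler_pdivlMr// ler_pdivrMl// mulrC kE U_grow.
  by rewrite ler_pdivlMr// ler_pdivrMl// mulrC kE F_growr.
have mid : hk (mm W) (@trunc W k) n x y <=
    2 * (Co / U i) * (eta ^+ l) ^+ (k - i - b).
  have hko i' z w : (n <= i'.*2.+1)%N ->
      hk (mm W) (@trunc W k) i' z w <= Co / U i.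
    move=> ni'; apply: le_trans (hk_trunc_le _ _ _ _) _; apply: HCo.
    apply: le_trans Fin _; have : n%:R <= 2 * i'.+1%:R :> R.
      by rewrite -natrM ler_nat; clear -ni'; lia.
    by rewrite -(ler_pM2l (addr_gt0 K0 F0)) mulrCA mulrA.
  pose n1 := n./2; pose n2 := (n - n1)%N.
  have nE : n = (n1 + n2)%N by rewrite subnKC// /n1; clear; lia.
  have n1b : (n <= n1.*2.+1)%N by rewrite /n1; clear; lia.
  have n2b : (n <= n2.*2.+1)%N by rewrite /n2 /n1; clear; lia.
  have n2n : (n2 <= n)%N by rewrite leq_subr.
  have n1n : (n1 <= n)%N by rewrite nE leq_addr.
  rewrite nE hkD; [|exact: m_gt0|exact: trunc_sym].
  have hk0 i' u v : 0 <= hk (mm W) (@trunc W k) i' u v.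
    by apply: hk_ge0; [exact: m_gt0|exact: trunc_ge0].
  apply: (@le_trans _ _ (Co / U i *
     P W k n1 (fun u => (~~ lvl j.-1 x u)%:R) x + Co / U i *
     P W k n2 (fun u => (~~ lvl j.-1 y u)%:R) y)); last first.
    have := far x n1 (or_introl erefl) n1n; have := far y n2 (or_intror erefl) n2n.
    have : 0 < Co / U i by rewrite divr_gt0.
    move=> /ltW Q0 /(ler_wpM2l Q0) hy /(ler_wpM2l Q0) hx; clear -hx hy; lra.
  rewrite (kpowE (@m_gt0 W) n1); last exact: trunc_sym.
  rewrite (kpowE (@m_gt0 W) n2); last exact: trunc_sym.
  rewrite !mulr_sumr -big_split; apply: ler_sum => z _ /=.
  rewrite [hk _ _ n2 z y]hk_sym; [|exact: m_gt0|exact: trunc_sym].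
  have h1 := hko n1 x z n1b; have h2 := hko n2 y z n2b.
  have p1 := hk0 n1 x z; have p2 := hk0 n2 y z; have mz := m_ge0 z.
  have : ~~ lvl j.-1 x z || ~~ lvl j.-1 y z.
    rewrite -negb_and; apply/negP => /andP[xz yz]; case/negP: xy.
    move: xz yz; rewrite /lvl => xz yz.
    have : 2 ^+ j = 2 * 2 ^+ j.-1 :> R.
      by rewrite -exprS prednK//; clear -kE; rewrite kE /a; lia.
    by have := dl_tri x z y; rewrite (dl_sym z y); clear -xz yz; lra.
  have Cu : 0 <= Co / U i by rewrite divr_ge0 ?ltW.
  move: (Co / U i) Cu h1 h2 => Q Q0; move: (hk _ _ _ x z) (hk _ _ _ y z) p1 p2.
  move=> g1 g2 g10 g20 g1Q g2Q.
  have m1 : 0 <= g1 * m z by rewrite mulr_ge0.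
  have m2 : 0 <= g2 * m z by rewrite mulr_ge0.
  case: (lvl j.-1 x z) => /=; rewrite ?mulr0 ?mulr1 ?add0r => h.
    by rewrite h mulr1; have := ler_wpM2r m2 g1Q; clear; lra.
  apply: (@le_trans _ _ (Q * (g1 * m z))).
    by have := ler_wpM2r m1 g2Q; clear; lra.
  by rewrite lerDl mulr_ge0// mulr_ge0// ler0n.
apply: le_trans big _; rewrite -addrA.
apply: le_trans (_ : _ <= A * (k2 * D) ^+ a * n%:R / (U j * F j) +
   C3 * n%:R / (U j * F j)) _; last by rewrite lerDr.
rewrite addrC; apply: lerD => //; apply: le_trans mid _.
pose q := (k - i - b)%N; rewrite -/q.
have ji : (j - i = q + (a + b))%N by rewrite /q /k; clear -ijab; lia.
have Ug : U j <= D ^+ (q + (a + b)) * U i.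
  by have := U_grow S (j - i) i; rewrite subnKC// ji.
have Fg : F j <= k2 ^+ (q + (a + b)) * ((k2 + F 0) * n%:R).
  have := F_growr S (j - i) i; rewrite subnKC// ji => h; apply: le_trans h _.
  by rewrite ler_wpM2l// exprn_ge0// ltW.
have eq : (eta ^+ l) ^+ q <= ((k2 * D) ^+ q)^-1.
  by rewrite -exprVn lerXn2r ?nnegrE ?exprn_ge0 ?(ltW e0)// invr_ge0 mulr_ge0 ?ltW.
apply: (@le_trans _ _ (2 * (Co / U i) * ((k2 * D) ^+ q)^-1)).
  by rewrite ler_wpM2l// mulr_ge0// divr_ge0 ?ltW.
have kD : 0 < (k2 * D) ^+ q by rewrite exprn_gt0// mulr_gt0.
have UF : U j * F j <= D ^+ (q + (a + b)) * U i *
    (k2 ^+ (q + (a + b)) * ((k2 + F 0) * n%:R)).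
  by apply: ler_pM => //; rewrite ltW.
rewrite ler_pdivlMr ?UF_gt0//.
apply: le_trans (ler_wpM2l _ UF) _.
  by rewrite mulr_ge0 ?mulr_ge0 ?divr_ge0 ?invr_ge0 ?(ltW kD) ?(ltW Co0) ?(ltW Ui).
rewrite le_eqVlt; apply/orP; left; apply/eqP.
rewrite /C3 !exprD !exprMn; field.
by rewrite !gt_eqF ?exprn_gt0.
Qed.

(** * Lower bound *)

(** A fixed proportion of the kernel uniform on the ball of radius [2 ^ k.+1] is
    set aside.  The paths that use it exactly once, at time [i], contribute
    disjointly for different [i]; before and after that time they may be assumed
    to remain close to [x], respectively [y]. *)
Lemma hk_lower : exists b C, 0 < C /\ forall (W : walk) n i k (x y : W),
  n%:R <= F i -> (i + b <= k)%N -> lvl k x y -> retains n x -> retains n y ->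
  n%:R / (C * (U k * F k)) <= hk (mm W) (JJ W) n x y.
Proof.
have [A0|A0] := leP A 0.
  by exists 0%N, 1; split => // W; have := A_gt0 W; rewrite ltNge A0.
have D0 := D_gt0 S; have D1 := D_ge1 S; have K0 := k2_gt0 S.
have [Cp Cp0 HCp] := point_tail.
have [b Hb] : exists b, eta ^+ b <= (8 * Cp)^-1.
  by apply: eta_small; rewrite invr_gt0 mulr_gt0.
exists b.+1, (32 * A * (D * k2)); split; first by rewrite !mulr_gt0.
move=> W n i k x y nF ik xy gx gy.
have Uk := U_gt0 S k; have Fk := F_gt0 S k.
have Uk1 := U_gt0 S k.+1; have Fk1 := F_gt0 S k.+1.
have kS : k = k.-1.+1 by rewrite prednK//; clear -ik; lia.
pose bb (u v : W) : R := 8^-1 * unif k.+1 u v.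
pose J' (u v : W) : R := J u v - bb u v.
have bb0 u v : 0 <= bb u v by rewrite mulr_ge0 ?invr_ge0 ?unif_ge0.
have bb_sym u v : bb u v = bb v u by rewrite /bb /unif lvl_sym.
have J'_bd u v : 0 <= J' u v <= J u v.
  have := unif_ge0 k.+1 u v; have := unif_le k.+1 u v; rewrite /J' /bb; lra.
have J'0 u v : 0 <= J' u v by have /andP[] := J'_bd u v.
have J's u v : J' u v = J' v u by rewrite /J' J_sym bb_sym.
have J'M : sub_markov (mm W) J'.
  split => // u; apply: le_trans (J_mass u); apply: ler_sum => v _.
  by rewrite ler_wpM2r ?m_ge0//; have /andP[] := J'_bd u v.
pose Q := kpow (mm W) J'.
have Q0 j f u : (forall v, 0 <= f v) -> 0 <= Q j f u.
  by move=> f0; apply: kpow_ge0 => //; exact: m_gt0.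
have near z j : retains n z -> (j <= n)%N ->
    2^-1 <= Q j (fun v => (lvl k.-1 z v)%:R) z.
  move=> gz jn; have h1 := gz j jn.
  have jF : j%:R <= F i by apply: le_trans nF; rewrite ler_nat.
  have h2 : kpow (mm W) (JJ W) j (fun=> 1) z <=
      Q j (fun=> 1) z + j%:R * (8^-1 / F k.+1).
    apply: kpow_perturb => //; [exact: m_gt0|by rewrite divr_ge0 ?invr_ge0 ?(ltW Fk1)|].
    move=> i' u; apply: (@le_trans _ _ (\sum_v bb u v * m v)).
      apply: ler_sum => v _; rewrite /J' opprB addrC subrK.
      by rewrite ler_piMr ?kpowJ_le1// mulr_ge0 ?m_ge0.
    have -> : \sum_v bb u v * m v =
        (8 * (A * (U k.+1 * F k.+1)))^-1 * \sum_(v | lvl k.+1 u v) m v.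
      rewrite mulr_sumr [RHS]big_mkcond; apply: eq_bigr => v _ /=.
      by rewrite /bb /unif (invfM 8); case: (lvl k.+1 u v) => /=; ring.
    have A80 : 0 <= (8 * (A * (U k.+1 * F k.+1)))^-1.
      by rewrite invr_ge0 mulr_ge0// ltW// (AUF_gt0 W).
    apply: le_trans (ler_wpM2l A80 (vol_lvl _ _)) _.
    rewrite le_eqVlt; apply/orP; left; apply/eqP.
    by field; rewrite !gt_eqF.
  have h3 : j%:R * (8^-1 / F k.+1) <= 8^-1.
    rewrite mulrCA ger_pMr ?invr_gt0// ler_pdivrMr// mul1r.
    by apply: le_trans jF _; apply: F_mono; clear -ik; lia.
  have h4 : Q j (fun v => (~~ lvl k.-1 z v)%:R) z <= 8^-1.
    apply: (@le_trans _ _ (kpow (mm W) (JJ W) j (fun v => (~~ lvl k.-1 z v)%:R) z)).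
      by apply: ler_kpow => [||v]; [exact: m_gt0|exact: J'_bd|rewrite ler0n lexx].
    apply: le_trans (HCp W j i k.-1 z jF _) _; first by clear -ik; lia.
    apply: (@le_trans _ _ (Cp * eta ^+ b)).
      by rewrite ler_pM2l// eta_decr//; clear -ik; lia.
    by move: Hb; rewrite invfM ler_pdivlMr// mulrC.
  have h5 : Q j (fun=> 1) z = Q j (fun v => (lvl k.-1 z v)%:R) z +
      Q j (fun v => (~~ lvl k.-1 z v)%:R) z.
    rewrite -kpowDf; apply: eq_kpow => v.
    by case: (lvl k.-1 z v); rewrite ?addr0 ?add0r.
  clear -h1 h2 h3 h4 h5; lra.
pose be := (16 * (A * (U k.+1 * F k.+1)))^-1.
have be0 : 0 < be by rewrite invr_gt0 mulr_gt0// (AUF_gt0 W).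
have cross j u : (j <= n)%N ->
    be * (lvl k.-1 x u)%:R <= kapp (mm W) bb (Q j (point_mass (mm W) y)) u.
  move=> jn; have Qd v : 0 <= Q j (point_mass (mm W) y) v.
    by apply: Q0 => w; apply: point_mass_ge0; exact: m_gt0.
  have [xu|_] := boolP (lvl k.-1 x u); last first.
    by rewrite mulr0; apply: kapp_ge0 => //; exact: m_gt0.
  rewrite mulr1; apply: (@le_trans _ _ (2 * be *
      Q j (fun v => (lvl k.-1 y v)%:R) y)).
    have := near y j gy jn; clear -be0; nra.
  rewrite /Q kpowE//; last exact: m_gt0.
  rewrite mulr_sumr; apply: ler_sum => v _ /=.
  rewrite -/(hk (mm W) J' j y v).
  have hv : 0 <= hk (mm W) J' j y v by apply: hk_ge0 => //; exact: m_gt0.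
  case: (boolP (lvl k.-1 y v)) => yv; last first.
    by rewrite !mulr0 mulr_ge0// mulr_ge0 ?m_ge0.
  suff -> : bb u v = 2 * be.
    by rewrite mulr1 -!mulrA ler_pM2l// ler_pM2l// mulrC.
  rewrite /bb /unif (_ : lvl k.+1 u v) ?mul1r /be.
    by field; rewrite !gt_eqF.
  move: xy xu yv; rewrite /lvl kS !exprS /= => xy xu yv.
  have := dl_tri u x v; have := dl_tri x y v; rewrite (dl_sym u x).
  clear -xy xu yv; lra.
have lower j u : (j <= n)%N ->
    be * \sum_(i' < j) Q i' (fun v => (lvl k.-1 x v)%:R) u <=
    kpow (mm W) (JJ W) j (point_mass (mm W) y) u.
  elim: j u => [|j IH] u jn.
    rewrite big_ord0 mulr0; apply: point_mass_ge0; exact: m_gt0.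
  have IHj v := IH v (ltnW jn).
  have -> : kpow (mm W) (JJ W) j.+1 (point_mass (mm W) y) u =
      kapp (mm W) J' (kpow (mm W) (JJ W) j (point_mass (mm W) y)) u +
      kapp (mm W) bb (kpow (mm W) (JJ W) j (point_mass (mm W) y)) u.
    rewrite kpowS /kapp -big_split; apply: eq_bigr => v _ /=.
    by rewrite -!mulrDl /J' subrK.
  rewrite big_ord_recl mulrDr addrC; apply: lerD.
    rewrite /= mulr_sumr.
    apply: (@le_trans _ _ (kapp (mm W) J'
       (fun v => be * \sum_(i' < j) Q i' (fun v => (lvl k.-1 x v)%:R) v) u)).
      rewrite kappZ -mulr_sumr ler_pM2l// /kapp.
      under [leRHS]eq_bigr => v _ do rewrite mulr_sumr.
      by rewrite exchange_big.
    by apply: ler_sum => v _; rewrite ler_wpM2l// mulr_ge0 ?m_ge0.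
  apply: le_trans (cross j u (ltnW jn)) _.
  apply: ler_kapp => v; [exact: m_gt0|by rewrite lexx bb0|].
  have Qd : 0 <= Q j (point_mass (mm W) y) v.
    by apply: Q0 => w; apply: point_mass_ge0; exact: m_gt0.
  apply/andP; split => //; apply: ler_kpow; [exact: m_gt0|exact: J'_bd|move=> w].
  by rewrite point_mass_ge0 ?lexx//; exact: m_gt0.
rewrite hk_sym; [|exact: m_gt0|exact: J_sym].
apply: le_trans (lower n x (leqnn n)).
apply: (@le_trans _ _ (be * (n%:R * 2^-1))); last first.
  rewrite ler_pM2l// mulr_natl -{1}(card_ord n) -sumr_const.
  by apply: ler_sum => j _; apply: near => //; exact: ltnW.
have -> : be * (n%:R * 2^-1) = n%:R / (32 * A * (U k.+1 * F k.+1)).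
  by rewrite /be; field; rewrite !gt_eqF.
rewrite ler_wpM2l// lef_pV2 ?posrE ?mulr_gt0//.
have -> : 32 * A * (D * k2) * (U k * F k) = 32 * A * (D * U k * (k2 * F k)).
  by ring.
rewrite ler_pM2l ?mulr_gt0//; apply: ler_pM; rewrite ?(ltW Uk1) ?(ltW Fk1)//.
  exact: U_dbl.
exact: F_le.
Qed.

End Walk.

(** * Regularly varying functions *)

Section RegularVariationTheory.
Context {R : realType}.
Variables (beta : R) (phi : R -> R).
Hypothesis beta_gt0 : 0 < beta.
Hypothesis phi_cont : {within `[0, +oo[, continuous phi}.
Hypothesis phi_gt0 : forall x : R, 0 <= x -> 0 < phi x.
Hypothesis phi_reg : regularly_varying phi beta.

Lemma near_pinfty_ex (P : R -> Prop) : (\forall x \near +oo, P x) ->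
  exists2 M : R, 0 < M & forall x, M <= x -> P x.
Proof.
move=> [M [_ HM]]; exists (Num.max M 0 + 1).
  by rewrite ltr_wpDl// le_max lexx orbT.
move=> x Mx; apply: HM; apply: lt_le_trans Mx.
by rewrite (@le_lt_trans _ _ (Num.max M 0))// ?ltrDl// le_max lexx.
Qed.

Lemma phi_bounded (r : R) : 0 <= r -> exists2 C, 1 <= C &
  forall x, 0 <= x <= r -> C^-1 <= phi x /\ phi x <= C.
Proof.
move=> r0; have sub : `[0, r] `<=` `[0, +oo[.
  by move=> x /=; rewrite !in_itv/= andbT => /andP[].
have cont := continuous_subspaceW sub phi_cont.
have [c] := EVT_max r0 cont; rewrite in_itv/= => /andP[c0 cr] Hc.
have [c'] := EVT_min r0 cont; rewrite in_itv/= => /andP[c'0 c'r] Hc'.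
have pc := phi_gt0 c0; have pc' := phi_gt0 c'0.
have C0 : 0 < 1 + phi c + (phi c')^-1 by rewrite !addr_gt0// invr_gt0.
have i0 : 0 < (phi c')^-1 by rewrite invr_gt0.
exists (1 + phi c + (phi c')^-1); first lra.
move=> x xr; have xI : x \in `[0, r] by rewrite in_itv.
split; last by apply: le_trans (Hc x xI) _; lra.
apply: le_trans (Hc' x xI); rewrite invf_ple//; lra.
Qed.

Lemma phi_continuous_at (x : R) : 0 < x -> {for x, continuous phi}.
Proof.
move=> x0; have sub : `](0 : R), +oo[ `<=` `[0, +oo[.
  by move=> y /=; rewrite !in_itv/= !andbT => /ltW.
have := continuous_subspaceW sub phi_cont.
rewrite continuous_open_subspace; last exact: interval_open.
by apply; rewrite inE /= ?in_itv/= ?x0.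
Qed.

Let psi (t : R) := phi (expR t).

Let psi_gt0 t : 0 < psi t. Proof. exact: phi_gt0 (expR_ge0 t). Qed.

Let psi_cont : continuous psi.
Proof.
move=> t; apply: continuous_comp; first exact: continuous_expR.
exact: phi_continuous_at (expR_gt0 t).
Qed.

(** The dilations, in logarithmic coordinates, by which [phi] varies at most by
    the factor [N.+1] beyond [N]. *)
Let tame (N : nat) : set R := [set t | forall s, N%:R <= s ->
  psi (s + t) <= N.+1%:R * psi s /\ psi s <= N.+1%:R * psi (s + t)].

Let tame_closed N : closed (tame N).
Proof.
have -> : tame N = \bigcap_(s in [set s : R | N%:R <= s])
    ((fun t => psi (s + t)) @^-1` [set y | y <= N.+1%:R * psi s] `&`
     (fun t => psi s - N.+1%:R * psi (s + t)) @^-1` [set y | y <= 0]).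
  apply/seteqP; split => t /= H s Ns; have := H s Ns => /= -[h1 h2]; split => //.
    by rewrite subr_le0.
  by rewrite -subr_le0.
have sh s : continuous (fun t : R => psi (s + t)).
  move=> t; apply: (@continuous_comp _ _ _ (fun t => s + t) psi).
    by apply: cvgD; [exact: cvg_cst|exact: cvg_id].
  exact: psi_cont.
apply: closed_bigI => s _; apply: closedI; apply: closed_comp.
- by move=> t _; exact: sh.
- exact: closed_le.
- move=> t _; apply: cvgB; first exact: cvg_cst.
  by apply: cvgM; [exact: cvg_cst|exact: sh].
- exact: closed_le.
Qed.

Let tame_cover t : exists N, tame N t.
Proof.
have l0 : 0 < (expR t) `^ beta by rewrite powR_gt0 ?expR_gt0.
have cv := phi_reg (expR_gt0 t).
have h2 : (expR t) `^ beta / 2 < (expR t) `^ beta by rewrite ltr_pdivrMr//; lra.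
have h3 : (expR t) `^ beta < 2 * (expR t) `^ beta by lra.
have [M1 M10 H1] := near_pinfty_ex (cvgr_gt _ cv _ h2).
have [M2 M20 H2] := near_pinfty_ex (cvgr_lt _ cv _ h3).
move: ((expR t) `^ beta) l0 {h2 h3 cv} H1 H2 => L L0 H1 H2.
pose B := M1 + M2 + 2 * L + 2 / L.
have iL : 0 < 2 / L by rewrite divr_gt0.
have B0 : 0 <= B by rewrite /B; lra.
exists (Num.bound B) => s Ns.
have BN := archi_boundP B0.
have sB : B <= expR s by have := expR_ge1Dx s; lra.
have N1 : (Num.bound B).+1%:R = (Num.bound B)%:R + 1 :> R by rewrite natr1.
have p0 := psi_gt0 s; have p1 := psi_gt0 (s + t).
have E : expR t * expR s = expR (s + t) by rewrite addrC expRD.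
have {}H1 := H1 (expR s) _; have {}H2 := H2 (expR s) _.
rewrite E -/(psi s) -/(psi (s + t)) in H1 H2.
have {}H2 : psi (s + t) < 2 * L * psi s.
  by rewrite -ltr_pdivrMr//; apply: H2; rewrite /B in sB; lra.
have {}H1 : L / 2 * psi s < psi (s + t).
  by rewrite -ltr_pdivlMr//; apply: H1; rewrite /B in sB; lra.
split; first by apply: le_trans (ltW H2) _; rewrite ler_pM2r//; rewrite /B in BN; lra.
have h : psi s <= 2 / L * psi (s + t).
  rewrite -ler_pdivrMl// invf_div; exact: ltW.
by apply: le_trans h _; rewrite ler_pM2r//; rewrite /B in BN; lra.
Qed.

(** The sets [tame N] are closed and cover the line; by Baire's theorem one of
    them contains an interval, and differences of its elements cover a
    neighbourhood of 0. *)
Let tame_small : exists S K h, [/\ 0 < h, 1 <= K & forall s v, S <= s ->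
  0 <= v <= h -> psi (s + v) <= K * psi s /\ psi s <= K * psi (s + v)].
Proof.
have [N HN] : exists N, ~ dense (~` tame N : set R^o).
  apply: contrapT => H.
  have dn : forall N, open (~` tame N : set R^o) /\ dense (~` tame N : set R^o).
    move=> N; split; first by apply: closed_openC; exact: tame_closed.
    by apply: contrapT => h; apply: H; exists N.
  have [t [_ Ht]] : [set: R^o] `&` \bigcap_i (~` tame i) !=set0.
    by apply: (Baire dn); [exists 0|exact: openT].
  have [N hN] := tame_cover t; exact: Ht N I hN.
have [V [[t0 Vt0] oV HV]] : exists V : set R, [/\ V !=set0, open V & V `<=` tame N].
  apply: contrapT => H; apply: HN => V V0 oV.
  apply: contrapT => H'; apply: H; exists V; split => // t Vt.
  by apply: contrapT => ht; apply: H'; exists t.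
have /nbhs_ballP[e /= e0 He] : nbhs t0 V by exact: open_nbhs_nbhs.
have tmT v : 0 <= v <= e / 2 -> tame N (t0 + v).
  move=> v0; apply: HV; apply: He; rewrite /ball/= opprD addrA subrr add0r normrN.
  by rewrite ger0_norm; lra.
have K1 : 1 <= N.+1%:R :> R by rewrite ler1n.
exists (N%:R + t0), (N.+1%:R ^+ 2), (e / 2); split; [lra|by rewrite exprn_ege1|].
move=> s v Ss vh.
have h0 : tame N (t0 + 0) by apply: tmT; lra.
have Ns : N%:R <= s - t0 by lra.
have [a1 a2] := h0 _ Ns; have [b1 b2] := tmT _ vh _ Ns.
have E1 : s - t0 + (t0 + 0) = s by ring.
have E2 : s - t0 + (t0 + v) = s + v by ring.
rewrite E1 in a1 a2; rewrite E2 in b1 b2; rewrite expr2 -!mulrA.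
have K0 : 0 <= N.+1%:R :> R by [].
split.
  by apply: le_trans b1 _; rewrite ler_pM2l ?ltr0n.
by apply: le_trans a1 _; rewrite ler_pM2l ?ltr0n.
Qed.

(** Part of the uniform convergence theorem for regularly varying functions. *)
Lemma phi_doubling_local : exists r0 C, [/\ 0 < r0, 1 <= C & forall r u, r0 <= r ->
  r <= u <= 2 * r -> phi u <= C * phi r /\ phi r <= C * phi u].
Proof.
have [S [K [h [h0 K1 H]]]] := tame_small.
have K0 : 0 < K by exact: lt_le_trans ltr01 K1.
have Hn n : forall s v, S <= s -> 0 <= v <= n%:R * h ->
    psi (s + v) <= K ^+ n * psi s /\ psi s <= K ^+ n * psi (s + v).
  elim: n => [|n IH] s v Ss.
    rewrite mul0r => /andP[v0 v0']; have -> : v = 0 by apply/eqP; rewrite eq_le v0 v0'.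
    by rewrite addr0 expr0 mul1r.
  rewrite -natr1 mulrDl mul1r => /andP[v0 vn].
  pose w := Num.max 0 (v - h).
  have w0 : 0 <= w by rewrite /w le_max lexx.
  have wv : 0 <= v - w <= h.
    by rewrite /w maxElt; case: ltP; lra.
  have wn : 0 <= w <= n%:R * h.
    rewrite w0 /w ge_max; have : 0 <= n%:R * h by rewrite mulr_ge0// ltW.
    by move=> ->; lra.
  have [a1 a2] := IH s w Ss wn.
  have Ssw : S <= s + w by lra.
  have [b1 b2] := H (s + w) (v - w) Ssw wv.
  have E : s + w + (v - w) = s + v by ring.
  rewrite E in b1 b2; have Kn : 0 < K ^+ n by rewrite exprn_gt0.
  split.
    by apply: le_trans b1 _; rewrite exprS -mulrA ler_pM2l.
  by apply: le_trans a2 _; rewrite exprSr -mulrA ler_pM2l.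
have ln20 : 0 <= ln 2 / h :> R by rewrite divr_ge0 ?(ltW h0)// ln_ge0// ler1n.
pose n := Num.bound (ln 2 / h : R).
exists (expR S), (K ^+ n); split; [exact: expR_gt0|by rewrite exprn_ege1|].
move=> r u Sr /andP[ru u2].
have r0 : 0 < r by apply: lt_le_trans Sr; exact: expR_gt0.
have u0 : 0 < u by exact: lt_le_trans ru.
have := Hn n (ln r) (ln u - ln r).
have -> : ln r + (ln u - ln r) = ln u by ring.
rewrite /psi !lnK ?posrE//; apply.
  by rewrite -ler_expR lnK.
rewrite subr_ge0 ler_ln ?posrE// ru /=.
have : ln u <= ln 2 + ln r by rewrite -lnM ?posrE// ler_ln ?posrE// mulr_gt0.
have := archi_boundP ln20; rewrite ltr_pdivrMr// -/n; lra.
Qed.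

Lemma phi_doubling_ratio : beta < 2 -> exists r0 k1 k2, [/\ 0 < r0, 1 < k1, k2 < 4 &
  forall r, r0 <= r -> k1 * phi r <= phi (2 * r) /\ phi (2 * r) <= k2 * phi r].
Proof.
move=> beta2; have cv := @phi_reg 2 (ltr0Sn _ 1).
have pE z : 2 `^ z = expR (z * ln 2) :> R by rewrite /powR pnatr_eq0.
have l2 : 0 < ln 2 :> R by rewrite ln_gt0// ltr1n.
have b1 : 1 < 2 `^ beta :> R.
  by rewrite -[X in X < _](powRr0 2) !pE ltr_expR ltr_pM2r.
have b2 : 2 `^ beta < 4 :> R.
  have -> : 4 = 2 `^ 2%:R :> R by rewrite powR_mulrn// expr2; ring.
  by rewrite !pE ltr_expR ltr_pM2r.
move: (2 `^ beta) b1 b2 cv => L L1 L4 cv.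
have h1 : (1 + L) / 2 < L by lra.
have h2 : L < (L + 4) / 2 by lra.
have [M1 M10 H1] := near_pinfty_ex (cvgr_gt _ cv _ h1).
have [M2 M20 H2] := near_pinfty_ex (cvgr_lt _ cv _ h2).
exists (M1 + M2), ((1 + L) / 2), ((L + 4) / 2); split; [lra|lra|lra|].
move=> r Mr; have r0 : 0 <= r by lra.
have pr := phi_gt0 r0; split.
  by rewrite -ler_pdivlMr// ltW// H1//; lra.
by rewrite -ler_pdivrMr// ltW// H2//; lra.
Qed.

(** Beyond [r0] the ratio over a factor 2 is close to [2 ^ beta], which lies
    strictly between 1 and 4; the remaining arguments are in the compact set
    [0, r0], where [phi] is bounded above and away from 0. *)
Lemma phi_dyadic : beta < 2 -> exists r0 k1 k2 C, [/\ 0 < r0, 1 < k1, k2 < 4, 1 <= C &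
  [/\ forall k, k1 * phi (r0 * 2 ^+ k) <= phi (r0 * 2 ^+ k.+1),
      forall k, phi (r0 * 2 ^+ k.+1) <= k2 * phi (r0 * 2 ^+ k),
      forall k r, 0 <= r <= r0 * 2 ^+ k -> phi r <= C * phi (r0 * 2 ^+ k) &
      forall k r, r0 * 2 ^+ k <= r -> phi (r0 * 2 ^+ k) <= C * phi r]].
Proof.
move=> beta2.
have [r1 [C1 [r10 C11 H1]]] := phi_doubling_local.
have [r2 [k1 [k2 [r20 k11 k24 H2]]]] := phi_doubling_ratio beta2.
pose r0 := r1 + r2; have r00 : 0 < r0 by rewrite addr_gt0.
have [C2 C21 H3] := phi_bounded (ltW r00).
have ge k : r0 <= r0 * 2 ^+ k by rewrite ler_peMr ?(ltW r00)// exprn_ege1// ler1n.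
have C20 : 0 < C2 by exact: lt_le_trans ltr01 C21.
have C10 : 0 < C1 by exact: lt_le_trans ltr01 C11.
have p0 k : 0 < phi (r0 * 2 ^+ k).
  by apply: phi_gt0; exact: le_trans (ltW r00) (ge k).
have Fge k : k1 * phi (r0 * 2 ^+ k) <= phi (r0 * 2 ^+ k.+1).
  rewrite exprS mulrCA; apply: (H2 _ _).1; apply: le_trans (ge k); rewrite /r0; lra.
have Fle k : phi (r0 * 2 ^+ k.+1) <= k2 * phi (r0 * 2 ^+ k).
  rewrite exprS mulrCA; apply: (H2 _ _).2; apply: le_trans (ge k); rewrite /r0; lra.
have Fmon i j : (i <= j)%N -> phi (r0 * 2 ^+ i) <= phi (r0 * 2 ^+ j).
  move=> /subnKC <-; elim: (j - i)%N => [|q IH]; first by rewrite addn0.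
  by rewrite addnS; apply: le_trans IH _; apply: le_trans (Fge _); rewrite ler_peMl ?ltW.
have loc k r : r0 * 2 ^+ k <= r <= r0 * 2 ^+ k.+1 ->
    phi r <= C1 * phi (r0 * 2 ^+ k) /\ phi (r0 * 2 ^+ k) <= C1 * phi r.
  rewrite exprS (mulrCA r0) => h; apply: H1 => //.
  by apply: le_trans (ge k); rewrite /r0; lra.
have K1 : 1 <= C2 ^+ 2 by rewrite exprn_ege1.
have C0 : 1 <= C1 + C2 ^+ 2 by lra.
exists r0, k1, k2, (C1 + C2 ^+ 2); split => //; split => //.
- elim=> [|k IH] r /andP[r_ge0 rk].
    rewrite expr0 mulr1 in rk *.
    have [|_ h] := H3 r; first by rewrite r_ge0.
    have [|h' _] := H3 r0; first by rewrite (ltW r00) lexx.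
    apply: le_trans h _.
    apply: (@le_trans _ _ (C2 ^+ 2 * phi r0)).
      by rewrite expr2 -mulrA ler_peMr ?(ltW C20)// -ler_pdivrMl// mulr1.
    by rewrite ler_pM2r ?lerDr ?(ltW C10)// phi_gt0// ltW.
  have [h|/ltW h] := leP r (r0 * 2 ^+ k).
    apply: le_trans (IH r _) _; first by rewrite r_ge0.
    by rewrite ler_pM2l ?Fmon//; lra.
  have [//|h1 _] := loc k r; first by rewrite h.
  apply: le_trans h1 _; apply: (@le_trans _ _ (C1 * phi (r0 * 2 ^+ k.+1))).
    by rewrite ler_pM2l// Fmon.
  by rewrite ler_pM2r// lerDl sqr_ge0.
- move=> k r kr; have r_gt0 : 0 < r.
    by apply: lt_le_trans kr; rewrite mulr_gt0// exprn_gt0.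
  have key q : r <= r0 * 2 ^+ (k + q.+1) -> phi (r0 * 2 ^+ k) <= C1 * phi r.
    elim: q => [|q IH] rq.
      by apply: (loc k r _).2; rewrite kr -(addn1 k).
    have [h|/ltW h] := leP r (r0 * 2 ^+ (k + q.+1)); first exact: IH.
    apply: le_trans (Fmon k (k + q.+1)%N (leq_addr _ _)) _.
    by apply: (loc (k + q.+1)%N r _).2; rewrite h -addnS.
  have [i Hi] := exp_unbounded (r / r0) (ltr1n R 2).
  apply: le_trans (key i _) _.
    rewrite -ler_pdivrMl// mulrC; apply: le_trans Hi _.
    by rewrite ler_weXn2l ?ler1n// addnS ltnW// ltnS leq_addl.
  by rewrite ler_pM2r ?lerDl ?sqr_ge0// phi_gt0// ltW.
Qed.

End RegularVariationTheory.

(** Along [x = n ^ (1 / beta)] the conjugate equation reads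
    [r * l r ~ x] for [r = x * lsharp x]; this forces [r] to be large, since [l]
    is bounded on bounded sets, and then [phi r ~ (r * l r) ^ beta ~ n]. *)
Lemma phi_conjugate (R : realType) (beta : R) (phi l lsharp : R -> R) :
  0 < beta -> {within `[0, +oo[, continuous phi} ->
  (forall x : R, 0 <= x -> 0 < phi x) -> (forall x : R, 0 <= x -> 0 < l x) ->
  (forall x : R, 0 <= x -> phi x = ((1 + x) * l x) `^ beta) ->
  de_bruijn_conjugate l lsharp ->
  exists2 C, 1 <= C & forall n : nat, (1 <= n)%N ->
    let r := n%:R `^ (1 / beta) * lsharp (n%:R `^ (1 / beta)) in
    [/\ 0 < r, phi r <= C * n%:R & n%:R <= C * phi r].
Proof.
move=> b0 phi_cont phi0 l0 phiE [ls0 _ _ conj].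
have h1 : 2^-1 < (1 : R) by rewrite invf_lt1// ltr1n.
have h2 : (1 : R) < 2 by rewrite ltr1n.
have [M1 M10 H1] := near_pinfty_ex (cvgr_gt _ conj _ h1).
have [M2 M20 H2] := near_pinfty_ex (cvgr_lt _ conj _ h2).
have [B B1 HB] := phi_bounded phi_cont phi0 (ler01 : 0 <= (1 : R)).
have B0 : 0 < B by exact: lt_le_trans ltr01 B1.
have bi : beta * (1 / beta) = 1 by rewrite mul1r mulfV// gt_eqF.
pose Bl := B `^ (1 / beta).
have Bl0 : 0 < Bl by rewrite powR_gt0.
have lB r : 0 <= r <= 1 -> l r <= Bl.
  move=> r1; have [r0 _] := andP r1; have lr := l0 r r0.
  have [_] := HB r r1; rewrite phiE// => h.
  have e0 : 0 <= 1 / beta by rewrite divr_ge0// ltW.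
  have := ge0_ler_powR e0 _ _ h; rewrite -powRrM bi powRr1; last first.
    by rewrite mulr_ge0 ?(ltW lr)// addr_ge0.
  move=> h'; have {}h' : (1 + r) * l r <= Bl by apply: h'; rewrite nnegrE ?powR_ge0// ltW.
  by apply: le_trans h'; rewrite ler_peMl ?(ltW lr)// lerDl.
pose X := M1 + M2 + 2 * Bl.
pose x n : R := n%:R `^ (1 / beta).
pose r n := x n * lsharp (x n).
have x0 n : (1 <= n)%N -> 0 < x n by move=> n1; rewrite powR_gt0// ltr0n.
have r0 n : (1 <= n)%N -> 0 < r n.
  by move=> n1; rewrite mulr_gt0 ?ls0 ?x0// ltW// x0.
have xb n : x n `^ beta = n%:R.
  by rewrite /x -powRrM mulrC bi powRr1.
have large n : (1 <= n)%N -> X < x n ->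
    phi (r n) <= 4 `^ beta * n%:R /\ n%:R <= 2 `^ beta * phi (r n).
  move=> n1 Xx; have xn := x0 n n1; have rn := r0 n n1.
  have h3 : 2^-1 < lsharp (x n) * l (r n) by apply: H1; rewrite /X in Xx; lra.
  have h4 : lsharp (x n) * l (r n) < 2 by apply: H2; rewrite /X in Xx; lra.
  have rl : r n * l (r n) = x n * (lsharp (x n) * l (r n)) by rewrite /r mulrA.
  have lr := l0 _ (ltW rn).
  have lo : x n / 2 <= r n * l (r n) by rewrite rl ler_pM2l// ltW.
  have hi : r n * l (r n) <= x n * 2 by rewrite rl ler_pM2l// ltW.
  have r1 : 1 < r n.
    rewrite ltNge; apply/negP => r1.
    have := lB (r n); rewrite (ltW rn) r1 => /(_ isT) hl.
    have : r n * l (r n) <= l (r n) by rewrite ler_piMl// ltW.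
    by rewrite /X in Xx; lra.
  have n0 : 0 <= n%:R :> R by [].
  rewrite phiE ?(ltW rn)//; rewrite -(xb n) -!powRM ?(ltW xn)//; last first.
    by rewrite mulr_ge0 ?(ltW lr)// addr_ge0// ltW.
  have lr1 : l (r n) < r n * l (r n) by rewrite ltr_pMl.
  split; apply: ge0_ler_powR; rewrite ?nnegrE ?(ltW b0)//.
  - by rewrite mulr_ge0 ?(ltW lr)// addr_ge0// ltW.
  - by rewrite mulr_ge0 ?(ltW xn).
  - by lra.
  - exact: ltW.
  - by rewrite mulr_ge0// mulr_ge0 ?(ltW lr)// addr_ge0// ltW.
  - by rewrite mulrDl mul1r; lra.
have X0 : 0 < X by rewrite /X; lra.
pose N := Num.bound (X `^ beta).
have smallN n : (1 <= n)%N -> (N <= n)%N -> X < x n.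
  move=> n1 Nn; rewrite ltNge; apply/negP => h.
  have : n%:R <= X `^ beta.
    rewrite -(xb n); apply: ge0_ler_powR;
      by rewrite ?nnegrE ?(ltW b0) ?(ltW X0) ?(ltW (x0 n n1)).
  have := archi_boundP (powR_ge0 X beta); rewrite -/N.
  have : N%:R <= n%:R :> R by rewrite ler_nat.
  lra.
pose C3 := \sum_(n < N) (`|phi (r n)| + `|n%:R / phi (r n)|).
have C30 : 0 <= C3 by apply: sumr_ge0 => i _; rewrite addr_ge0.
have p4 : 0 < 4 `^ beta :> R by rewrite powR_gt0.
have p2 : 0 < 2 `^ beta :> R by rewrite powR_gt0.
exists (1 + 4 `^ beta + 2 `^ beta + C3); first lra.
move=> n n1 /=; rewrite -/(x n) -/(r n); have rn := r0 n n1.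
have pn := phi0 _ (ltW rn); have nn : 1 <= n%:R :> R by rewrite ler1n.
split => //.
  have [/(smallN n n1)/(large n n1)[h _]|nN] := leqP N n.
    by apply: le_trans h _; rewrite ler_wpM2r//; lra.
  have h : phi (r n) <= C3.
    rewrite /C3 (bigD1 (Ordinal nN))//= -[leLHS]gtr0_norm// -addrA lerDl.
    by rewrite addr_ge0// sumr_ge0// => i _; rewrite addr_ge0.
  by apply: le_trans h _; apply: (@le_trans _ _ (C3 * n%:R)); [rewrite ler_peMr|
    rewrite ler_wpM2r//; lra].
have [/(smallN n n1)/(large n n1)[_ h]|nN] := leqP N n.
  by apply: le_trans h _; rewrite ler_wpM2r ?(ltW pn)//; lra.
have h : n%:R / phi (r n) <= C3.
  apply: le_trans (ler_norm _) _; rewrite /C3 (bigD1 (Ordinal nN))//=.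
  apply: (@le_trans _ _ (`|phi (r n)| + `|n%:R / phi (r n)|)).
    by rewrite lerDr.
  by rewrite lerDl sumr_ge0// => i _; rewrite addr_ge0.
rewrite -ler_pdivrMr//; apply: le_trans h _; lra.
Qed.

(** * Restriction of the chain to finite sets *)

Section RealProbability.
Context {d : measure_display} {R : realType} {Omega : measurableType d}.
Variable Q : probability Omega R.
Implicit Types A B : set Omega.

Definition pr A : R := fine (Q A).

Lemma prE A : measurable A -> Q A = (pr A)%:E.
Proof. by move=> mA; rewrite /pr fineK// fin_num_measure. Qed.

Lemma pr_ge0 A : 0 <= pr A. Proof. by rewrite fine_ge0. Qed.

Lemma pr_le A B : measurable A -> measurable B -> A `<=` B -> pr A <= pr B.
Proof. by move=> mA mB AB; rewrite -lee_fin -!prE// le_measure// inE. Qed.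

Lemma pr_le1 A : measurable A -> pr A <= 1.
Proof. by move=> mA; rewrite -lee_fin -prE// probability_le1. Qed.

Lemma prU A B : measurable A -> measurable B -> A `&` B = set0 ->
  pr (A `|` B) = pr A + pr B.
Proof.
move=> mA mB AB; apply: EFin_inj.
by rewrite EFinD -!prE//; [exact: measureU|exact: measurableU].
Qed.

Lemma pr_setC A : measurable A -> pr (~` A) = 1 - pr A.
Proof.
move=> mA; apply: EFin_inj; rewrite EFinB -!prE//; last exact: measurableC.
exact: probability_setC.
Qed.

Lemma pr_setI_ge A B : measurable A -> measurable B ->
  pr A <= pr (A `&` B) + pr (~` B).
Proof.
move=> mA mB; have mC := measurableC mB.
apply: (@le_trans _ _ (pr ((A `&` B) `|` (A `&` ~` B)))).
  rewrite -setIUr setUv setIT//.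
rewrite prU; [|exact: measurableI|exact: measurableI|].
  by rewrite lerD2l; apply: pr_le => //; exact: measurableI.
by rewrite setIACA setICr setI0.
Qed.

Lemma pr_split d' (M : measurableType d') (f : {mfun Omega >-> M}) (s : seq M) A :
  (forall B : set M, measurable B) -> measurable A -> uniq s ->
  pr (A `&` f @^-1` [set` s]) = \sum_(z <- s) pr (A `&` f @^-1` [set z]).
Proof.
move=> Mm mA; elim: s => [_|z s IH /= /andP[zs us]].
  rewrite big_nil (_ : _ `&` _ = set0) ?/pr ?measure0//.
  by apply/seteqP; split => // w /= -[].
have mf (B : set M) : measurable (f @^-1` B) by exact: measurable_funPTI.
rewrite big_cons -IH// -prU; [|exact: measurableI|exact: measurableI|].
  congr pr; rewrite -setIUr; congr (_ `&` _); apply/seteqP; split => w /=.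
    by rewrite inE => /orP[/eqP ->|ws]; [left|right].
  by rewrite inE => -[->|->]; rewrite ?eqxx ?orbT.
apply/seteqP; split => // w /= -[[_ wz] [_ ws]].
by move: zs; rewrite -wz ws.
Qed.

End RealProbability.

Lemma bigcap_ltnP (T : Type) (n : nat) (B : nat -> set T) (w : T) :
  (\bigcap_(i < n) B i) w <-> forall i, (i < n)%N -> B i w.
Proof. by split=> H i; apply: H. Qed.

Section Restriction.
Context {d d' : measure_display} {R : realType}.
Context {M : measurableMetricType d R} {Omega : measurableType d'}.
Variables (P : M -> probability Omega R) (X : nat -> {mfun Omega >-> M}).
Variable p : M -> M -> R.
Implicit Types (S : seq M).
Hypothesis Mm : forall A : set M, d.-measurable A.
Hypothesis Xp : markov_chain P X p.

Lemma measurable_X i (B : set M) : measurable (X i @^-1` B).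
Proof. exact: measurable_funPTI. Qed.

Definition cyl n (B : nat -> set M) : set Omega := \bigcap_(i < n) X i @^-1` B i.

Lemma cylP n B w : cyl n B w <-> forall i, (i < n)%N -> B i (X i w).
Proof. exact: bigcap_ltnP. Qed.

Lemma cylS n B : cyl n.+1 B = cyl n B `&` X n @^-1` B n.
Proof.
apply/seteqP; split => w.
  move=> /cylP H; split; last exact: H.
  by apply/cylP => i h; apply: H; rewrite ltnW.
move=> [/cylP H Hn]; apply/cylP => i; rewrite ltnS leq_eqVlt => /orP[/eqP ->//|].
exact: H.
Qed.

Lemma cyl0 B : cyl 0 B = setT.
Proof. by apply/seteqP; split => // w _; apply/cylP. Qed.

Lemma cyl_measurable n B : measurable (cyl n B).
Proof.
elim: n => [|n IH]; first by rewrite cyl0; exact: measurableT.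
by rewrite cylS; apply: measurableI => //; exact: measurable_X.
Qed.

Definition free_then_fixed k (S : seq M) (s : nat -> M) i : set M :=
  if (i < k)%N then [set` S] else [set s i].

(** The Markov property given that the first [k] positions belong to a finite
    set; it is obtained from that for paths by summing over the positions. *)
Lemma markov_cyl x k n S s : uniq S -> (k <= n)%N ->
  pr (P x) (cyl n.+2 (free_then_fixed k S s)) =
  pr (P x) (cyl n.+1 (free_then_fixed k S s)) * p (s n) (s n.+1).
Proof.
move=> uS; have [_ _ Xm] := Xp.
elim: k s => [|k IH] s kn.
  have h := Xm x n s; apply: EFin_inj; rewrite EFinM.
  rewrite -(prE _ (cyl_measurable n.+2 (free_then_fixed 0 S s))).
  by rewrite -(prE _ (cyl_measurable n.+1 (free_then_fixed 0 S s))).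
pose s' z i := if i == k then z else s i.
pose B0 i := if i == k then [set: M] else free_then_fixed k S s i.
have split N : (k < N)%N -> pr (P x) (cyl N (free_then_fixed k.+1 S s)) =
    \sum_(z <- S) pr (P x) (cyl N (free_then_fixed k S (s' z))).
  move=> kN.
  have -> : cyl N (free_then_fixed k.+1 S s) = cyl N B0 `&` X k @^-1` [set` S].
    apply/seteqP; split => w.
      move=> /cylP H; split; last by have := H k kN; rewrite /free_then_fixed ltnSn.
      apply/cylP => i iN; have := H i iN; rewrite /B0 /free_then_fixed.
      by case: eqP => // ik; rewrite (ltnS i k) (leq_eqVlt i k) (introF eqP ik).
    move=> [/cylP H Hk]; apply/cylP => i iN; have := H i iN.
    rewrite /B0 /free_then_fixed (ltnS i k) (leq_eqVlt i k).
    by have [-> _|] := eqVneq i k; first exact: Hk.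
  rewrite pr_split//; last exact: cyl_measurable.
  apply: eq_bigr => z _; congr pr; apply/seteqP; split => w.
    move=> [/cylP H Hk]; apply/cylP => i iN; have := H i iN.
    rewrite /B0 /free_then_fixed /s'.
    by have [-> _|//] := eqVneq i k; rewrite ltnn.
  move=> /cylP H; split; last first.
    by have := H k kN; rewrite /free_then_fixed /s' ltnn eqxx.
  apply/cylP => i iN; have := H i iN; rewrite /B0 /free_then_fixed /s'.
  by have [->|//] := eqVneq i k.
have kn1 : (k < n.+1)%N by exact: ltnW.
rewrite (split _ (ltnW kn1 : k < n.+2)%N) (split _ kn1).
rewrite mulr_suml; apply: eq_bigr => z _; rewrite IH; last exact: ltnW.
by rewrite /s' (gtn_eqF kn) (gtn_eqF kn1).
Qed.

(** The law at time [n] of the chain killed on leaving [S]; the final position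
    itself is not required to be in [S]. *)
Definition killed x S n z : R :=
  pr (P x) (cyl n (fun=> [set` S]) `&` X n @^-1` [set z]).

Lemma killed0 x S z : killed x S 0 z = (z == x)%:R.
Proof.
have [_ X0 _] := Xp.
have p0 : pr (P x) (X 0%N @^-1` [set x]) = 1 by rewrite /pr X0.
rewrite /killed cyl0 setTI; have [->//|zx] := eqVneq z x.
rewrite mulr0n; apply/eqP; rewrite eq_le pr_ge0 andbT.
have := pr_setC (P x) (measurable_X 0 [set x]); rewrite p0 subrr => <-.
apply: pr_le; [exact: measurable_X|exact: measurableC (measurable_X _ _)|].
by move=> w /= -> /eqP; rewrite (negPf zx).
Qed.

Lemma killedS x S n y : uniq S ->
  killed x S n.+1 y = \sum_(z <- S) killed x S n z * p z y.
Proof.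
move=> uS; rewrite /killed cylS setIAC pr_split//; last first.
  by apply: measurableI; [exact: cyl_measurable|exact: measurable_X].
apply: eq_bigr => z _.
pose s i := if i == n then z else y.
have h := markov_cyl x s uS (leqnn n).
have E1 : cyl n.+1 (free_then_fixed n S s) =
    cyl n (fun=> [set` S]) `&` X n @^-1` [set z].
  rewrite cylS; congr (_ `&` _).
    apply/seteqP; split => w /cylP H; apply/cylP => i iN; have := H i iN;
      by rewrite /free_then_fixed iN.
  by rewrite /free_then_fixed ltnn /s eqxx.
have E2 : cyl n.+2 (free_then_fixed n S s) =
    cyl n (fun=> [set` S]) `&` X n @^-1` [set z] `&` X n.+1 @^-1` [set y].
  rewrite cylS E1; congr (_ `&` _).
  by rewrite /free_then_fixed ltnNge leqnSn /s (gtn_eqF (ltnSn n)).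
rewrite E1 E2 in h.
by rewrite setIAC h /s eqxx (gtn_eqF (ltnSn n)).
Qed.

Lemma step_law x y : pr (P x) (X 1 @^-1` [set y]) = p x y.
Proof.
have [_ X0 _] := Xp.
have p0 : pr (P x) (X 0%N @^-1` [set x]) = 1 by rewrite /pr X0.
have := killedS x 0 y (erefl : uniq [:: x]).
rewrite big_seq1 killed0 eqxx mul1r => <-; rewrite /killed.
have c1 : cyl 1 (fun=> [set` [:: x]]) = X 0%N @^-1` [set x].
  apply/seteqP; split => w.
    by move=> /cylP /(_ 0%N (ltn0Sn _)) /=; rewrite inE => /eqP.
  by move=> /= wx; apply/cylP => -[|//] _ /=; rewrite wx inE eqxx.
rewrite c1; apply/eqP; rewrite eq_le; apply/andP; split; last first.
  apply: pr_le; [|exact: measurable_X|exact: subIsetr].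
  by apply: measurableI; exact: measurable_X.
have := pr_setI_ge (P x) (measurable_X 1 [set y]) (measurable_X 0 [set x]).
rewrite setIC; move/le_trans; apply.
by rewrite pr_setC ?p0 ?subrr ?addr0//; exact: measurable_X.
Qed.

Definition leaving x S i : R := pr (P x) (~` (X i @^-1` [set` S])).

(** Union bound over the times at which the path may be outside [S]. *)
Lemma cyl_lower x S n A : measurable A ->
  pr (P x) A <= pr (P x) (cyl n (fun=> [set` S]) `&` A) + \sum_(i < n) leaving x S i.
Proof.
move=> mA; elim: n => [|n IH].
  by rewrite big_ord0 addr0 cyl0 setTI.
have mc := measurableI _ _ (cyl_measurable n (fun=> [set` S])) mA.
have h : pr (P x) (cyl n (fun=> [set` S]) `&` A) <=
    pr (P x) (cyl n.+1 (fun=> [set` S]) `&` A) + leaving x S n.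
  by rewrite cylS setIAC; apply: pr_setI_ge => //; exact: measurable_X.
by apply: le_trans IH _; rewrite big_ord_recr /= addrA; move: h; lra.
Qed.

Lemma killed_le x S n y : killed x S n y <= pr (P x) (X n @^-1` [set y]).
Proof.
apply: pr_le; [|exact: measurable_X|exact: subIsetr].
by apply: measurableI; [exact: cyl_measurable|exact: measurable_X].
Qed.

Lemma killed_lower x S n y : pr (P x) (X n @^-1` [set y]) <=
  killed x S n y + \sum_(i < n) leaving x S i.
Proof. by apply: cyl_lower; exact: measurable_X. Qed.

Lemma killed_mass x S n : uniq S ->
  1 - \sum_(i < n.+1) leaving x S i <= \sum_(z <- S) killed x S n z.
Proof.
move=> uS; rewrite /killed -pr_split//; last exact: cyl_measurable.
rewrite big_ord_recr /= /leaving pr_setC; last exact: measurable_X.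
have := cyl_lower x S n (measurable_X n [set` S]); rewrite /leaving; lra.
Qed.

(** Laws on a countable space are tight; finitely many starting points and times
    are dealt with together. *)
Lemma exhaustion : countable [set: M] ->
  forall (zs : seq M) (n : nat) (e : R), 0 < e -> exists S : seq M,
  [/\ uniq S, {subset zs <= S} &
      forall z i, z \in zs -> (i <= n)%N -> leaving z S i <= e].
Proof.
move=> /countable_injP[c cinj] zs n e e0.
have {}cinj x y : c x = c y -> x = y by apply: cinj; rewrite inE.
have list N : exists s : seq M, forall z, (c z < N)%N -> z \in s.
  elim: N => [|N [s Hs]]; first by exists [::].
  have [[z0 Hz0]|H] := pselect (exists z, c z = N).
    exists (z0 :: s) => z; rewrite ltnS leq_eqVlt inE => /orP[/eqP E|/Hs ->].
      by rewrite (cinj z z0) ?eqxx// Hz0.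
    by rewrite orbT.
  exists s => z; rewrite ltnS leq_eqVlt => /orP[/eqP E|/Hs//].
  by case: H; exists z.
have small z i : exists N, pr (P z) (~` (X i @^-1` [set y | (c y < N)%N])) <= e.
  pose G N := ~` (X i @^-1` [set y | (c y < N)%N]).
  have mG N : measurable (G N) by apply: measurableC; exact: measurable_X.
  have G0 : \bigcap_N G N = set0.
    by apply/seteqP; split => // w /(_ (c (X i w)).+1 I); apply => /=.
  have := @nonincreasing_cvg_mu _ _ _ (P z) G.
  rewrite G0 measure0 => /(_ _ mG measurable0).
  move=> H; have : (P z \o G) x @[x --> \oo] --> (0 : \bar R)%E.
    apply: H; first by apply: le_lt_trans (probability_le1 _ (mG 0%N)) _; exact: ltry.
    move=> a b ab; apply/subsetPset => w /= h1 h2; apply: h1.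
    exact: leq_trans ab.
  move=> /fine_cvgP[_ /cvgr_lt] /(_ e e0) [N _ HN].
  by exists N; apply: ltW; exact: (HN N (leqnn N)).
have all_small z : exists N, forall i, (i <= n)%N ->
    pr (P z) (~` (X i @^-1` [set y | (c y < N)%N])) <= e.
  elim: n => [|n' [N1 H1]].
    have [N HN] := small z 0%N; exists N => i; rewrite leqn0 => /eqP ->//.
  have [N2 H2] := small z n'.+1.
  have mono i N N' : (N <= N')%N ->
      pr (P z) (~` (X i @^-1` [set y | (c y < N')%N])) <=
      pr (P z) (~` (X i @^-1` [set y | (c y < N)%N])).
    move=> NN; apply: pr_le; try (apply: measurableC; exact: measurable_X).
    by move=> w /= h1 h2; apply: h1; exact: leq_trans NN.
  exists (maxn N1 N2) => i; rewrite leq_eqVlt => /orP[/eqP ->|h].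
    by apply: le_trans H2; apply: mono; rewrite leq_maxr.
  by apply: le_trans (H1 i h); apply: mono; rewrite leq_maxl.
have [N HN] : exists N, forall z i, z \in zs -> (i <= n)%N ->
    pr (P z) (~` (X i @^-1` [set y | (c y < N)%N])) <= e.
  elim: zs => [|z0 zs [N1 H1]]; first by exists 0%N.
  have [N2 H2] := all_small z0.
  have mono z i N N' : (N <= N')%N ->
      pr (P z) (~` (X i @^-1` [set y | (c y < N')%N])) <=
      pr (P z) (~` (X i @^-1` [set y | (c y < N)%N])).
    move=> NN; apply: pr_le; try (apply: measurableC; exact: measurable_X).
    by move=> w /= h1 h2; apply: h1; exact: leq_trans NN.
  exists (maxn N1 N2) => z i; rewrite inE => /orP[/eqP ->|zz] ij.
    by apply: le_trans (H2 i ij); apply: mono; rewrite leq_maxr.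
  by apply: le_trans (H1 z i zz ij); apply: mono; rewrite leq_maxl.
have [s Hs] := list N.
exists (undup (zs ++ s)); split; first exact: undup_uniq.
  by move=> z zz; rewrite mem_undup mem_cat zz.
move=> z i zz ij; apply: le_trans (HN z i zz ij).
apply: pr_le; try (apply: measurableC; exact: measurable_X).
by move=> w /= h1 h2; apply: h1; rewrite mem_undup mem_cat Hs ?orbT.
Qed.

End Restriction.

Lemma sum_seq_sub (R : realType) (M : choiceType) (S : seq M) (F : M -> R)
  (Q : pred M) : uniq S ->
  \sum_(y : seq_sub S | Q (val y)) F (val y) = \sum_(y <- S | Q y) F y.
Proof.
move=> uS; rewrite -(big_map val Q F); apply: perm_big; apply: uniq_perm => //.
  by rewrite (map_inj_uniq val_inj) index_enum_uniq.
move=> y; apply/mapP/idP => [[z _ ->]|yS]; first exact: valP.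
by exists (SeqSub yS); rewrite ?mem_index_enum.
Qed.

Lemma sum3_ge (R : realFieldType) (a b c : R) : 0 <= a -> 0 <= b -> 0 <= c ->
  [/\ a <= a + b + c, b <= a + b + c & c <= a + b + c].
Proof. by split; lra. Qed.

Section FiniteBalls.
Context {d : measure_display} {R : realType} {M : measurableMetricType d R}.
Variables (mu : {measure set M -> \bar R}) (Cm : R).
Hypothesis Mm : forall A : set M, d.-measurable A.
Hypothesis Cm1 : 1 <= Cm.
Hypothesis mu_bd : forall x : M, ((Cm^-1)%:E <= mu [set x] <= Cm%:E)%E.

Let Cm0 : 0 < Cm. Proof. exact: lt_le_trans ltr01 Cm1. Qed.

Lemma mu1E x : mu [set x] = (mass mu x)%:E.
Proof.
have /andP[h1 h2] := mu_bd x; rewrite /mass fineK// fin_numElt.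
apply/andP; split; first by apply: lt_le_trans h1; exact: ltNyr.
by apply: le_lt_trans h2 _; exact: ltry.
Qed.

Lemma mass_ge x : Cm^-1 <= mass mu x.
Proof. by have /andP[h _] := mu_bd x; move: h; rewrite mu1E lee_fin. Qed.

Lemma mass_gt0 x : 0 < mass mu x.
Proof. by apply: lt_le_trans (mass_ge x); rewrite invr_gt0. Qed.

Lemma mu_seq (s : seq M) : uniq s -> mu [set` s] = (\sum_(y <- s) mass mu y)%:E.
Proof.
elim: s => [_|z s IH /= /andP[zs us]].
  rewrite big_nil (_ : [set` _] = set0) ?measure0//.
  by apply/seteqP; split.
rewrite big_cons EFinD -IH// -mu1E -measureU; [| exact: Mm | exact: Mm |].
  congr (mu _); apply/seteqP; split => y /=.
    by rewrite inE => /orP[/eqP ->|ys]; [left|right].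
  by rewrite inE => -[->|->]; rewrite ?eqxx ?orbT.
by apply/seteqP; split => // y /= -[-> zs']; move: zs; rewrite zs'.
Qed.

Lemma sum_mass_le (s : seq M) (B : set M) (c : R) : uniq s ->
  (forall y, y \in s -> B y) -> (mu B <= c%:E)%E -> \sum_(y <- s) mass mu y <= c.
Proof.
move=> us sB Bc; rewrite -lee_fin -mu_seq//; apply: le_trans Bc.
by apply: le_measure => //; apply/mem_set; exact: Mm.
Qed.

(** Points have mass bounded below, so that a set of finite measure is finite. *)
Lemma finite_set_of_mu (B : set M) (c : R) : (mu B <= c%:E)%E ->
  exists s : seq M, uniq s /\ forall y, y \in s <-> B y.
Proof.
move=> Bc; have fB : finite_set B.
  apply: contrapT => /(infinite_set_fset (Num.bound (Cm * `|c|)))[X XB cX].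
  have := @sum_mass_le (finmap.enum_fset X) B c (finmap.fset_uniq X) XB Bc.
  apply/negP; rewrite -ltNge.
  have h : c < (Num.bound (Cm * `|c|))%:R * Cm^-1.
    rewrite ltr_pdivlMr// mulrC.
    apply: le_lt_trans (archi_boundP (mulr_ge0 (ltW Cm0) (normr_ge0 c))).
    by rewrite ler_pM2l// ler_norm.
  apply: lt_le_trans h _.
  apply: (@le_trans _ _ (\sum_(y <- finmap.enum_fset X) Cm^-1)); last first.
    by apply: ler_sum => y _; exact: mass_ge.
  rewrite big_const_seq count_predT iter_addr addr0 -[leRHS]mulr_natl.
  by rewrite ler_pM2r ?invr_gt0// ler_nat.
have /finite_fsetP[X XE] := fB; exists (finmap.enum_fset X).
split; first exact: finmap.fset_uniq.
by move=> y; rewrite XE.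
Qed.

End FiniteBalls.

Section RestrictedWalk.
Context {d d' : measure_display} {R : realType}.
Context {M : measurableMetricType d R} {Omega : measurableType d'}.
Variables (P : M -> probability Omega R) (X : nat -> {mfun Omega >-> M}).
Variables (p : M -> M -> R) (mu : {measure set M -> \bar R}) (Vh phi : R -> R).
Variables (Cm Ch C1 Cphi r0 : R) (S : scaling R).
Hypothesis Mm : forall A : set M, d.-measurable A.
Hypothesis Xp : markov_chain P X p.
Hypothesis Cm1 : 1 <= Cm.
Hypothesis mu_bd : forall x : M, ((Cm^-1)%:E <= mu [set x] <= Cm%:E)%E.
Hypothesis Vh_gt0 : forall r : R, 0 <= r -> 0 < Vh r.
Hypothesis Vh_mono : forall r s : R, 0 <= r -> r <= s -> Vh r <= Vh s.
Hypothesis Ch1 : 1 <= Ch.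
Hypothesis Vh_vol : forall (x : M) (r : R), 0 < r ->
  ((Ch^-1 * Vh r)%:E <= volume mu x r <= (Ch * Vh r)%:E)%E.
Hypothesis C10 : 0 < C1.
Hypothesis phi_gt0 : forall x : R, 0 <= x -> 0 < phi x.
Hypothesis J_bounds : forall x y : M,
  [/\ C1^-1 * (1 / (Vh (mdist x y) * phi (mdist x y))) <= jump_kernel mu P X x y,
      jump_kernel mu P X x y = jump_kernel mu P X y x &
      jump_kernel mu P X x y <= C1 * (1 / (Vh (mdist x y) * phi (mdist x y)))].
Hypothesis r00 : 0 < r0.
Hypothesis Cphi1 : 1 <= Cphi.
Hypothesis UE : forall k, U S k = Vh (r0 * 2 ^+ k).
Hypothesis FE : forall k, F S k = phi (r0 * 2 ^+ k).
Hypothesis phi_le : forall k r, 0 <= r <= r0 * 2 ^+ k ->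
  phi r <= Cphi * phi (r0 * 2 ^+ k).
Hypothesis phi_ge : forall k r, r0 * 2 ^+ k <= r -> phi (r0 * 2 ^+ k) <= Cphi * phi r.

Let A := Cm + C1 * Cphi + Ch.
Let mass0 x : 0 < mass mu x. Proof. exact: mass_gt0 Cm1 mu_bd x. Qed.
Let massV x : mass mu x != 0. Proof. by rewrite gt_eqF. Qed.
Let CC0 : 0 < C1 * Cphi. Proof. by rewrite mulr_gt0// (lt_le_trans ltr01). Qed.
Let A_ge : [/\ Cm <= A, C1 * Cphi <= A & Ch <= A].
Proof. by apply: sum3_ge; [exact: le_trans Cm1|exact: ltW CC0|exact: le_trans Ch1]. Qed.
Let A1 : 1 <= A. Proof. by have [h _ _] := A_ge; exact: le_trans h. Qed.
Let A0 : 0 < A. Proof. exact: lt_le_trans ltr01 A1. Qed.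
Let ACC : C1 * Cphi <= A. Proof. by have [] := A_ge. Qed.
Let AChm : Cm <= A /\ Ch <= A. Proof. by have [] := A_ge. Qed.
Let p2 k : 0 < r0 * 2 ^+ k. Proof. by rewrite mulr_gt0// exprn_gt0. Qed.

Definition jump x y : R := p x y / mass mu y.

Lemma jump_kernelE x y : jump_kernel mu P X x y = jump x y.
Proof.
by rewrite /jump_kernel /heat_kernel /nstep /jump -(step_law Mm Xp x y).
Qed.

Lemma jump_sym x y : jump x y = jump y x.
Proof. by have [_ h _] := J_bounds x y; rewrite -!jump_kernelE. Qed.

Lemma jump_le x y : jump x y <= A.
Proof.
have p1 : p x y <= 1 by rewrite -(step_law Mm Xp x y) pr_le1//; exact: measurable_X.
rewrite /jump ler_pdivrMr//; apply: le_trans p1 _.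
have := mass_ge mu_bd y; rewrite -[leLHS]div1r ler_pdivrMr ?(lt_le_trans ltr01 Cm1)//.
move/le_trans; apply; rewrite mulrC ler_pM2r//; exact: (proj1 AChm).
Qed.

Lemma jump_up k x y : r0 * 2 ^+ k < mdist x y -> jump x y <= A / (U S k * F S k).
Proof.
move=> h; have [_ _] := J_bounds x y; rewrite jump_kernelE => /le_trans; apply.
have d0 : 0 <= mdist x y by exact: mdist_ge0.
have V0 := Vh_gt0 d0; have f0 := phi_gt0 d0.
have Vk := Vh_gt0 (ltW (p2 k)); have fk := phi_gt0 (ltW (p2 k)).
rewrite UE FE; have hV := Vh_mono (ltW (p2 k)) (ltW h).
have hf := phi_ge (ltW h).
rewrite mulrA mulr1 ler_pdivrMr ?mulr_gt0// mulrAC ler_pdivlMr ?mulr_gt0//.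
apply: (@le_trans _ _ (C1 * (Vh (mdist x y) * (Cphi * phi (mdist x y))))).
  by rewrite ler_pM2l//; apply: ler_pM => //; rewrite ltW.
have -> : C1 * (Vh (mdist x y) * (Cphi * phi (mdist x y))) =
  C1 * Cphi * (Vh (mdist x y) * phi (mdist x y)) by ring.
by rewrite ler_pM2r ?mulr_gt0.
Qed.

Lemma jump_low k x y : mdist x y <= r0 * 2 ^+ k ->
  (A * (U S k * F S k))^-1 <= jump x y.
Proof.
move=> h; have [+ _ _] := J_bounds x y; rewrite jump_kernelE; apply: le_trans.
have d0 : 0 <= mdist x y by exact: mdist_ge0.
have V0 := Vh_gt0 d0; have f0 := phi_gt0 d0.
have Vk := Vh_gt0 (ltW (p2 k)); have fk := phi_gt0 (ltW (p2 k)).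
rewrite UE FE; have hV := Vh_mono d0 h.
have hf : phi (mdist x y) <= Cphi * phi (r0 * 2 ^+ k) by apply: phi_le; rewrite d0.
rewrite div1r -invfM lef_pV2 ?posrE ?mulr_gt0//.
apply: (@le_trans _ _ (C1 * (Vh (r0 * 2 ^+ k) * (Cphi * phi (r0 * 2 ^+ k))))).
  by rewrite ler_pM2l//; apply: ler_pM => //; rewrite ltW.
have -> : C1 * (Vh (r0 * 2 ^+ k) * (Cphi * phi (r0 * 2 ^+ k))) =
  C1 * Cphi * (Vh (r0 * 2 ^+ k) * phi (r0 * 2 ^+ k)) by ring.
by rewrite ler_pM2r ?mulr_gt0.
Qed.

Lemma jump_ge0 x y : 0 <= jump x y.
Proof. by have [[p0 _] _ _] := Xp; rewrite divr_ge0// ltW. Qed.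

Lemma jump_mass x (s : seq M) : uniq s -> \sum_(y <- s) jump x y * mass mu y <= 1.
Proof.
move=> us; have -> : \sum_(y <- s) jump x y * mass mu y =
    pr (P x) (setT `&` X 1 @^-1` [set` s]).
  rewrite pr_split//; apply: eq_bigr => y _.
  by rewrite setTI (step_law Mm Xp) /jump divfK.
by rewrite setTI pr_le1//; exact: measurable_X.
Qed.

(** The whole ball of [M] is added to the finite set before its volume is
    used. *)
Lemma jump_mass_ball k x (s : seq M) : uniq s ->
  \sum_(y <- s) (jump x y - (mdist x y <= r0 * 2 ^+ k)%R%:R / (A * (U S k * F S k)))
    * mass mu y <= 1 - (A ^+ 2 * F S k)^-1.
Proof.
move=> us; have Uk := U_gt0 S k; have Fk := F_gt0 S k.
have b0 : 0 < A * (U S k * F S k) by rewrite !mulr_gt0.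
have /andP[V1 V2] := Vh_vol x (p2 k).
have [bs [ubs bsE]] := finite_set_of_mu Mm Cm1 mu_bd V2.
pose g y : R := (jump x y - (mdist x y <= r0 * 2 ^+ k)%R%:R / (A * (U S k * F S k)))
  * mass mu y.
have g0 y : 0 <= g y.
  rewrite /g mulr_ge0 ?(ltW (mass0 y))// subr_ge0.
  have [h|h] := boolP (mdist x y <= r0 * 2 ^+ k)%R; last by rewrite mul0r jump_ge0.
  by rewrite mul1r jump_low.
pose t := s ++ [seq y <- bs | y \notin s].
have ut : uniq t.
  rewrite cat_uniq us filter_uniq//= andbT; apply/hasPn => y.
  by rewrite mem_filter => /andP[].
apply: (@le_trans _ _ (\sum_(y <- t) g y)).
  by rewrite big_cat /= lerDl; apply: sumr_ge0.
have -> : \sum_(y <- t) g y = \sum_(y <- t) jump x y * mass mu y -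
    (A * (U S k * F S k))^-1 * \sum_(y <- t | (mdist x y <= r0 * 2 ^+ k)%R) mass mu y.
  rewrite mulr_sumr [X in _ - X]big_mkcond -sumrB; apply: eq_bigr => y _.
  by rewrite /g; case: ifP => _ /=; ring.
have -> : \sum_(y <- t | (mdist x y <= r0 * 2 ^+ k)%R) mass mu y =
    \sum_(y <- bs) mass mu y.
  rewrite -big_filter; apply: perm_big; apply: uniq_perm => //.
    exact: filter_uniq.
  move=> y; rewrite mem_filter mem_cat mem_filter.
  have [ybs|ybs] := boolP (y \in bs).
    have -> : (mdist x y <= r0 * 2 ^+ k)%R by have /bsE := ybs.
    by case: (y \in s).
  rewrite andbF orbF; apply/negP => /andP[h _]; case/negP: ybs; exact/bsE.
have bsV : Ch^-1 * U S k <= \sum_(y <- bs) mass mu y.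
  rewrite UE -lee_fin; apply: le_trans V1 _.
  rewrite -(mu_seq Mm mu_bd)// /volume (_ : [set` bs] = cball x (r0 * 2 ^+ k))//.
  by apply/seteqP; split => y /bsE.
apply: lerB; first exact: jump_mass.
have Ch0 : 0 < Ch by exact: lt_le_trans ltr01 Ch1.
apply: (@le_trans _ _ ((A * (U S k * F S k))^-1 * (Ch^-1 * U S k))); last first.
  by rewrite ler_pM2l ?invr_gt0.
have -> : (A * (U S k * F S k))^-1 * (Ch^-1 * U S k) = (A * F S k * Ch)^-1.
  by field; rewrite !gt_eqF.
rewrite lef_pV2 ?posrE ?mulr_gt0 ?exprn_gt0// expr2.
have -> : A * A * F S k = A * F S k * A by ring.
have ChA : Ch <= A := proj2 AChm.
by rewrite ler_pM2l ?mulr_gt0.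
Qed.

(** The chain killed on leaving a finite set is a walk in the sense of the
    finite theory, for distances measured in units of [r0]. *)
Lemma restricted_walk (s : seq M) : uniq s ->
  exists (W : walk S A) (v : W -> M),
  [/\ forall z, z \in s -> exists w, v w = z,
      forall w w', dl w w' = mdist (v w) (v w') / r0,
      forall n w w', hk (@m R S A W) (@J R S A W) n w w' =
        killed P X (v w) s n (v w') / mass mu (v w') &
      forall n w, 1 - \sum_(i < n.+1) leaving P X (v w) s i <=
        kpow (@m R S A W) (@J R S A W) n (fun=> 1) w].
Proof.
move=> us.
pose T : finType := seq_sub s.
pose mT (x : T) : R := mass mu (val x).
pose dT (x y : T) : R := mdist (val x) (val y) / r0.
pose JT (x y : T) : R := jump (val x) (val y).
have dTk x y k : (dT x y <= 2 ^+ k) = (mdist (val x) (val y) <= r0 * 2 ^+ k).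
  by rewrite /dT ler_pdivrMr// mulrC.
have m_ge' x : A^-1 <= mT x.
  apply: le_trans (mass_ge mu_bd (val x)).
  rewrite lef_pV2 ?posrE ?(lt_le_trans ltr01 Cm1)//; exact: (proj1 AChm).
have dl_ge0' x y : 0 <= dT x y by rewrite divr_ge0 ?mdist_ge0// ltW.
have dlxx' x : dT x x = 0 by rewrite /dT mdistxx mul0r.
have dl_sym' x y : dT x y = dT y x by rewrite /dT metric_sym.
have dl_tri' x y z : dT x z <= dT x y + dT y z.
  by rewrite /dT -mulrDl ler_pM2r ?invr_gt0// metric_triangle.
have J_sym' x y : JT x y = JT y x by exact: jump_sym.
have J_le' x y : JT x y <= A by exact: jump_le.
have J_up' k x y : 2 ^+ k < dT x y -> JT x y <= A / (U S k * F S k).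
  by move=> h; apply: jump_up; rewrite ltNge -dTk -ltNge.
have J_low' k x y : dT x y <= 2 ^+ k -> (A * (U S k * F S k))^-1 <= JT x y.
  by rewrite dTk; exact: jump_low.
have vol' k x : \sum_(y | dT x y <= 2 ^+ k) mT y <= A * U S k.
  under eq_bigl => y do rewrite dTk.
  rewrite (sum_seq_sub (mass mu) (fun y => mdist (val x) y <= r0 * 2 ^+ k)%R us).
  rewrite -big_filter.
  apply: le_trans (_ : _ <= Ch * U S k) _; last first.
    by rewrite ler_pM2r ?U_gt0//; exact: (proj2 AChm).
  have /andP[_ V2] := Vh_vol (val x) (p2 k); rewrite UE.
  apply: sum_mass_le V2 => //; first exact: filter_uniq.
  by move=> y; rewrite mem_filter => /andP[].
have mass' x : \sum_y JT x y * mT y <= 1.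
  rewrite (sum_seq_sub (fun y => jump (val x) y * mass mu y) predT us).
  exact: jump_mass.
have mass_ball' k x : \sum_y
    (JT x y - (dT x y <= 2 ^+ k)%R%:R / (A * (U S k * F S k))) * mT y
      <= 1 - (A ^+ 2 * F S k)^-1.
  under eq_bigr => y do rewrite dTk.
  rewrite (sum_seq_sub (fun y => (jump (val x) y - (mdist (val x) y <= r0 * 2 ^+ k)%R%:R
    / (A * (U S k * F S k))) * mass mu y) predT us).
  exact: jump_mass_ball.
pose W : walk S A := @Walk R S A T mT dT JT A1 m_ge' dl_ge0' dlxx' dl_sym' dl_tri'
  J_sym' J_le' J_up' J_low' vol' mass' mass_ball'.
have mT0 x : 0 < mT x by exact: mass0.
have hkE n (w w' : T) : hk mT JT n w w' =
    killed P X (val w) s n (val w') / mass mu (val w').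
  elim: n w' => [|n IH] w'.
    rewrite (killed0 Mm Xp) /hk /kpow /= /point_mass (inj_eq val_inj).
    by case: eqP => [->|_]; rewrite ?mul0r.
  rewrite /hk kpowS /kapp (killedS Mm Xp)// mulr_suml.
  rewrite -(sum_seq_sub (fun z => killed P X (val w) s n z * p z (val w')
    / mass mu (val w')) predT us).
  apply: eq_bigr => z _; rewrite -/(hk mT JT n w z) IH J_sym' /JT /jump /mT.
  by field; rewrite !massV.
exists W, val; split => //.
- by move=> z zs; exists (SeqSub zs).
- move=> n w; rewrite (kpowE (@m_gt0 R S A W)); last exact: J_sym'.
  apply: le_trans (killed_mass P X Mm (val w) n us) _.
  rewrite -(sum_seq_sub (killed P X (val w) s n) predT us).
  apply: ler_sum => y _; rewrite mulr1 /= hkE /mT divfK//.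
Qed.

End RestrictedWalk.

(** * The heat kernel estimate *)

Theorem theorem1p1
  (R : realType)
  (d : measure_display) (M : measurableMetricType d R)
  (M_countable : countable [set: M])
  (M_measurable : forall A : set M, d.-measurable A)
  (M_unif_discrete : uniformly_discrete M)
  (mu : {measure set M -> \bar R})
  (mu_counting : comparable_to_counting mu)
  (Vh : R -> R)
  (mu_doubling : homogeneous_volume_doubling mu Vh)
  (beta : R) (beta_gt0 : 0 < beta) (beta_lt2 : beta < 2)
  (phi l : R -> R)
  (phi_continuous : {within `[0, +oo[, continuous phi})
  (phi_gt0 : forall x : R, 0 <= x -> 0 < phi x)
  (phi_regular : regularly_varying phi beta)
  (l_gt0 : forall x : R, 0 <= x -> 0 < l x)
  (l_slow : slowly_varying l)
  (phiE : forall x : R, 0 <= x -> phi x = ((1 + x) * l x) `^ beta)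
  (lsharp : R -> R)
  (lsharp_conj : de_bruijn_conjugate l lsharp)
  (d' : measure_display) (Omega : measurableType d')
  (P : M -> probability Omega R) (X : nat -> {mfun Omega >-> M})
  (p : M -> M -> R)
  (X_markov : markov_chain P X p)
  (p_reversible : reversible mu p)
  (J_bounds : exists2 C1 : R, 0 < C1 & forall x y : M,
     [/\ C1^-1 * (1 / (Vh (mdist x y) * phi (mdist x y)))
           <= jump_kernel mu P X x y,
         jump_kernel mu P X x y = jump_kernel mu P X y x &
         jump_kernel mu P X x y
           <= C1 * (1 / (Vh (mdist x y) * phi (mdist x y)))]) :
  exists2 C2 : R, 0 < C2 & forall (n : nat) (x y : M), (1 <= n)%N ->
    heat_kernel mu P X n x y
      <= C2 * Num.min
           (1 / Vh (n%:R `^ (1 / beta) * lsharp (n%:R `^ (1 / beta))))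
           (n%:R / (Vh (mdist x y) * phi (mdist x y)))
    /\
    C2^-1 * Num.min
           (1 / Vh (n%:R `^ (1 / beta) * lsharp (n%:R `^ (1 / beta))))
           (n%:R / (Vh (mdist x y) * phi (mdist x y)))
      <= heat_kernel mu P X n x y.
Proof.
have [Cm Cm1 mu_bd] := mu_counting.
have [Vh0 Vh_mono [CD CD1 Vh_dbl] [Ch Ch1 Vh_vol]] := mu_doubling.
have [C1 C10 Jb] := J_bounds.
have [r0 [k1 [k2 [Cp [r00 k11 k24 Cp1 [Fge Fle phi_le phi_ge]]]]]] :=
  phi_dyadic beta_gt0 phi_continuous phi_gt0 phi_regular beta_lt2.
have [C5 C51 HR] :=
  phi_conjugate beta_gt0 phi_continuous phi_gt0 l_gt0 phiE lsharp_conj.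
have p2 k : 0 < r0 * 2 ^+ k by rewrite mulr_gt0// exprn_gt0.
have Uge k : Vh (r0 * 2 ^+ k) <= Vh (r0 * 2 ^+ k.+1).
  apply: Vh_mono; first exact: ltW.
  by rewrite ler_pM2l// ler_weXn2l// ler1n.
have Udbl k : Vh (r0 * 2 ^+ k.+1) <= CD * Vh (r0 * 2 ^+ k).
  by rewrite exprS mulrCA; exact: Vh_dbl.
pose S := @Scaling R (fun k => Vh (r0 * 2 ^+ k)) (fun k => phi (r0 * 2 ^+ k)) CD k1 k2
  (fun k => Vh0 _ (ltW (p2 k))) Uge Udbl (fun k => phi_gt0 _ (ltW (p2 k)))
  k11 k24 Fge Fle.
pose A := Cm + C1 * Cp + Ch.
have UE k : U S k = Vh (r0 * 2 ^+ k) by [].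
have FE k : F S k = phi (r0 * 2 ^+ k) by [].
have build s := @restricted_walk d d' R M Omega P X p mu Vh phi Cm Ch C1 Cp r0 S
  M_measurable X_markov Cm1 mu_bd Vh0 Vh_mono Ch1 Vh_vol C10 phi_gt0 Jb r00 Cp1 UE FE
  phi_le phi_ge s.
have Cp0 : 0 < Cp by exact: lt_le_trans ltr01 Cp1.
have C50 : 0 < C5 by exact: lt_le_trans ltr01 C51.
have K20 := k2_gt0 S; have D0 := D_gt0 S; have K21 := k2_gt1 S.
rewrite /= in K20 D0 K21.
(* A finite walk whose heat kernel is [e]-close to that of the chain and which
   loses little mass up to time [n] from [x], [y] and their neighbourhoods. *)
have transfer n x y j (e : R) : 0 < e -> exists (W : walk S A) (a b : W),
   [/\ hk (@m R S A W) (@J R S A W) n a b <= heat_kernel mu P X n x y,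
       heat_kernel mu P X n x y <= hk (@m R S A W) (@J R S A W) n a b + e,
       dl a b = mdist x y / r0,
       retains n a /\ retains n b &
       forall z : W, lvl j a z || lvl j b z -> retains n z].
  move=> e0.
  have ball (z : M) : exists bs : seq M, forall u, mdist z u <= r0 * 2 ^+ j -> u \in bs.
    have /andP[_ V2] := Vh_vol z _ (p2 j).
    have [bs [_ H]] := finite_set_of_mu M_measurable Cm1 mu_bd V2.
    by exists bs => u /H.
  have [bx Hbx] := ball x; have [by' Hby] := ball y.
  have my : 0 < mass mu y by exact: mass_gt0 Cm1 mu_bd y.
  pose e' := Num.min 4^-1 (e * mass mu y) / n.+1%:R.
  have e'0 : 0 < e' by rewrite divr_gt0// lt_min invr_gt0 ltr0n mulr_gt0.
  have e'n : n.+1%:R * e' = Num.min 4^-1 (e * mass mu y).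
    by rewrite /e' mulrC divfK// pnatr_eq0.
  have e'4 : n.+1%:R * e' <= 4^-1 by rewrite e'n ge_min lexx.
  have e'e : n.+1%:R * e' <= e * mass mu y by rewrite e'n ge_min lexx orbT.
  have [s [us zs Hs]] := exhaustion P X M_measurable M_countable
    (x :: y :: bx ++ by') n e'0.
  have leav z i : z \in x :: y :: bx ++ by' -> (i <= n.+1)%N ->
      \sum_(i' < i) leaving P X z s i' <= n.+1%:R * e'.
    move=> zz ijn; apply: (@le_trans _ _ (i%:R * e')); last first.
      by rewrite ler_pM2r// ler_nat.
    have -> : i%:R * e' = \sum_(i' < i) e' by rewrite sumr_const card_ord mulr_natl.
    apply: ler_sum => i' _.
    by apply: Hs => //; rewrite -ltnS (leq_trans _ ijn).
  have [W [v [vs vd vk vm]]] := build s us.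
  have xin : x \in x :: y :: bx ++ by' by rewrite inE eqxx.
  have yin : y \in x :: y :: bx ++ by' by rewrite !inE eqxx orbT.
  have [a va] := vs x (zs _ xin); have [b vb] := vs y (zs _ yin).
  have ret w : v w \in x :: y :: bx ++ by' -> retains n w.
    move=> vw i ijn; apply: le_trans (vm i w).
    have := leav (v w) i.+1 vw ijn; have := e'4; lra.
  have hE : heat_kernel mu P X n x y = pr (P x) (X n @^-1` [set y]) / mass mu y by [].
  exists W, a, b; rewrite vk va vb hE; split.
  - by rewrite ler_pM2r ?invr_gt0// killed_le.
  - rewrite -[X in _ + X](mulfK (lt0r_neq0 my)) -mulrDl ler_pM2r ?invr_gt0//.
    apply: le_trans (killed_lower P X M_measurable x s n y) _.
    by rewrite lerD2l (le_trans _ e'e)// leav.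
  - by rewrite vd va vb.
  - by split; apply: ret; rewrite ?va ?vb.
  - move=> z /orP[]; rewrite /lvl vd ler_pdivrMr// mulrC ?va ?vb => h.
      by apply: ret; rewrite !inE mem_cat Hbx ?orbT.
    by apply: ret; rewrite !inE mem_cat Hby ?orbT.
pose r n := n%:R `^ (1 / beta) * lsharp (n%:R `^ (1 / beta)).
have F0 := F_gt0 S 0; have U0 := U_gt0 S 0; rewrite /= in F0 U0.
pose B := F S 0 + k2 * (Cp * C5).
(* The dyadic scale of [r n]; for [r n <= r0] it is 0, and the constants involve
   [F 0] and [U 0 / Vh 0]. *)
have scale n : (1 <= n)%N -> exists k, [/\ r n <= r0 * 2 ^+ k, F S k <= B * n%:R,
    n%:R <= C5 * Cp * F S k & U S k <= (CD + U S 0 / Vh 0) * Vh (r n)].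
  move=> n1; have nR : 1 <= n%:R :> R by rewrite ler1n.
  have [rn hi lo] := HR n n1; rewrite -/(r n) in rn hi lo.
  have ex : exists k, r n <= r0 * 2 ^+ k.
    have [k Hk] := exp_unbounded (r n / r0) (ltr1n R 2).
    by exists k; rewrite -ler_pdivrMl// mulrC.
  have [k Hk kmin] := ex_minnP ex; exists k.
  have V0 := Vh0 0 (lexx 0); have Vr := Vh0 _ (ltW rn).
  have B0 : 0 < k2 * (Cp * C5) by rewrite !mulr_gt0.
  have h3 : n%:R <= C5 * Cp * F S k.
    apply: le_trans lo _; rewrite -mulrA ler_pM2l//; apply: phi_le.
    by rewrite (ltW rn).
  have UV0 : 0 < U S 0 / Vh 0 by rewrite divr_gt0// U_gt0.
  split => //.
    case: k Hk kmin {h3} => [|k] Hk kmin.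
      by rewrite /B; have := F_gt0 S 0; nra.
    have h : r0 * 2 ^+ k <= r n.
      by rewrite leNgt; apply/negP => /ltW /kmin; rewrite ltnn.
    apply: le_trans (F_le S k) _.
    apply: (@le_trans _ _ (k2 * (Cp * C5) * n%:R)).
      rewrite -[leRHS]mulrA ler_pM2l// -mulrA.
      by apply: le_trans (phi_ge _ _ h) _; rewrite ler_pM2l.
    by rewrite ler_wpM2r// /B lerDr ltW// F_gt0.
  case: k Hk kmin h3 => [|k] Hk kmin _.
    apply: (@le_trans _ _ (U S 0 / Vh 0 * Vh (r n))).
      rewrite -mulrA ler_peMr ?(ltW (U_gt0 _ _))//.
      by rewrite mulrC ler_pdivlMr// mul1r Vh_mono// ltW.
    by rewrite ler_pM2r// lerDr ltW.
  have h : r0 * 2 ^+ k <= r n.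
    by rewrite leNgt; apply/negP => /ltW /kmin; rewrite ltnn.
  apply: le_trans (U_dbl S k) _; apply: (@le_trans _ _ (CD * Vh (r n))).
    by rewrite ler_pM2l//; apply: Vh_mono => //; exact: ltW (p2 k).
  by rewrite ler_pM2r// lerDl ltW.
have [Co Co0 HCo] := @on_diagonal R S A B.
have [Cf Cf0 HCf] := @off_diagonal_upper R S A.
have [b [Cl [Cl0 HCl]]] := @hk_lower R S A.
have [c Hc] := exp_unbounded (C5 * Cp) k11.
have A0 : 0 < A.
  have : 0 < C1 * Cp by rewrite mulr_gt0.
  by rewrite /A; have := Cm1; have := Ch1; lra.
pose E1 := Co + Cf * (CD * (k2 * Cp)) + A * (U S 0 * (Cp * F S 0)).
pose E2 := Cl * (CD ^+ (c + b) * (CD + U S 0 / Vh 0)) * (k2 ^+ (c + b) * B) +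
  Cl * (CD * (k2 * Cp)).
have V00 := Vh0 0 (lexx 0).
have E1_ge : [/\ Co <= E1, Cf * (CD * (k2 * Cp)) <= E1 &
    A * (U S 0 * (Cp * F S 0)) <= E1].
  by apply: sum3_ge; rewrite ?mulr_ge0// ltW.
have [E1o E1f E1a] := E1_ge.
have B0 : 0 < B by rewrite /B addr_gt0// !mulr_gt0.
have E20 : 0 < Cl * (CD ^+ (c + b) * (CD + U S 0 / Vh 0)) * (k2 ^+ (c + b) * B).
  by rewrite !mulr_gt0 ?exprn_gt0// addr_gt0// divr_gt0.
have E20' : 0 < Cl * (CD * (k2 * Cp)) by rewrite !mulr_gt0.
have E10 : 0 < E1 by apply: lt_le_trans E1o.
exists (E1 + E2); first by rewrite addr_gt0// /E2 addr_gt0.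
have E2p : 0 < E2 by rewrite /E2 addr_gt0.
move=> n x y n1; rewrite -/(r n).
have nR : 1 <= n%:R :> R by rewrite ler1n.
have n0 : 0 < n%:R :> R by rewrite ltr0n.
have d0 : 0 <= mdist x y by exact: mdist_ge0.
have Vd := Vh0 _ d0; have fd := phi_gt0 _ d0.
have [rn _ _] := HR n n1; rewrite -/(r n) in rn.
have Vr := Vh0 _ (ltW rn).
have [k [kr kB kn kU]] := scale n n1.
set mn := Num.min _ _.
have mn0 : 0 < mn by rewrite lt_min !divr_gt0// mulr_gt0.
split.
- apply: (@le_trans _ _ (E1 * mn)); last by rewrite ler_pM2r// lerDl ltW.
  apply/ler_addgt0Pr => e e0.
  have [j Hj] : exists j, [/\ mdist x y <= r0 * 2 ^+ j.+1 &
      (r0 * 2 ^+ j < mdist x y) \/ mdist x y <= r0].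
    have ex : exists j, mdist x y <= r0 * 2 ^+ j.+1.
      have [j Hj] := exp_unbounded (mdist x y / r0) (ltr1n R 2).
      exists j; rewrite -ler_pdivrMl// mulrC (le_trans Hj)//.
      by rewrite ler_weXn2l// ler1n.
    have [j Hj jmin] := ex_minnP ex; exists j; split => //.
    case: j Hj jmin => [|j] Hj jmin.
      by rewrite expr0 mulr1; case: (leP (mdist x y) r0) => h; [right|left].
    by left; rewrite ltNge; apply/negP => /jmin; rewrite ltnn.
  have [W [a [b' [_ h2 h3 _ h5]]]] := transfer n x y j e e0.
  apply: le_trans h2 _; rewrite lerD2r.
  suff [s1 s2] : hk (@m R S A W) (@J R S A W) n a b' <= E1 * (1 / Vh (r n)) /\
      hk (@m R S A W) (@J R S A W) n a b' <=
        E1 * (n%:R / (Vh (mdist x y) * phi (mdist x y))).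
    by rewrite /mn minElt; case: ifP.
  split.
    apply: (@le_trans _ _ (Co / U S k)).
      by apply: HCo; apply: le_trans kB _; rewrite ler_pM2l// ler_nat.
    rewrite div1r; apply: ler_pM => //; rewrite ?invr_ge0 ?(ltW Co0) ?(ltW (U_gt0 S k))//.
    by rewrite lef_pV2 ?posrE ?U_gt0//; apply: Vh_mono => //; exact: ltW.
  case: Hj => Hj [hlow|hsmall]; last first.
    (* below the distance [r0] all quantities are of order 1 *)
    apply: le_trans (hk_le_A n a b') _.
    rewrite mulrA ler_pdivlMr ?mulr_gt0//.
    have hV : Vh (mdist x y) <= U S 0 by rewrite /= expr0 mulr1; exact: Vh_mono.
    have hf : phi (mdist x y) <= Cp * F S 0 by apply: phi_le; rewrite d0 expr0 mulr1.
    apply: (@le_trans _ _ (A * (U S 0 * (Cp * F S 0)))).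
      by rewrite ler_pM2l//; apply: ler_pM => //; exact: ltW.
    by apply: le_trans E1a _; rewrite ler_peMr// ltW.
  apply: (@le_trans _ _ (Cf * n%:R / (U S j * F S j))).
    by apply: HCf => //; rewrite /lvl h3 -ltNge ltr_pdivlMr// mulrC.
  have Uj := U_gt0 S j; have Fj := F_gt0 S j.
  have hV : Vh (mdist x y) <= CD * U S j.
    by apply: le_trans (U_dbl S j); apply: Vh_mono.
  have hf : phi (mdist x y) <= k2 * Cp * F S j.
    apply: (@le_trans _ _ (Cp * F S j.+1)); first by apply: phi_le; rewrite d0.
    by rewrite (mulrC k2) -mulrA ler_pM2l// F_le.
  rewrite ler_pdivrMr ?mulr_gt0//.
  have -> : E1 * (n%:R / (Vh (mdist x y) * phi (mdist x y))) * (U S j * F S j) =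
      E1 * n%:R * (U S j * F S j) / (Vh (mdist x y) * phi (mdist x y)) by ring.
  rewrite ler_pdivlMr ?mulr_gt0//.
  apply: (@le_trans _ _ (Cf * n%:R * (CD * U S j * (k2 * Cp * F S j)))).
    rewrite ler_pM2l ?mulr_gt0//; apply: ler_pM => //; exact: ltW.
  have -> : Cf * n%:R * (CD * U S j * (k2 * Cp * F S j)) =
      Cf * (CD * (k2 * Cp)) * (n%:R * (U S j * F S j)) by ring.
  have -> : E1 * n%:R * (U S j * F S j) = E1 * (n%:R * (U S j * F S j)) by ring.
  by rewrite ler_pM2r ?mulr_gt0.
(* The scale used for the lower bound must exceed both that of the time [n] and
   that of the distance; the one that attains the maximum tells which term of
   the minimum is recovered. *)
have [jl jl1 jl2] : exists2 jl, mdist x y <= r0 * 2 ^+ jl &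
    forall i, (i < jl)%N -> r0 * 2 ^+ i < mdist x y.
  have ex : exists j, mdist x y <= r0 * 2 ^+ j.
    have [j Hj] := exp_unbounded (mdist x y / r0) (ltr1n R 2).
    by exists j; rewrite -ler_pdivrMl// mulrC.
  have [j Hj jmin] := ex_minnP ex; exists j => // i ij.
  by rewrite ltNge; apply/negP => /jmin; rewrite leqNgt ij.
pose K := maxn (k + c + b) jl.
have [W [a [b' [h1 _ h3 [h4 h4'] _]]]] := transfer n x y 0%N 1 ltr01.
apply: le_trans h1; have UK := U_gt0 S K; have FK := F_gt0 S K.
have nF : n%:R <= F S (k + c).
  apply: le_trans kn _; apply: le_trans (F_grow S c k).
  by rewrite ler_pM2r ?F_gt0.
have hK : n%:R / (Cl * (U S K * F S K)) <= hk (@m R S A W) (@J R S A W) n a b'.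
  apply: (HCl W n (k + c)%N K a b') => //; first by rewrite leq_maxl.
  rewrite /lvl h3 ler_pdivrMr// mulrC (le_trans jl1)// ler_pM2l//.
  by rewrite ler_weXn2l ?ler1n// leq_maxr.
apply: le_trans hK; rewrite mulrC ler_pdivrMr ?(addr_gt0 E10 E2p)//.
suff [h|h] : (1 / Vh (r n) <= n%:R / (Cl * (U S K * F S K)) * E2) \/
   (n%:R / (Vh (mdist x y) * phi (mdist x y)) <= n%:R / (Cl * (U S K * F S K)) * E2).
- apply: (@le_trans _ _ (n%:R / (Cl * (U S K * F S K)) * E2)).
    by apply: le_trans h; rewrite ge_min lexx.
  by rewrite ler_wpM2l ?lerDr ?(ltW E10)// divr_ge0// ltW// !mulr_gt0.
- apply: (@le_trans _ _ (n%:R / (Cl * (U S K * F S K)) * E2)).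
    by apply: le_trans h; rewrite ge_min lexx orbT.
  by rewrite ler_wpM2l ?lerDr ?(ltW E10)// divr_ge0// ltW// !mulr_gt0.
have [KE|KE] := leqP jl (k + c + b); [left|right].
  have {KE}KE : K = (k + (c + b))%N by rewrite /K addnA; apply/maxn_idPl.
  have hU : U S K <= CD ^+ (c + b) * ((CD + U S 0 / Vh 0) * Vh (r n)).
    rewrite KE; apply: le_trans (U_grow S (c + b) k) _.
    by rewrite ler_pM2l// exprn_gt0.
  have hF : F S K <= k2 ^+ (c + b) * (B * n%:R).
    rewrite KE; apply: le_trans (F_growr S (c + b) k) _.
    by rewrite ler_pM2l// exprn_gt0.
  rewrite mulrAC ler_pdivlMr ?mulr_gt0// div1r mulrC ler_pdivrMr//.
  apply: (@le_trans _ _ (Cl * (CD ^+ (c + b) * ((CD + U S 0 / Vh 0) * Vh (r n)) *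
     (k2 ^+ (c + b) * (B * n%:R))))).
    by rewrite ler_pM2l//; apply: ler_pM => //; exact: ltW.
  have -> : Cl * (CD ^+ (c + b) * ((CD + U S 0 / Vh 0) * Vh (r n)) *
     (k2 ^+ (c + b) * (B * n%:R))) =
     n%:R * (Cl * (CD ^+ (c + b) * (CD + U S 0 / Vh 0)) * (k2 ^+ (c + b) * B)) *
     Vh (r n) by ring.
  by rewrite ler_pM2r// ler_pM2l// /E2 lerDl ltW.
have {KE}[KE jl0] : K = jl /\ (0 < jl)%N.
  by split; [rewrite /K; apply/maxn_idPr; exact: ltnW|exact: leq_ltn_trans KE].
have jE : K = jl.-1.+1 by rewrite KE prednK.
have hlow : r0 * 2 ^+ jl.-1 < mdist x y by apply: jl2; rewrite prednK.
have hU : U S K <= CD * Vh (mdist x y).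
  rewrite jE; apply: le_trans (U_dbl S _) _; rewrite ler_pM2l//.
  by apply: Vh_mono; [exact: ltW (p2 _)|exact: ltW].
have hF : F S K <= k2 * (Cp * phi (mdist x y)).
  rewrite jE; apply: le_trans (F_le S _) _; rewrite ler_pM2l//.
  by apply: phi_ge; exact: ltW.
rewrite -[leRHS]mulrA ler_pM2l// [leRHS]mulrC ler_pdivlMr ?mulr_gt0//.
rewrite [leLHS]mulrC ler_pdivrMr ?mulr_gt0//.
apply: (@le_trans _ _ (Cl * (CD * Vh (mdist x y) * (k2 * (Cp * phi (mdist x y)))))).
  by rewrite ler_pM2l//; apply: ler_pM => //; exact: ltW.
have -> : Cl * (CD * Vh (mdist x y) * (k2 * (Cp * phi (mdist x y)))) =
  Cl * (CD * (k2 * Cp)) * (Vh (mdist x y) * phi (mdist x y)) by ring.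
by rewrite ler_pM2r ?mulr_gt0// /E2 lerDr ltW.
Qed.
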